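(* Let $n\ge1$ and $d\ge0$. The congruences on the $d$-twisted partition monoid $\mathcal P^\Phi_{n,d}$ are precisely the relations $\mathsf{cg}(M)$, where $M$ is any finitary C-matrix (fC-matrix).
   Context: **Partitions.** The partition monoid $\mathcal P_n$ ($n\ge1$) consists of all set partitions of $X\cup X'$, where $X=\{1,\dots,n\}$, $X'=\{1',\dots,n'\}$. A partition is identified with any graph on $X\cup X'$ whose connected components are its blocks. For $\alpha,\beta\in\mathcal P_n$, let $X''=\{1'',\dots,n''\}$; rename each lower vertex $x'$ of $\alpha$ as $x''$ and each upper vertex $x$ of $\beta$ as $x''$, and let the product graph $\Gamma(\alpha,\beta)$ on $X\cup X''\cup X'$ be the union of the two resulting graphs. The product $\alpha\beta$ is the partition in which $x,y\in X\cup X'$ lie in the same block iff they lie in the same connected component of $\Gamma(\alpha,\beta)$. $\Phi(\alpha,\beta)$ is the number of connected components of $\Gamma(\alpha,\beta)$ contained in $X''$. A transversal of $\alpha$ is a block meeting both $X$ and $X'$; $\operatorname{rank}\alpha$ is the number of transversals. $\widehat\alpha$ is the rank-$0$ partition obtained from $\alpha$ by splitting each transversal $A\cup B'$ into $A$ and $B'$. Green's relations $\mathscr R,\mathscr L,\mathscr H=\mathscr R\cap\mathscr L$ on $\mathcal P_n$ are the usual ones. If $\alpha\,\mathscr H\,\beta$ have rank $q$ and $\alpha$ has transversals $A_i\cup B_i'$ ($1\le i\le q$), then $\beta$ has transversals $A_i\cup B_{i\pi}'$ for some $\pi\in\mathcal S_q$ (symmetric group), and we put $\partial(\alpha,\beta)=\pi$;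 this is well defined up to conjugacy in $\mathcal S_q$. **$d$-twisted partition monoid.** $\mathcal P^\Phi_{n,d}=(\{0,1,\dots,d\}\times\mathcal P_n)\cup\{\mathbf 0\}$, where $(i,\alpha)(j,\beta)=(i+j+\Phi(\alpha,\beta),\alpha\beta)$ if $i+j+\Phi(\alpha,\beta)\le d$, and all other products equal $\mathbf 0$. **fC-matrices.** An fC-matrix is a matrix $M=(M_{qi})_{q\in\{0,\dots,n\},\,i\in\{0,\dots,d\}}$ with entries from $\{\Delta,\mu^\uparrow,\mu^\downarrow,\mu,R\}\cup\{N:\{\mathrm{id}_q\}\ne N\trianglelefteq\mathcal S_q,\ 2\le q\le n\}$ (entries of the second set are $N$-symbols) such that rows $0,1$ are jointly of one of the types fRT1–fRT4, each row $q\ge2$ is of type fRT5, and (V1), (V2) hold. Below $j$ ranges over $\{0,\dots,d\}$ and $\zeta\in\{\mu,\mu^\uparrow,\mu^\downarrow,\Delta\}$. - fRT1: for some $0\le k\le d+1$: $M_{0j}=M_{1j}=\Delta$ for $j<k$ and $M_{0j}=M_{1j}=R$ for $j\ge k$. - fRT2: for some $0\le i<k\le d$: $M_{0j}=\Delta$ for $j<i$, $\mu$ for $i\le j<k$, $R$ for $j\ge k$; $M_{1j}=\Delta$ for $j<i$, $M_{1i}=\zeta$, $M_{1j}=\mu$ for $i<j\le k$, $R$ for $j\ge k+1$. - fRT3: for some $0\le k<l\le d+1$: $M_{0j}=\Delta$ for $j<k$, $R$ for $j\ge k$; $M_{1j}=\Delta$ for $j<l-1$, $M_{1,l-1}=\zeta$,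 $M_{1j}=R$ for $j\ge l$. - fRT4: for some $0<k<l-1\le d$: $M_{0j}=\Delta$ for $j<k-1$, $M_{0,k-1}=\mu$, $M_{0j}=R$ for $j\ge k$; $M_{1j}=\Delta$ for $j<l-1$, $M_{1,l-1}=\mu$, $M_{1j}=R$ for $j\ge l$. - fRT5 (row $q\ge2$): for some $0\le i\le k\le d+1$ and non-trivial normal subgroups $N_i\le\cdots\le N_{k-1}$ of $\mathcal S_q$: $M_{qj}=\Delta$ for $j<i$, $N_j$ for $i\le j<k$, $R$ for $j\ge k$. - (V1) An $N$-symbol cannot be immediately above (position $(q,i)$ over position $(q-1,i)$) $\Delta$, $\mu^\uparrow$, $\mu^\downarrow$ or another $N$-symbol. - (V2) Every entry $R$ in a row $q\ge2$ is directly above an entry $R$ in row $q-1$. For an fC-matrix $M$, $\min_q(M)$ denotes the least $i$ with $M_{qi}=R$, or $d+1$ if row $q$ contains no $R$. **The relation $\mathsf{cg}(M)$** on $\mathcal P_{n,d}^\Phi$ consists of all pairs $((i,\alpha),(j,\beta))$ such that, with $q=\operatorname{rank}\alpha$, $r=\operatorname{rank}\beta$, one of the following holds: - (fC1) $M_{qi}=M_{rj}=\Delta$, $i=j$ and $\alpha=\beta$; - (fC2) $M_{qi}=M_{rj}=R$; - (fC3) $M_{qi}=M_{rj}=N$ (an $N$-symbol; so $q=r$), $i=j$, $\alpha\,\mathscr H\,\beta$ and $\partial(\alpha,\beta)\in N$; - (fC4) $M_{qi}=M_{rj}=\mu^\downarrow$, $\widehat\alpha=\widehat\beta$ and $\alpha\,\mathscr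 L\,\beta$; - (fC5) $M_{qi}=M_{rj}=\mu^\uparrow$, $\widehat\alpha=\widehat\beta$ and $\alpha\,\mathscr R\,\beta$; - (fC6) $M_{qi}=M_{rj}=\mu$, $\widehat\alpha=\widehat\beta$, and either $(q,i)=(r,j)$ or $i-j=\min_q(M)-\min_r(M)$; together with (fC7) the pairs $((i,\alpha),\mathbf 0)$ and $(\mathbf 0,(i,\alpha))$ with $M_{qi}=R$ where $q=\operatorname{rank}\alpha$, and (fC8) the pair $(\mathbf 0,\mathbf 0)$. *)

(* Defs.v *)
From HB Require Import structures.
From Stdlib Require Export RelationClasses.
From mathcomp Require Export all_boot all_order all_algebra all_fingroup.

Set Implicit Arguments.
Unset Strict Implicit.
Unset Printing Implicit Defensive.

(* Points of X u X': [inl x] is the upper vertex x, [inr x] the lower vertex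
   x'. *)
Notation vertex n := ('I_n + 'I_n)%type.

Record partn (n : nat) := Partn {
  blocks :> {set {set vertex n}};
  blocksP : partition blocks [set: vertex n]
}.

HB.instance Definition _ n := [isSub for @blocks n].
HB.instance Definition _ n := [Finite of partn n by <:].

Section Partitions.
Variable n : nat.
Implicit Types (alpha beta : partn n) (u v : vertex n) (B : {set vertex n}).

Definition same_block alpha u v : bool := v \in pblock (blocks alpha) u.

(* Vertices of product graphs: [inl u] for u in X u X', and [inr x] for the
   middle vertex x''. *)
Definition pvertex : finType := (vertex n + 'I_n)%type.

Definition embed_top u : pvertex :=
  match u with inl x => inl (inl x) | inr x => inr x end.
Definition embed_bot u : pvertex :=
  match u with inl x => inr x | inr x => inl (inr x) end.

Definition product_graph alpha beta : rel pvertex := fun a b =>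
     [exists u, exists v,
       [&& same_block alpha u v, a == embed_top u & b == embed_top v]]
  || [exists u, exists v,
       [&& same_block beta u v, a == embed_bot u & b == embed_bot v]].

Lemma same_block_sym alpha : symmetric (same_block alpha).
Proof.
have [/eqP cov tI n0] := and3P (blocksP alpha).
by move=> u v; rewrite /same_block -!eq_pblock ?cov ?inE // eq_sym.
Qed.

Lemma product_graph_sym alpha beta : symmetric (product_graph alpha beta).
Proof.
move=> a b; rewrite /product_graph; congr (_ || _);
  apply/existsP/existsP => -[u /existsP[v /and3P[uv au bv]]];
  by exists v; apply/existsP; exists u; rewrite same_block_sym uv au bv.
Qed.

Lemma connect_product_equiv alpha beta :
  equivalence_rel (connect (product_graph alpha beta)).
Proof.
apply/equivalence_relP; split=> [a | a b ab]; first exact: connect0.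
exact: same_connect (sym_connect_sym (product_graph_sym alpha beta)) _ _ ab.
Qed.

Definition mulp_blocks alpha beta : {set {set vertex n}} :=
  equivalence_partition
    (fun u v => connect (product_graph alpha beta) (inl u) (inl v))
    [set: vertex n].

Lemma mulp_blocksP alpha beta :
  partition (mulp_blocks alpha beta) [set: vertex n].
Proof.
apply: equivalence_partitionP => u v w _ _ _.
exact: connect_product_equiv.
Qed.

Definition mulp alpha beta : partn n := Partn (mulp_blocksP alpha beta).

Definition Phi alpha beta : nat :=
  #|[set C in equivalence_partition (connect (product_graph alpha beta))
                                    [set: pvertex]
      | C \subset [set a | if a is inr _ then true else false]]|.

Definition upper B : {set vertex n} :=
  [set u in B | if u is inl _ then true else false].
Definition lower B : {set vertex n} :=
  [set u in B | if u is inr _ then true else false].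

Definition transversals alpha : {set {set vertex n}} :=
  [set B in blocks alpha | (upper B != set0) && (lower B != set0)].

Definition rank alpha : nat := #|transversals alpha|.

Definition hat_blocks alpha : {set {set vertex n}} :=
  (blocks alpha :\: transversals alpha)
  :|: [set upper B | B in transversals alpha]
  :|: [set lower B | B in transversals alpha].

Lemma hat_blocksP alpha : partition (hat_blocks alpha) [set: vertex n].
Proof.
have [/eqP cov tI n0] := and3P (blocksP alpha).
have UL B : B = upper B :|: lower B.
  by apply/setP => -[x | x]; rewrite !inE ?andbT ?andbF ?orbF.
have hatE C : C \in hat_blocks alpha -> C != set0 /\
    exists2 B, B \in blocks alpha & C = upper B \/ C = lower B.
  case/setUP => [/setUP[|] |].
  - rewrite !inE negb_and => /andP[nT BC]; split.
      by apply: contraNneq n0 => <-.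
    exists C => //; move: nT; rewrite BC /= negb_and !negbK.
    by case/orP => /eqP E; [right | left];
      rewrite {1}(UL C) E ?set0U ?setU0.
  - case/imsetP => B; rewrite inE => /and3P[BC u0 l0] ->.
    by split=> //; exists B => //; left.
  - case/imsetP => B; rewrite inE => /and3P[BC u0 l0] ->.
    by split=> //; exists B => //; right.
apply/and3P; split.
- apply/eqP/setP => u; rewrite inE; apply/bigcupP.
  have: u \in cover alpha by rewrite cov inE.
  case/bigcupP => B BC uB; case TB: (B \in transversals alpha).
    case: u uB => x uB; [exists (upper B) | exists (lower B)];
      rewrite ?inE ?uB //.
    + by apply/orP; left; apply/orP; right; apply: imset_f.
    + by apply/orP; right; apply: imset_f.
  by exists B; rewrite // !in_setU in_setD TB BC.
- apply/trivIsetP => C1 C2 /hatE[_ [B1 B1C E1]] /hatE[_ [B2 B2C E2]].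
  apply: contraR => /pred0Pn[u /= /andP[u1 u2]].
  have uB C B : C = upper B \/ C = lower B -> u \in C -> u \in B.
    by case=> ->; rewrite inE => /andP[].
  have EB : B1 = B2.
    by rewrite -(def_pblock tI B1C (uB _ _ E1 u1))
               -(def_pblock tI B2C (uB _ _ E2 u2)).
  by move: u1 u2; case: E1 E2 => -> [] ->; rewrite EB // !inE;
    case: u {uB} => x; rewrite ?andbF.
- by apply/negP => /hatE[/eqP].
Qed.

Definition hat alpha : partn n := Partn (hat_blocksP alpha).

(* Green's relations: equality of the principal one-sided ideals
   alpha S^1 and S^1 alpha. *)
Definition right_ideal alpha : {set partn n} :=
  alpha |: [set mulp alpha gamma | gamma : partn n].
Definition left_ideal alpha : {set partn n} :=
  alpha |: [set mulp gamma alpha | gamma : partn n].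

Definition greenR alpha beta : bool := right_ideal alpha == right_ideal beta.
Definition greenL alpha beta : bool := left_ideal alpha == left_ideal beta.
Definition greenH alpha beta : bool := greenR alpha beta && greenL alpha beta.

Definition block_of (A B : {set 'I_n}) : {set vertex n} :=
  [set inl x | x in A] :|: [set inr y | y in B].

(* [perm_diff alpha beta pi] says that pi is a value of the permutation
   difference of alpha and beta, for some numbering A_i u B_i' of the
   transversals of alpha; the value depends on the numbering, but only up to
   conjugacy.  Permutations act on the right, as in MathComp. *)
Definition perm_diff q alpha beta (pi : 'S_q) : Prop :=
  exists A B : 'I_q -> {set 'I_n},
    [/\ injective (fun i => block_of (A i) (B i)),
        transversals alpha = [set block_of (A i) (B i) | i : 'I_q]
      & transversals beta = [set block_of (A i) (B (pi i)) | i : 'I_q]].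

End Partitions.

(* [None] is the zero element. *)
Definition twisted (n d : nat) : Type := option ('I_d.+1 * partn n).

Definition tmul n d (x y : twisted n d) : twisted n d :=
  match x, y with
  | Some (i, alpha), Some (j, beta) =>
      let k := i + j + Phi alpha beta in
      if k <= d then Some (inord k, mulp alpha beta) else None
  | _, _ => None
  end.

Definition congruence (T : Type) (mul : T -> T -> T)
    (sigma : T -> T -> Prop) : Prop :=
  [/\ Equivalence sigma,
      forall x y z, sigma x y -> sigma (mul z x) (mul z y)
    & forall x y z, sigma x y -> sigma (mul x z) (mul y z)].

Inductive symbol : Type :=
  | Delta | MuUp | MuDown | Mu | RR
  | Nsym (q : nat) (N : {group 'S_q}).

Definition is_N (s : symbol) : bool :=
  if s is Nsym _ _ then true else false.
Definition is_R (s : symbol) : bool :=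
  if s is RR then true else false.

Definition is_zeta (s : symbol) : Prop :=
  [\/ s = Mu, s = MuUp, s = MuDown | s = Delta].

Section FCMatrices.
Variables n d : nat.
Implicit Type M : 'M[symbol]_(n.+1, d.+1).

(* Meaningful for q <= n and i <= d only, and used only there. *)
Definition entry M (q i : nat) : symbol := M (inord q) (inord i).

Definition fRT1 M : Prop :=
  exists2 k, k <= d.+1 &
  forall j, j <= d ->
    entry M 0 j = (if j < k then Delta else RR) /\
    entry M 1 j = (if j < k then Delta else RR).

Definition fRT2 M : Prop :=
  exists i k zeta,
  [/\ i < k, k <= d, is_zeta zeta &
  forall j, j <= d ->
    entry M 0 j = (if j < i then Delta else if j < k then Mu else RR) /\
    entry M 1 j = (if j < i then Delta else if j == i then zeta
                   else if j <= k then Mu else RR)].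

(* Here and in [fRT4], j.+1 < l and j.+1 == l encode j < l-1 and j = l-1. *)
Definition fRT3 M : Prop :=
  exists k l zeta,
  [/\ k < l, l <= d.+1, is_zeta zeta &
  forall j, j <= d ->
    entry M 0 j = (if j < k then Delta else RR) /\
    entry M 1 j = (if j.+1 < l then Delta else if j.+1 == l then zeta
                   else RR)].

Definition fRT4 M : Prop :=
  exists k l,
  [/\ 0 < k, k < l.-1, l.-1 <= d &
  forall j, j <= d ->
    entry M 0 j = (if j.+1 < k then Delta else if j.+1 == k then Mu
                   else RR) /\
    entry M 1 j = (if j.+1 < l then Delta else if j.+1 == l then Mu
                   else RR)].

Definition fRT5 M (q : nat) : Prop :=
  exists i k (N : nat -> {group 'S_q}),
  [/\ i <= k <= d.+1,
      forall j, i <= j < k -> (N j <| [set: 'S_q])%g /\ N j :!=: 1%g,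
      forall j j', i <= j -> j <= j' -> j' < k -> N j \subset N j' &
      forall j, j <= d ->
        entry M q j = (if j < i then Delta else if j < k then Nsym (N j)
                       else RR)].

Definition V1 M : Prop :=
  forall q i, q < n -> i <= d -> is_N (entry M q.+1 i) ->
    ~ [\/ entry M q i = Delta, entry M q i = MuUp, entry M q i = MuDown
        | is_N (entry M q i)].

Definition V2 M : Prop :=
  forall q i, 1 < q <= n -> i <= d -> entry M q i = RR ->
    entry M q.-1 i = RR.

(* The row types force every N-symbol [Nsym q N] to lie in row q, with
   2 <= q <= n and N a non-trivial normal subgroup of S_q. *)
Definition fC_matrix M : Prop :=
  [/\ [\/ fRT1 M, fRT2 M, fRT3 M | fRT4 M],
      forall q, 1 < q <= n -> fRT5 M q,
      V1 M
    & V2 M].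

(* The length d.+1 of the list if there is no R in row q. *)
Definition min_row M (q : nat) : nat :=
  find (fun i => is_R (entry M q i)) (iota 0 d.+1).

Definition cg_nz M (i : nat) (alpha : partn n) (j : nat) (beta : partn n) :
    Prop :=
  let q := rank alpha in
  let r := rank beta in
  let Mqi := entry M q i in
  let Mrj := entry M r j in
  [/\ Mqi = Delta, Mrj = Delta, i = j & alpha = beta]
  \/ (Mqi = RR /\ Mrj = RR)
  \/ (exists N : {group 'S_q},
      [/\ Mqi = Nsym N /\ Mrj = Nsym N, i = j, greenH alpha beta
        & exists2 pi : 'S_q, perm_diff alpha beta pi & pi \in N])
  \/ [/\ Mqi = MuDown, Mrj = MuDown, hat alpha = hat beta
                & greenL alpha beta]
  \/ [/\ Mqi = MuUp, Mrj = MuUp, hat alpha = hat beta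
                & greenR alpha beta]
  \/ [/\ Mqi = Mu, Mrj = Mu, hat alpha = hat beta
                & (q, i) = (r, j) \/
                  (i%:Z - j%:Z = (min_row M q)%:Z - (min_row M r)%:Z)%R].

Definition cg M (x y : twisted n d) : Prop :=
  match x, y with
  | Some (i, alpha), Some (j, beta) => cg_nz M i alpha j beta
  | Some (i, alpha), None | None, Some (i, alpha) =>
      entry M (rank alpha) i = RR
  | None, None => True
  end.

End FCMatrices.

(* Main.v *)
From HB Require Import structures.
From mathcomp Require boolp.
From mathcomp Require Import zify.
Require Import Defs.

(** A partition is studied through three relations on points: [up] and [dn],
    the restrictions of its block relation to upper and to lower vertices, and
    [tr], from upper to lower ones. What a product [pmul gamma alpha] takes
    from [gamma] is contained in [mid], connectedness on upper and middle
    vertices, which depends on [alpha] through [up alpha] only. Exchanging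
    upper and lower vertices is an anti-automorphism [dual], so that each
    one-sided argument serves twice. Levels above [d] are read as the zero
    element ([elt]), and matrix entries beyond [d] as [RR] ([xentry]); both
    then obey uniform rules.

    The relation of an fC-matrix is a congruence ([cg_congruence]). By duality
    left multiplication is enough ([xcg_left]). For partitions of rank at most
    1 with the same hat, a multiplication changes level minus rank by the same
    amount ([Phi_hat]), so the claim is one about the positions of the symbols
    in rows 0 and 1 ([row_facts]). A pair covered by an N-symbol keeps its
    permutation as long as its rank is kept ([greenH_mul]). If the rank drops,
    the symbol below matters: either it is [RR], or q = 2 and it is [Mu], and
    two swapped transversals cannot be told apart once one of them is lost or
    they are merged ([hat_mul2]).

    Every congruence comes from an fC-matrix ([fC_matrix_of], [sigma_cg]). The
    class of the zero element is an ideal, and consists of the partitions of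
    rank q from a threshold level on ([in_zero_reach]); this gives the entries
    [RR]. The rest of the proof shows that a related pair outside this class
    differs in few ways. The recurring argument multiplies both elements by a
    partition that cuts some points off from above. If these points are cut
    off in one of the two only, then on one side a component floats, which
    raises the level, or a transversal is lost. An element that is related to
    its own shift to a higher level is related to zero ([s_iter]), so:
    - for rank at most 1 the kernels agree ([split_kernel_zero]);
    - elements of positive rank have equal levels ([level_gap_zero]);
    - a rank of at least 2 is shared by both elements ([rank_drop_zero]), and
      then they are H-related ([related_H]).
    In ranks q >= 2 the relation is hence given by the permutations that occur,
    and these form a normal subgroup ([Ngrp]). A nontrivial permutation puts
    rank q - 1 into the class of zero if q >= 3 ([perm_kill]); if q = 2 it
    relates rank-one partitions that differ in one half of the transversal, and
    does so for both halves ([perm2_Lpair], [perm2_Rpair]). This is [V1].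

    In ranks 0 and 1 there remain pairs of rank one with equal hats
    ([Lpair], [Rpair]) and links between a rank-one partition and its hat
    ([linked]). A pair at level i produces a link between level i + 1 of rank 1
    and level i of rank 0 ([Lpair_link]). Links can be shifted, and their two
    ends reach the class of zero together; a link also relates two copies of
    one rank-zero element, so the levels of its ends differ by one, or it
    stands at the very end of both rows ([linked_facts]). What these
    constraints leave are the four types of rows 0 and 1 ([rows01]). *)

Set Implicit Arguments.
Unset Strict Implicit.
Unset Printing Implicit Defensive.

(** * Partitions as relations, and their products *)

(** Sealed copies of the product and of the number of floating components:
    unification would otherwise unfold the connectivity computations. *)
HB.lock Definition pmul n (alpha beta : partn n) : partn n := mulp alpha beta.
HB.lock Definition phi n (alpha beta : partn n) : nat := Phi alpha beta.

Section Rels.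
Variable n : nat.
Implicit Types (alpha beta gamma : partn n) (x y z : 'I_n) (u v : vertex n).

Lemma pmulE alpha beta : pmul alpha beta = mulp alpha beta.
Proof. by rewrite pmul.unlock. Qed.
Lemma phiE alpha beta : phi alpha beta = Phi alpha beta.
Proof. by rewrite phi.unlock. Qed.

Lemma same_block_refl alpha u : same_block alpha u u.
Proof.
have [/eqP cov _ _] := and3P (blocksP alpha).
by rewrite /same_block mem_pblock cov inE.
Qed.

Lemma same_blockE alpha u v :
  same_block alpha u v = (pblock (blocks alpha) u == pblock (blocks alpha) v).
Proof.
have [/eqP cov tI _] := and3P (blocksP alpha).
by rewrite /same_block eq_pblock // cov inE.
Qed.

Lemma same_block_trans alpha : transitive (same_block alpha).
Proof. by move=> v u w; rewrite !same_blockE => /eqP-> /eqP->. Qed.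

Lemma same_block_sub alpha beta :
  same_block alpha =2 same_block beta -> blocks alpha \subset blocks beta.
Proof.
move=> eqab; have [/eqP cova tIa n0a] := and3P (blocksP alpha).
have [/eqP covb tIb n0b] := and3P (blocksP beta).
apply/subsetP => B Ba; have [u uB] : exists u, u \in B.
  by apply/set0Pn; apply: contraNneq n0a => <-.
suff -> : B = pblock (blocks beta) u by rewrite pblock_mem // covb inE.
rewrite -(def_pblock tIa Ba uB); apply/setP => v; exact: eqab.
Qed.

Lemma partn_ext alpha beta :
  same_block alpha =2 same_block beta -> alpha = beta.
Proof.
move=> eqab; apply: val_inj; apply/eqP; rewrite eqEsubset /=.
by rewrite !same_block_sub // => u v; rewrite eqab.
Qed.

(** Three relations on points, in place of one on vertices, let a product be
    computed relation by relation: [up_mul], [tr_mulP], [dn_mulP]. *)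
Definition up alpha x y := same_block alpha (inl x) (inl y).
Definition dn alpha x y := same_block alpha (inr x) (inr y).
Definition tr alpha x y := same_block alpha (inl x) (inr y).

Lemma partn_ext3 alpha beta :
  up alpha =2 up beta -> dn alpha =2 dn beta -> tr alpha =2 tr beta ->
  alpha = beta.
Proof.
move=> eu ed et; apply: partn_ext => -[x|x] [y|y].
- exact: eu.
- exact: et.
- by rewrite same_block_sym [RHS]same_block_sym; exact: et.
- exact: ed.
Qed.

Lemma up_refl alpha x : up alpha x x. Proof. exact: same_block_refl. Qed.
Lemma dn_refl alpha x : dn alpha x x. Proof. exact: same_block_refl. Qed.
Lemma up_sym alpha x y : up alpha x y = up alpha y x.
Proof. exact: same_block_sym. Qed.
Lemma dn_sym alpha x y : dn alpha x y = dn alpha y x.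
Proof. exact: same_block_sym. Qed.
Lemma up_trans alpha y x z : up alpha x y -> up alpha y z -> up alpha x z.
Proof. exact: same_block_trans. Qed.
Lemma dn_trans alpha y x z : dn alpha x y -> dn alpha y z -> dn alpha x z.
Proof. exact: same_block_trans. Qed.
Lemma up_tr alpha x' x y : up alpha x x' -> tr alpha x' y -> tr alpha x y.
Proof. exact: same_block_trans. Qed.
Lemma tr_dn alpha y' x y : tr alpha x y' -> dn alpha y' y -> tr alpha x y.
Proof. exact: same_block_trans. Qed.
Lemma tr_up alpha x x' y : tr alpha x y -> tr alpha x' y -> up alpha x x'.
Proof.
by move=> h1 h2; apply: same_block_trans h1 _; rewrite same_block_sym.
Qed.
Lemma tr_dn2 alpha x y y' : tr alpha x y -> tr alpha x y' -> dn alpha y y'.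
Proof.
move=> h1 h2; apply: same_block_trans h2.
by rewrite same_block_sym.
Qed.

Definition dom alpha := [set x | [exists y, tr alpha x y]].
Definition cod alpha := [set y | [exists x, tr alpha x y]].

Lemma domP alpha x : reflect (exists y, tr alpha x y) (x \in dom alpha).
Proof. by rewrite inE; apply: existsP. Qed.
Lemma codP alpha y : reflect (exists x, tr alpha x y) (y \in cod alpha).
Proof. by rewrite inE; apply: existsP. Qed.
Lemma tr_dom alpha x y : tr alpha x y -> x \in dom alpha.
Proof. by move=> h; apply/domP; exists y. Qed.
Lemma tr_cod alpha x y : tr alpha x y -> y \in cod alpha.
Proof. by move=> h; apply/codP; exists x. Qed.
Lemma up_dom alpha x x' : up alpha x x' -> (x \in dom alpha) = (x' \in dom alpha).
Proof.
move=> h; apply/domP/domP => -[y xy]; exists y; last exact: up_tr xy.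
by apply: up_tr xy; rewrite up_sym.
Qed.
Lemma dn_cod alpha x x' : dn alpha x x' -> (x \in cod alpha) = (x' \in cod alpha).
Proof.
move=> h; apply/codP/codP => -[y xy]; exists y; first exact: tr_dn xy _.
by apply: tr_dn xy _; rewrite dn_sym.
Qed.

Lemma eqrel_label (T : eqType) (f : vertex n -> T) :
  {in [set: vertex n] & &, equivalence_rel (fun u v => f u == f v)}.
Proof. by move=> u v r _ _ _; split=> // /eqP->. Qed.

(** All auxiliary partitions are given by labellings of the vertices; the
    blocks are the fibres. *)
Definition Lab (T : eqType) (f : vertex n -> T) : partn n :=
  Partn (equivalence_partitionP (eqrel_label f)).

Lemma same_block_Lab (T : eqType) (f : vertex n -> T) u v :
  same_block (Lab f) u v = (f u == f v).
Proof.
rewrite /same_block /= pblock_equivalence_partition ?inE //.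
by move=> a b c _ _ _; split=> // /eqP->.
Qed.

Definition lab2 (T : eqType) (c a : 'I_n -> T) : partn n :=
  Lab (fun u => match u with inl x => c x | inr y => a y end).

Lemma up_lab2 (T : eqType) (c a : 'I_n -> T) x y :
  up (lab2 c a) x y = (c x == c y).
Proof. exact: same_block_Lab. Qed.
Lemma dn_lab2 (T : eqType) (c a : 'I_n -> T) x y :
  dn (lab2 c a) x y = (a x == a y).
Proof. exact: same_block_Lab. Qed.
Lemma tr_lab2 (T : eqType) (c a : 'I_n -> T) x y :
  tr (lab2 c a) x y = (c x == a y).
Proof. exact: same_block_Lab. Qed.

Definition swap_side u : vertex n := match u with inl x => inr x | inr x => inl x end.
Lemma swap_sideK : involutive swap_side. Proof. by case. Qed.

(** The mirror image. It reverses products ([dual_mul]) and preserves the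
    number of floating components ([Phi_dual]), which transfers every one-sided
    result to the other side. *)
Definition dual alpha := Lab (fun u => pblock (blocks alpha) (swap_side u)).
Lemma same_block_dual alpha u v :
  same_block (dual alpha) u v = same_block alpha (swap_side u) (swap_side v).
Proof. by rewrite same_block_Lab same_blockE. Qed.
Lemma dualK : involutive dual.
Proof.
by move=> alpha; apply: partn_ext => u v; rewrite !same_block_dual !swap_sideK.
Qed.
Lemma up_dual alpha x y : up (dual alpha) x y = dn alpha x y.
Proof. exact: same_block_dual. Qed.
Lemma dn_dual alpha x y : dn (dual alpha) x y = up alpha x y.
Proof. exact: same_block_dual. Qed.
Lemma tr_dual alpha x y : tr (dual alpha) x y = tr alpha y x.
Proof. by rewrite /tr same_block_dual /= same_block_sym. Qed.
Lemma dom_dual alpha : dom (dual alpha) = cod alpha.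
Proof.
by apply/setP => x; apply/domP/codP => -[y h]; exists y; rewrite tr_dual in h *.
Qed.
Lemma cod_dual alpha : cod (dual alpha) = dom alpha.
Proof. by rewrite -dom_dual dualK. Qed.

Definition mid_edge gamma alpha : rel (vertex n) := fun u v =>
  same_block gamma u v ||
  match u, v with inr x, inr y => up alpha x y | _, _ => false end.
(** Connectedness on the upper and middle vertices of the product graph. A
    lower vertex is attached to these through its block in [alpha] or not at
    all, so this is what the product needs to know of [gamma]. *)
Definition mid gamma alpha := connect (mid_edge gamma alpha).

Lemma mid_edge_sym gamma alpha : symmetric (mid_edge gamma alpha).
Proof.
move=> u v; rewrite /mid_edge same_block_sym; congr (_ || _).
by case: u v => [x|x] [y|y] //; rewrite up_sym.
Qed.
Lemma mid_sym gamma alpha u v : mid gamma alpha u v = mid gamma alpha v u.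
Proof. exact/sym_connect_sym/mid_edge_sym. Qed.
Lemma mid_trans gamma alpha v u w :
  mid gamma alpha u v -> mid gamma alpha v w -> mid gamma alpha u w.
Proof. exact: connect_trans. Qed.
Lemma mid_refl gamma alpha u : mid gamma alpha u u.
Proof. exact: connect0. Qed.
Lemma mid_left gamma alpha u v : same_block gamma u v -> mid gamma alpha u v.
Proof. by move=> h; apply: connect1; rewrite /mid_edge h. Qed.
Lemma mid_right gamma alpha x y :
  up alpha x y -> mid gamma alpha (inr x) (inr y).
Proof. by move=> h; apply: connect1; rewrite /mid_edge h orbT. Qed.

Lemma mid_min gamma alpha (T : eqType) (f : vertex n -> T) :
  (forall u v, same_block gamma u v -> f u = f v) ->
  (forall x y, up alpha x y -> f (inr x) = f (inr y)) ->
  forall u v, mid gamma alpha u v -> f u = f v.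
Proof.
move=> h1 h2 u v /connectP[p]; elim: p u => [|w p IH] u /=; first by move=> _ ->.
case/andP => e pw lv; rewrite -(IH w) //; case/orP: e => [/h1//|].
by case: u w {pw lv IH} => [//|x] [//|y] /h2.
Qed.

Lemma product_graph_csym gamma alpha : connect_sym (product_graph gamma alpha).
Proof. exact/sym_connect_sym/product_graph_sym. Qed.

Lemma pg_top gamma alpha u v : same_block gamma u v ->
  connect (product_graph gamma alpha) (embed_top u) (embed_top v).
Proof.
move=> h; apply: connect1; apply/orP; left.
by apply/existsP; exists u; apply/existsP; exists v; rewrite h !eqxx.
Qed.
Lemma pg_bot gamma alpha u v : same_block alpha u v ->
  connect (product_graph gamma alpha) (embed_bot u) (embed_bot v).
Proof.
move=> h; apply: connect1; apply/orP; right.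
by apply/existsP; exists u; apply/existsP; exists v; rewrite h !eqxx.
Qed.

Lemma mid_pg gamma alpha u v : mid gamma alpha u v ->
  connect (product_graph gamma alpha) (embed_top u) (embed_top v).
Proof.
move/connectP => [p]; elim: p u => [|w p IH] u /=; first by move=> _ ->.
case/andP => e pw lv; apply: connect_trans (IH _ pw lv).
case/orP: e => [/pg_top//|].
by case: u w {pw lv IH} => [//|x] [//|y] /(@pg_bot gamma alpha (inl x) (inl y)).
Qed.

(** A complete invariant of the components of the product graph: the
    component for [mid] that a vertex is attached to or, for a lower vertex off
    the transversals of [alpha], its block. *)
Definition comp_label gamma alpha (a : pvertex n) : vertex n + {set vertex n} :=
  match a with
  | inl (inl x) => inl (fingraph.root (mid_edge gamma alpha) (inl x))
  | inr z => inl (fingraph.root (mid_edge gamma alpha) (inr z))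
  | inl (inr y) => if [pick z | tr alpha z y] is Some z
                   then inl (fingraph.root (mid_edge gamma alpha) (inr z))
                   else inr (pblock (blocks alpha) (inr y))
  end.

Lemma root_mid gamma alpha u v :
  (fingraph.root (mid_edge gamma alpha) u == fingraph.root (mid_edge gamma alpha) v)
  = mid gamma alpha u v.
Proof. by apply: root_connect; apply/sym_connect_sym/mid_edge_sym. Qed.

Lemma comp_labelE gamma alpha a b :
  connect (product_graph gamma alpha) a b = (comp_label gamma alpha a == comp_label gamma alpha b).
Proof.
set e := mid_edge gamma alpha; set l := comp_label gamma alpha.
have topE u : l (embed_top u) = inl (fingraph.root e u) by case: u.
have midr x y : up alpha x y -> fingraph.root e (inr x) = fingraph.root e (inr y).
  by move=> h; apply/eqP; rewrite root_mid mid_right.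
have botE x y : tr alpha x y -> l (inl (inr y)) = inl (fingraph.root e (inr x)).
  move=> h; rewrite /l /=; case: pickP => [z zy|/(_ x)]; last by rewrite h.
  by rewrite -/e (midr z x) // (tr_up zy h).
have botN y : y \notin cod alpha ->
    l (inl (inr y)) = inr (pblock (blocks alpha) (inr y)).
  move=> h; rewrite /l /=; case: pickP => [z zy|//].
  by rewrite (tr_cod zy) in h.
apply/idP/eqP.
  suff E a' b' : product_graph gamma alpha a' b' -> l a' = l b'.
    case/connectP=> p; elim: p a => [|c p IH] a' /=; first by move=> _ ->.
    by case/andP=> /E -> pc lb; apply: IH.
  case/orP => /existsP[u /existsP[v /and3P[uv /eqP-> /eqP->]]].
    by rewrite !topE; congr inl; apply/eqP; rewrite root_mid mid_left.
  case: u v uv => [x|x] [y|y] uv.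
  - by congr inl; apply: midr.
  - by rewrite [RHS](botE x).
  - by rewrite [LHS](botE y) // /tr same_block_sym.
  - change (l (inl (inr x)) = l (inl (inr y))); case xc: (x \in cod alpha).
      case/codP: xc => z zx; rewrite (botE z) // (botE z) //.
      exact: tr_dn zx uv.
    rewrite !botN ?xc //; last by rewrite -(dn_cod uv) xc.
    by congr inr; apply/eqP; rewrite -same_blockE.
have tm u v : fingraph.root e u = fingraph.root e v ->
    connect (product_graph gamma alpha) (embed_top u) (embed_top v).
  by move/eqP; rewrite root_mid => /mid_pg.
(* Each vertex is attached to an upper or middle one, or is a lower vertex off the
   transversals. *)
have repr c : (exists u, l c = inl (fingraph.root e u) /\
    connect (product_graph gamma alpha) c (embed_top u)) \/
    exists y, [/\ c = inl (inr y), y \notin cod alpha &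
      l c = inr (pblock (blocks alpha) (inr y))].
  case: c => [[x|y]|z].
  - by left; exists (inl x).
  - case yc: (y \in cod alpha); last first.
      by right; exists y; split=> //; rewrite ?yc // botN ?yc.
    case/codP: yc => z zy; left; exists (inr z); split; first exact: botE.
    apply: (@pg_bot gamma alpha (inr y) (inl z)).
    by rewrite same_block_sym.
  - by left; exists (inr z).
case: (repr a) => [[u [-> cu]]|[y [-> _ ->]]];
  case: (repr b) => [[v [-> cv]]|[y' [-> _ ->]]] // [].
  move=> /tm uv; apply: connect_trans cu _; apply: connect_trans uv _.
  by rewrite product_graph_csym.
move=> h; apply: (@pg_bot gamma alpha (inr y) (inr y')).
by rewrite same_blockE h.
Qed.

Lemma same_block_mulp gamma alpha u v :
  same_block (pmul gamma alpha) u v =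
  connect (product_graph gamma alpha) (inl u) (inl v).
Proof.
rewrite pmul.unlock /same_block /= pblock_equivalence_partition ?inE //.
by move=> a b c _ _ _; apply: connect_product_equiv.
Qed.

Lemma up_mul gamma alpha x y :
  up (pmul gamma alpha) x y = mid gamma alpha (inl x) (inl y).
Proof. by rewrite /up same_block_mulp comp_labelE /= -root_mid. Qed.

Lemma tr_mulP gamma alpha x y :
  reflect (exists2 z, tr alpha z y & mid gamma alpha (inl x) (inr z))
          (tr (pmul gamma alpha) x y).
Proof.
rewrite /tr same_block_mulp comp_labelE /=; case: pickP => [z zy|no].
  rewrite (inj_eq (@inl_inj _ _)) root_mid; apply: (iffP idP) => [h|]; first by exists z.
  case=> z' z'y h; apply: mid_trans h _; apply: mid_right.
  exact: tr_up z'y zy.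
by apply: (iffP eqP) => // -[z zy]; have := no z; rewrite /tr zy.
Qed.

Lemma dn_mulP gamma alpha x y :
  reflect (dn alpha x y \/ exists z z', [/\ tr alpha z x, tr alpha z' y &
             mid gamma alpha (inr z) (inr z')])
          (dn (pmul gamma alpha) x y).
Proof.
rewrite /dn same_block_mulp comp_labelE /=; case: pickP => [z zx|nox];
  case: pickP => [z' zy|noy].
- rewrite (inj_eq (@inl_inj _ _)) root_mid; apply: (iffP idP) => [h|].
    by right; exists z, z'.
  case=> [h|[w [w' [wx wy h]]]].
    by apply: mid_right; apply: tr_up zy; apply: tr_dn zx h.
  apply: mid_trans (mid_trans h _); apply: mid_right; first exact: tr_up zx wx.
  exact: tr_up wy zy.
- apply: (iffP eqP) => // -[h|[w [w' [_ h]]]]; last by have := noy w'; rewrite h.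
  by have := noy z; rewrite (tr_dn zx h).
- apply: (iffP eqP) => // -[h|[w [w' [h]]]]; last by have := nox w; rewrite h.
  have := nox z'; rewrite (@tr_dn _ _ _ _ zy) //.
  by rewrite /dn same_block_sym.
- rewrite (inj_eq (@inr_inj _ _)) -same_blockE; apply: (iffP idP) => [|[//|]].
    by left.
  by case=> w [w' [h]]; have := nox w; rewrite h.
Qed.

Definition floating gamma alpha : {set 'I_n} :=
  [set z | [forall u, ~~ connect (product_graph gamma alpha) (inr z) (inl u)]].

Lemma PhiE gamma alpha :
  phi gamma alpha =
  #|[set [set w | connect (product_graph gamma alpha) (inr z) (inr w)]
      | z in floating gamma alpha]|.
Proof.
rewrite phi.unlock /Phi; set R := connect _.
pose F (A : {set 'I_n}) : {set pvertex n} := inr @: A.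
have injF : injective F by apply: imset_inj => x y [].
rewrite -(card_imset _ injF) -imset_comp; congr #|pred_of_set _|.
have eqR : {in [set: pvertex n] & &, equivalence_rel R}.
  by move=> a b c _ _ _; apply: connect_product_equiv.
apply/setP => C; rewrite inE; apply/andP/imsetP.
- case=> /imsetP[a _ ->] /subsetP h.
  have: a \in [set a | if a is inr _ then true else false].
    by apply: h; rewrite !inE; apply: connect0.
  rewrite inE; case: a h => [//|z] h _; exists z.
    rewrite inE; apply/forallP => u; apply/negP => c.
    by have := h (inl u); rewrite !inE => /(_ c).
  apply/setP => -[u|w]; rewrite /= !inE; last first.
    by rewrite mem_imset ?inE // => p q [].
  rewrite [X in _ = X](_ : _ = false); last by apply/imsetP => -[].
  by apply/negP => c; have := h (inl u); rewrite !inE => /(_ c).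
- case=> z; rewrite inE => /forallP h ->.
  split.
    apply/imsetP; exists (inr z) => //; apply/setP => -[u|w]; rewrite !inE.
      rewrite /R (negPf (h u)); apply/imsetP => -[w _] //.
    by rewrite mem_imset ?inE // => p q [].
  by apply/subsetP => a /imsetP[w _ ->]; rewrite inE.
Qed.

Lemma floatingP gamma alpha z :
  reflect ((forall x, ~~ mid gamma alpha (inl x) (inr z)) /\
           forall w, w \in dom alpha -> ~~ mid gamma alpha (inr z) (inr w))
    (z \in floating gamma alpha).
Proof.
rewrite inE; apply: (iffP forallP) => [h|[h1 h2] [x|y]].
- split=> [x|w /domP[y wy]]; apply/negP => c.
    by have := h (inl x); rewrite comp_labelE /= eq_sym (inj_eq (@inl_inj _ _)) root_mid c.
  have /negP := h (inr y); apply.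
  apply: connect_trans (mid_pg c) _.
  exact: (@pg_bot gamma alpha (inl w) (inr y)).
- by rewrite comp_labelE /= eq_sym (inj_eq (@inl_inj _ _)) root_mid.
- rewrite comp_labelE /=; case: pickP => [w wy|//].
  by rewrite (inj_eq (@inl_inj _ _)) root_mid h2 // (tr_dom wy).
Qed.

Lemma Phi_mid gamma alpha :
  phi gamma alpha =
  #|[set [set w | mid gamma alpha (inr z) (inr w)] | z in floating gamma alpha]|.
Proof.
rewrite PhiE; congr #|pred_of_set _|; apply: eq_imset => z.
by apply/setP => w; rewrite !inE comp_labelE /= (inj_eq (@inl_inj _ _)) root_mid.
Qed.

Lemma Phi0 gamma alpha : (phi gamma alpha == 0) = (floating gamma alpha == set0).
Proof.
rewrite Phi_mid cards_eq0; apply/eqP/eqP => [|->]; last exact: imset0.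
by move/eqP; rewrite imset_eq0 => /eqP.
Qed.

Lemma Phi0_in gamma alpha :
  (forall z, (exists x, mid gamma alpha (inl x) (inr z)) \/
     exists2 w, w \in dom alpha & mid gamma alpha (inr z) (inr w)) ->
  phi gamma alpha = 0.
Proof.
move=> h; apply/eqP; rewrite Phi0; apply/eqP/setP => z; rewrite in_set0.
apply/negP => /floatingP[h1 h2]; case: (h z) => [[x]|[w]].
  exact/negP/h1.
by move/h2/negP.
Qed.

Lemma Phi1_in gamma alpha (z : 'I_n) :
  z \in floating gamma alpha ->
  (forall w, w \in floating gamma alpha -> mid gamma alpha (inr z) (inr w)) ->
  phi gamma alpha = 1.
Proof.
move=> zf h; rewrite Phi_mid.
suff -> : [set [set w | mid gamma alpha (inr z) (inr w)] | z in floating gamma alpha]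
   = [set [set w | mid gamma alpha (inr z) (inr w)]] by rewrite cards1.
apply/setP => C; rewrite inE; apply/imsetP/eqP => [[w wf ->]|->]; last by exists z.
apply/setP => v; rewrite !inE; have zw := h w wf.
apply/idP/idP; first exact: mid_trans.
by apply: mid_trans; rewrite mid_sym.
Qed.

Definition pswap (a : pvertex n) : pvertex n :=
  match a with inl u => inl (swap_side u) | inr z => inr z end.

Lemma pg_dual gamma alpha a b :
  product_graph (dual alpha) (dual gamma) a b =
  product_graph gamma alpha (pswap a) (pswap b).
Proof.
have swt u : pswap (embed_top u) = embed_bot (swap_side u) by case: u.
have swb u : pswap (embed_bot u) = embed_top (swap_side u) by case: u.
have pswK : involutive pswap by case=> // u; rewrite /= swap_sideK.
rewrite /product_graph orbC; congr (_ || _);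
  apply/existsP/existsP => -[u] /existsP[v] /and3P[h ea eb];
  exists (swap_side u); apply/existsP; exists (swap_side v).
- by rewrite -same_block_dual h -!swb (eqP ea) (eqP eb) !eqxx.
- rewrite same_block_dual !swap_sideK h -(inj_eq (can_inj pswK)) (eqP ea) swb swap_sideK eqxx.
  by rewrite -(inj_eq (can_inj pswK)) (eqP eb) swb swap_sideK eqxx.
- by rewrite -same_block_dual h -!swt (eqP ea) (eqP eb) !eqxx.
- rewrite same_block_dual !swap_sideK h -(inj_eq (can_inj pswK)) (eqP ea) swt swap_sideK eqxx.
  by rewrite -(inj_eq (can_inj pswK)) (eqP eb) swt swap_sideK eqxx.
Qed.

Lemma connect_pg_dual gamma alpha a b :
  connect (product_graph (dual alpha) (dual gamma)) a b =
  connect (product_graph gamma alpha) (pswap a) (pswap b).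
Proof.
have pswK : involutive pswap by case=> // u; rewrite /= swap_sideK.
apply/connectP/connectP => -[p pp epart].
  exists (map pswap p); last by rewrite last_map -epart.
  by rewrite path_map (@eq_path _ _ (product_graph (dual alpha) (dual gamma))) // => c d;
    rewrite /= pg_dual.
exists (map pswap p); last by rewrite -[a]pswK last_map -epart pswK.
rewrite -[a]pswK path_map (@eq_path _ _ (product_graph gamma alpha)) // => c d.
by rewrite /= pg_dual !pswK.
Qed.

Lemma dual_mul gamma alpha : dual (pmul gamma alpha) = pmul (dual alpha) (dual gamma).
Proof.
apply: partn_ext => u v; rewrite same_block_dual !same_block_mulp.
by rewrite connect_pg_dual.
Qed.

Lemma Phi_dual gamma alpha : phi (dual alpha) (dual gamma) = phi gamma alpha.
Proof.
rewrite (PhiE (dual alpha)) (PhiE gamma alpha).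
have cd a b := connect_pg_dual gamma alpha a b.
have -> : floating (dual alpha) (dual gamma) = floating gamma alpha.
  apply/setP => z; rewrite [LHS]in_set [RHS]in_set.
  apply/forallP/forallP => h u; last by rewrite cd; exact: h.
  by have := h (swap_side u); rewrite cd /= swap_sideK.
by congr #|pred_of_set _|; apply: eq_imset => z; apply/setP => w; rewrite in_set cd [RHS]in_set.
Qed.

End Rels.

(** * Rank, splitting of transversals and Green's relations *)

Lemma leq_imset_fun (T T1 T2 : finType) (D : {set T}) (f : T -> T1) (g : T -> T2) :
  {in D &, forall x y, g x = g y -> f x = f y} -> #|f @: D| <= #|g @: D|.
Proof.
move=> h; pose k (t : T2) := omap f [pick x | (x \in D) && (g x == t)].
rewrite -(card_imset (f @: D) (@Some_inj _)) -imset_comp.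
have -> : [set (Some \o f) x | x in D] = [set k t | t in g @: D].
  rewrite -[RHS]imset_comp; apply: eq_in_imset => x xD /=; rewrite /k.
  case: pickP => [y /andP[yD /eqP e]|/(_ x)]; last by rewrite xD eqxx.
  by rewrite /= (h y x).
exact: leq_imset_card.
Qed.

Lemma eq_card_imset_fun (T T1 T2 : finType) (D : {set T}) (f : T -> T1) (g : T -> T2) :
  {in D &, forall x y, (f x == f y) = (g x == g y)} -> #|f @: D| = #|g @: D|.
Proof.
move=> h; apply/eqP; rewrite eqn_leq; apply/andP; split; apply: leq_imset_fun => x y xD yD /eqP e;
 by apply/eqP; rewrite ?h // -h.
Qed.

Lemma ltn_imset_fun (T T1 T2 : finType) (D : {set T}) (f : T -> T1) (g : T -> T2) x y :
  {in D &, forall x y, g x = g y -> f x = f y} ->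
  x \in D -> y \in D -> f x = f y -> g x <> g y -> #|f @: D| < #|g @: D|.
Proof.
move=> h xD yD fxy gxy.
rewrite (cardsD1 (g x)) imset_f // add1n ltnS.
pose D' := [set z in D | g z != g x].
have -> : g @: D :\ g x = g @: D'.
  apply/setP => t; rewrite !inE; apply/andP/imsetP => [[tx /imsetP[z zD e]]|[z]].
    by exists z; rewrite // inE zD -e.
  by rewrite inE => /andP[zD zx] ->; split=> //; apply: imset_f.
have -> : f @: D = f @: D'.
  apply/setP => t; apply/imsetP/imsetP => -[z zD ->]; last first.
    by move: zD; rewrite inE => /andP[zD _]; exists z.
  case: (eqVneq (g z) (g x)) => e; last by exists z; rewrite // inE zD.
  exists y; first by rewrite inE yD; apply/eqP/nesym.
  by rewrite (h z x).
apply: leq_imset_fun => u v; rewrite !inE => /andP[uD _] /andP[vD _]; exact: h.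
Qed.

Section Rank.
Variable n : nat.
Implicit Types (alpha beta gamma : partn n) (x y z : 'I_n) (u v : vertex n).

Notation pb alpha := (pblock (blocks alpha)).

Lemma mem_pb alpha u v : (v \in pb alpha u) = same_block alpha u v.
Proof. by []. Qed.

Lemma pb_in alpha u : pb alpha u \in blocks alpha.
Proof.
have [/eqP cov _ _] := and3P (blocksP alpha).
by rewrite pblock_mem // cov inE.
Qed.

Lemma blockE alpha B u : B \in blocks alpha -> u \in B -> B = pb alpha u.
Proof.
have [_ tI _] := and3P (blocksP alpha).
by move=> Ba uB; rewrite (def_pblock tI Ba uB).
Qed.

Lemma transversal_up alpha x : (pb alpha (inl x) \in transversals alpha) = (x \in dom alpha).
Proof.
rewrite inE pb_in /=; apply/andP/domP => [[_ /set0Pn[[y|y]]]|[y xy]].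
- by rewrite inE andbF.
- by rewrite inE mem_pb => /andP[h _]; exists y.
split; apply/set0Pn; first by exists (inl x); rewrite inE mem_pb same_block_refl.
by exists (inr y); rewrite inE mem_pb andbT.
Qed.

Lemma transversal_dn alpha y : (pb alpha (inr y) \in transversals alpha) = (y \in cod alpha).
Proof.
apply/idP/codP => [|[x xy]].
  rewrite inE => /and3P[_ /set0Pn[[x|x]]]; rewrite inE ?andbF //.
  by rewrite andbT mem_pb same_block_sym => h _; exists x.
by move: (xy); rewrite /tr same_blockE => /eqP <-; rewrite transversal_up (tr_dom xy).
Qed.

Lemma transversals_dom alpha : transversals alpha = [set pb alpha (inl x) | x in dom alpha].
Proof.
apply/setP => B; apply/idP/imsetP => [Bt|[x xd ->]]; last by rewrite transversal_up.
have := Bt; rewrite inE => /and3P[Ba /set0Pn[u]]; rewrite inE => /andP[uB].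
case: u uB => // x uB _ _; have e := blockE Ba uB.
by exists x; rewrite // -transversal_up -e.
Qed.

Lemma transversals_cod alpha : transversals alpha = [set pb alpha (inr x) | x in cod alpha].
Proof.
apply/setP => B; apply/idP/imsetP => [Bt|[x xd ->]]; last by rewrite transversal_dn.
have := Bt; rewrite inE => /and3P[Ba _ /set0Pn[u]]; rewrite inE => /andP[uB].
case: u uB => // x uB _; have e := blockE Ba uB.
by exists x; rewrite // -transversal_dn -e.
Qed.

Lemma rank_dom alpha : rank alpha = #|[set pb alpha (inl x) | x in dom alpha]|.
Proof. by rewrite /rank transversals_dom. Qed.
Lemma rank_cod alpha : rank alpha = #|[set pb alpha (inr x) | x in cod alpha]|.
Proof. by rewrite /rank transversals_cod. Qed.

Lemma rank_dual alpha : rank (dual alpha) = rank alpha.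
Proof.
rewrite rank_dom rank_cod dom_dual; apply: eq_card_imset_fun => x y _ _.
by rewrite -!same_blockE same_block_dual.
Qed.

Lemma rank_eqR alpha beta : up alpha =2 up beta -> dom alpha = dom beta ->
  rank alpha = rank beta.
Proof.
move=> eu ed; rewrite !rank_dom ed; apply: eq_card_imset_fun => x y _ _.
by rewrite -!same_blockE; exact: eu.
Qed.

Lemma rank0 alpha : (rank alpha == 0) = (dom alpha == set0).
Proof. by rewrite rank_dom cards_eq0 imset_eq0. Qed.

Lemma rank_gt0P alpha : reflect (exists x, x \in dom alpha) (0 < rank alpha).
Proof. by rewrite lt0n rank0; apply: set0Pn. Qed.

Lemma rank_le1 alpha x y :
  rank alpha <= 1 -> x \in dom alpha -> y \in dom alpha -> up alpha x y.
Proof.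
rewrite rank_dom => /card_le1_eqP h xd yd; rewrite /up same_blockE; apply/eqP.
by apply: h; apply: imset_f.
Qed.
Lemma rank_le1_cod alpha x y :
  rank alpha <= 1 -> x \in cod alpha -> y \in cod alpha -> dn alpha x y.
Proof.
rewrite -rank_dual -dom_dual => r xd yd; rewrite -up_dual.
exact: rank_le1 r xd yd.
Qed.

Lemma rank_gt1P alpha :
  reflect (exists x y, [/\ x \in dom alpha, y \in dom alpha & ~~ up alpha x y])
          (1 < rank alpha).
Proof.
rewrite rank_dom; apply: (iffP card_gt1P) => [[A [B [/imsetP[x xd ->] /imsetP[y yd ->] h]]]|].
  by exists x, y; rewrite xd yd /up same_blockE.
case=> x [y [xd yd h]]; exists (pb alpha (inl x)), (pb alpha (inl y)).
by split; [exact: imset_f|exact: imset_f|rewrite -same_blockE].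
Qed.

Lemma cod_mul gamma alpha : cod (pmul gamma alpha) \subset cod alpha.
Proof. by apply/subsetP => y /codP[x /tr_mulP[z zy _]]; apply: tr_cod zy. Qed.
Lemma dn_mul_sub gamma alpha x y : dn alpha x y -> dn (pmul gamma alpha) x y.
Proof. by move=> h; apply/dn_mulP; left. Qed.

Lemma rank_mul_cod gamma alpha :
  rank (pmul gamma alpha) <= #|[set pb (pmul gamma alpha) (inr y) | y in cod alpha]|
     <= rank alpha.
Proof.
apply/andP; split; first by rewrite rank_cod subset_leq_card // imsetS // cod_mul.
rewrite rank_cod; apply: leq_imset_fun => x y _ _ /eqP; rewrite -same_blockE => h.
by apply/eqP; rewrite -same_blockE; apply: dn_mul_sub.
Qed.

Lemma rank_mulr gamma alpha : rank (pmul gamma alpha) <= rank alpha.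
Proof. by case/andP: (rank_mul_cod gamma alpha) => /leq_trans; apply. Qed.
Lemma rank_mull gamma alpha : rank (pmul gamma alpha) <= rank gamma.
Proof. by rewrite -rank_dual dual_mul -(rank_dual gamma) rank_mulr. Qed.

(** Left multiplication loses rank in two ways: here two transversals of
    [alpha] are joined by [gamma]; in [rank_mul_cut] one is cut off from above. *)
Lemma rank_mul_merge gamma alpha x x' :
  x \in dom alpha -> x' \in dom alpha -> ~~ up alpha x x' ->
  mid gamma alpha (inr x) (inr x') -> rank (pmul gamma alpha) < rank alpha.
Proof.
case/domP => y xy /domP[y' xy'] nup m.
have [/leq_ltn_trans + _] := andP (rank_mul_cod gamma alpha); apply.
rewrite (rank_cod alpha); apply: (@ltn_imset_fun _ _ _ _ _ _ y y').
- move=> z z' _ _ /eqP; rewrite -same_blockE => h.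
  by apply/eqP; rewrite -same_blockE; apply: dn_mul_sub.
- exact: tr_cod xy.
- exact: tr_cod xy'.
- by apply/eqP; rewrite -same_blockE; apply/dn_mulP; right; exists x, x'.
- move=> /eqP; rewrite -same_blockE => h; case/negP: nup.
  by apply: tr_up xy'; apply: tr_dn xy h.
Qed.

Lemma rank_mul_cut gamma alpha x :
  x \in dom alpha -> (forall t, ~~ mid gamma alpha (inl t) (inr x)) ->
  rank (pmul gamma alpha) < rank alpha.
Proof.
case/domP => y xy h.
have [_ /(leq_trans _)] := andP (rank_mul_cod gamma alpha); apply.
rewrite rank_cod; apply: proper_card; apply/properP; split.
  by rewrite imsetS // cod_mul.
exists (pb (pmul gamma alpha) (inr y)); first by apply: imset_f; apply: tr_cod xy.
apply/imsetP => -[y' y'c /eqP]; rewrite -same_blockE => /dn_cod.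
rewrite y'c => /codP[t] /tr_mulP[z zy]; apply/negP.
apply: contra (h t) => m; apply: mid_trans m _; apply: mid_right; exact: tr_up zy xy.
Qed.

(** If the upper kernel of [alpha] refines the lower kernel of [gamma], then
    connectedness needs no transitive closure and the product is computed by
    relational composition. Most multipliers below are coarse in this sense, or
    in its mirror image. *)
Section ModeC.
Variables gamma alpha : partn n.
Hypothesis coarse : forall x y, up alpha x y -> dn gamma x y.

Lemma midC : mid gamma alpha =2 same_block gamma.
Proof.
move=> u v; apply/idP/idP; last exact: mid_left.
move=> m; rewrite same_blockE; apply/eqP; move: u v m; apply: mid_min => [u v|x y].
  by rewrite same_blockE => /eqP.
by move/coarse; rewrite /dn same_blockE => /eqP.
Qed.

Lemma upC x y : up (pmul gamma alpha) x y = up gamma x y.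
Proof. by rewrite up_mul midC. Qed.
Lemma trCP x y : reflect (exists2 z, tr gamma x z & tr alpha z y) (tr (pmul gamma alpha) x y).
Proof.
by apply: (iffP (tr_mulP _ _ _ _)) => -[z h1 h2]; exists z => //; rewrite midC in h2 *.
Qed.
Lemma dnCP x y :
  reflect (dn alpha x y \/ exists z z', [/\ tr alpha z x, tr alpha z' y & dn gamma z z'])
   (dn (pmul gamma alpha) x y).
Proof.
by apply: (iffP (dn_mulP _ _ _ _)) => -[h|[z [z' [h1 h2 h3]]]]; by [left|right; exists z, z';
  rewrite midC in h3 *].
Qed.
Lemma floatingC z : z \in floating gamma alpha =
  (z \notin cod gamma) && [forall w, (w \in dom alpha) ==> ~~ dn gamma z w].
Proof.
apply/floatingP/andP => [[h1 h2]|[h1 /forallP h2]]; split.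
- by apply/codP => -[x]; apply/negP; rewrite /tr -midC.
- by apply/forallP => w; apply/implyP => /h2; rewrite midC.
- by move=> x; apply: contra h1; rewrite midC => h; apply: tr_cod h.
- by move=> w wd; have := h2 w; rewrite wd midC.
Qed.
Lemma Phi0C : (forall z, z \in cod gamma \/ exists2 w, w \in dom alpha & dn gamma z w) ->
  phi gamma alpha = 0.
Proof.
move=> h; apply: Phi0_in => z; case: (h z) => [/codP[x]|[w wd zw]]; [left|right].
  by exists x; rewrite midC.
by exists w => //; rewrite midC.
Qed.
End ModeC.

Section ModeD.
Variables gamma alpha : partn n.
Hypothesis coarse : forall x y, dn gamma x y -> up alpha x y.
Let coarse' x y : up (dual gamma) x y -> dn (dual alpha) x y.
Proof. by rewrite up_dual dn_dual; apply: coarse. Qed.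

Lemma dnD x y : dn (pmul gamma alpha) x y = dn alpha x y.
Proof. by rewrite -up_dual dual_mul upC // up_dual. Qed.
Lemma trDP x y : reflect (exists2 z, tr gamma x z & tr alpha z y) (tr (pmul gamma alpha) x y).
Proof.
rewrite -(tr_dual (pmul gamma alpha)) dual_mul; apply: (iffP (trCP coarse' _ _)) => -[z h1 h2];
  exists z; rewrite !tr_dual in h1 h2 *; done.
Qed.
Lemma upDP x y :
  reflect (up gamma x y \/ exists z z', [/\ tr gamma x z, tr gamma y z' & up alpha z z'])
   (up (pmul gamma alpha) x y).
Proof.
rewrite -(dn_dual (pmul gamma alpha)) dual_mul; apply: (iffP (dnCP coarse' _ _));
  rewrite !dn_dual => -[h|[z [z' [h1 h2 h3]]]];
 by [left|right; exists z, z'; rewrite !tr_dual !dn_dual in h1 h2 h3 *].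
Qed.
Lemma Phi0D : (forall z, z \in dom alpha \/ exists2 w, w \in cod gamma & up alpha z w) ->
  phi gamma alpha = 0.
Proof.
move=> h; rewrite -Phi_dual; apply: Phi0C => // z; rewrite cod_dual dom_dual.
by case: (h z) => [|[w wd zw]]; [left|right; exists w; rewrite ?dn_dual].
Qed.
End ModeD.

Lemma mul_mid gamma gamma' alpha alpha' :
  (forall u v, mid gamma alpha u v = mid gamma' alpha' u v) -> dn alpha =2 dn alpha' ->
    tr alpha =2 tr alpha' ->
  pmul gamma alpha = pmul gamma' alpha'.
Proof.
move=> em ed et; apply: partn_ext3 => x y.
- by rewrite !up_mul em.
- by apply/dn_mulP/dn_mulP => -[h|[z [z' [h1 h2 h3]]]];
   [left; rewrite -ed|right; exists z, z'; rewrite -!et -em|left; rewrite ed|right;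
     exists z, z'; rewrite !et em].
- by apply/tr_mulP/tr_mulP => -[z h1 h2]; exists z; rewrite ?et ?em // -?et -?em.
Qed.

Definition side u := if u is inl _ then true else false.

Lemma same_block_hat alpha u v :
  same_block (hat alpha) u v = same_block alpha u v && (side u == side v).
Proof.
pose S := [set w in pb alpha u | side w == side u].
have uS : u \in S by rewrite inE eqxx andbT mem_pb same_block_refl.
suff SB : S \in hat_blocks alpha.
  have [_ tI _] := and3P (blocksP (hat alpha)).
  by rewrite /same_block (def_pblock tI SB uS) inE eq_sym.
case bt: (pb alpha u \in transversals alpha).
  have [E|E] : S = upper (pb alpha u) \/ S = lower (pb alpha u).
    by rewrite /S; case: u {uS bt S} => x; [left|right]; apply/setP => -[z|z]; rewrite !inE.
  - by apply/setUP; left; apply/setUP; right; rewrite E; apply: imset_f.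
  - by apply/setUP; right; rewrite E; apply: imset_f.
apply/setUP; left; apply/setUP; left; suff -> : S = pb alpha u by rewrite in_setD bt pb_in.
apply/setP => w; rewrite in_set; apply: andb_idr; rewrite mem_pb => uw.
case: u w uw bt {S uS} => [x|x] [y|y] //= uw.
  by rewrite transversal_up (tr_dom uw).
by rewrite transversal_dn (@tr_cod _ _ y) // /tr same_block_sym.
Qed.

Lemma up_hat alpha x y : up (hat alpha) x y = up alpha x y.
Proof. by rewrite /up same_block_hat andbT. Qed.
Lemma dn_hat alpha x y : dn (hat alpha) x y = dn alpha x y.
Proof. by rewrite /dn same_block_hat andbT. Qed.
Lemma tr_hat alpha x y : tr (hat alpha) x y = false.
Proof. by rewrite /tr same_block_hat andbF. Qed.
Lemma dom_hat alpha : dom (hat alpha) = set0.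
Proof. by apply/setP => x; rewrite in_set0; apply/domP => -[y]; rewrite tr_hat. Qed.
Lemma rank_hat alpha : rank (hat alpha) = 0.
Proof. by apply/eqP; rewrite rank0 dom_hat. Qed.

Lemma hatP alpha beta :
  hat alpha = hat beta <-> up alpha =2 up beta /\ dn alpha =2 dn beta.
Proof.
split=> [h|[h1 h2]].
  split=> x y; first by rewrite -(up_hat alpha) h up_hat.
  by rewrite -(dn_hat alpha) h dn_hat.
by apply: partn_ext3 => x y; rewrite ?up_hat ?dn_hat ?tr_hat.
Qed.

Lemma hat_id alpha : rank alpha = 0 -> hat alpha = alpha.
Proof.
move/eqP; rewrite rank0 => /eqP d0; apply: partn_ext3 => x y; rewrite ?up_hat ?dn_hat ?tr_hat //.
by apply/esym/negP => /tr_dom; rewrite d0 inE.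
Qed.

Lemma hat_dual alpha : hat (dual alpha) = dual (hat alpha).
Proof.
by apply: partn_ext3 => x y; rewrite ?(up_hat, dn_hat, tr_hat, up_dual, dn_dual, tr_dual).
Qed.

Lemma dom_mul gamma alpha : dom (pmul gamma alpha) \subset dom gamma.
Proof. by rewrite -!cod_dual dual_mul cod_mul. Qed.
Lemma up_mul_sub gamma alpha x y : up gamma x y -> up (pmul gamma alpha) x y.
Proof. by rewrite -!dn_dual dual_mul; apply: dn_mul_sub. Qed.

Lemma up_mul_ndom gamma alpha x y :
  x \notin dom gamma -> up (pmul gamma alpha) x y -> up gamma x y.
Proof.
move=> xd; rewrite up_mul => m.
pose f u := u \in pb gamma (inl x).
suff : f (inl x) = f (inl y) by rewrite /f !mem_pb same_block_refl => /esym.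
apply: (mid_min (f := f)) m => [u v uv|a b _].
  rewrite /f !mem_pb; apply/idP/idP => h; first exact: same_block_trans uv.
  by apply: same_block_trans h _; rewrite same_block_sym.
have fF z : f (inr z) = false by apply: contraNF xd; rewrite /f mem_pb => /tr_dom.
by rewrite !fF.
Qed.

Lemma right_ideal_mul alpha beta :
  (forall x y, up alpha x y -> up beta x y) -> dom beta \subset dom alpha ->
  (forall x y, x \notin dom alpha -> up beta x y -> up alpha x y) ->
  exists delta, beta = pmul alpha delta.
Proof.
move=> eu /subsetP ed nd.
pose c y := if [pick x | tr alpha x y] is Some x then Some (pb beta (inl x)) else None.
pose d y := Some (pb beta (inr y)).
have cE x y : tr alpha x y -> c y = Some (pb beta (inl x)).
  move=> xy; rewrite /c; case: pickP => [x' x'y|/(_ x)]; last by rewrite xy.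
  congr Some; apply/eqP; rewrite -same_blockE; apply: eu; exact: tr_up x'y xy.
have cN y : y \notin cod alpha -> c y = None.
  move=> h; rewrite /c; case: pickP => [x /tr_cod|//]; by rewrite (negPf h).
exists (lab2 c d).
have co x y : dn alpha x y -> up (lab2 c d) x y.
  rewrite up_lab2 => xy; case xc: (x \in cod alpha); last by rewrite !cN ?xc // -(dn_cod xy) xc.
  case/codP: xc => z zx; rewrite (cE z) // (cE z) //; exact: tr_dn zx xy.
apply: partn_ext3 => x y.
- apply/idP/(upDP co) => [h|].
    case xd: (x \in dom alpha); last by left; apply: nd; rewrite ?xd.
    case yd: (y \in dom alpha); last first.
      by left; rewrite up_sym; apply: nd; rewrite ?yd // up_sym.
    right; move: xd yd => /domP[z xz] /domP[z' yz']; exists z, z'.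
    by rewrite xz yz' up_lab2 (cE x) // (cE y) // (inj_eq (@Some_inj _)) -same_blockE.
  case=> [|[z [z' [h1 h2]]]]; first exact: eu.
  by rewrite up_lab2 (cE x) // (cE y) // (inj_eq (@Some_inj _)) -same_blockE.
- by rewrite dnD // dn_lab2 (inj_eq (@Some_inj _)) -same_blockE.
- apply/idP/(trDP co) => [h|[z xz]].
    have /domP[z xz] := ed _ (tr_dom h); exists z => //.
    by rewrite tr_lab2 (cE x) // (inj_eq (@Some_inj _)) -same_blockE.
  by rewrite tr_lab2 (cE x) // (inj_eq (@Some_inj _)) -same_blockE.
Qed.

(** Right multiplication may merge the upper parts of transversals, and may
    cut them off from below; the upper blocks off the transversals stay as they
    are. *)
Lemma right_idealP alpha beta :
  reflect [/\ forall x y, up alpha x y -> up beta x y, dom beta \subset dom alpha &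
              forall x y, x \notin dom alpha -> up beta x y -> up alpha x y]
          (beta \in right_ideal alpha).
Proof.
apply: (iffP setU1P) => [[-> //|/imsetP[g _ ->]]|[h1 h2 h3]]; rewrite -?pmulE.
  split=> [x y||x y]; [exact: up_mul_sub|exact: dom_mul|exact: up_mul_ndom].
by right; case: (right_ideal_mul h1 h2 h3) => d ->; rewrite pmulE; apply: imset_f.
Qed.

Lemma greenRP alpha beta :
  reflect (up alpha =2 up beta /\ dom alpha = dom beta) (greenR alpha beta).
Proof.
apply: (iffP eqP) => [h|[eu ed]]; last first.
  apply/setP => c; apply/right_idealP/right_idealP => -[h1 h2 h3]; split.
  - by move=> x y; rewrite -eu; apply: h1.
  - by rewrite -ed.
  - by move=> x y; rewrite -ed -eu; apply: h3.
  - by move=> x y; rewrite eu; apply: h1.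
  - by rewrite ed.
  - by move=> x y; rewrite ed eu; apply: h3.
have /right_idealP[s1 t1 _] : beta \in right_ideal alpha by rewrite h setU11.
have /right_idealP[s2 t2 _] : alpha \in right_ideal beta by rewrite -h setU11.
split; last by apply/eqP; rewrite eqEsubset t1 t2.
by move=> x y; apply/idP/idP; [apply: s1|apply: s2].
Qed.

Lemma greenL_dual alpha beta : greenL alpha beta = greenR (dual alpha) (dual beta).
Proof.
have e a : left_ideal a = [set dual c | c in right_ideal (dual a)].
  apply/setP => c; apply/setU1P/imsetP => [[->|/imsetP[g _ ->]]|].
  - by exists (dual a); rewrite ?setU11 // dualK.
  - exists (dual (pmul g a)); last by rewrite dualK pmulE.
    by apply/setU1P; right; rewrite dual_mul pmulE; apply: imset_f.
  - case=> d /setU1P[->|/imsetP[g _ ->]] ->; first by left; rewrite dualK.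
    by right; rewrite -pmulE dual_mul dualK pmulE; apply: imset_f.
apply/eqP/eqP; rewrite !e; last by move=> ->.
exact/imset_inj/can_inj/dualK.
Qed.

Lemma greenLP alpha beta :
  reflect (dn alpha =2 dn beta /\ cod alpha = cod beta) (greenL alpha beta).
Proof.
rewrite greenL_dual; apply: (iffP (greenRP _ _)); rewrite !dom_dual => -[h1 h2].
  by split=> // x y; have := h1 x y; rewrite !up_dual.
by split=> // x y; rewrite !up_dual.
Qed.
End Rank.

(** * Numberings of the transversals *)

Section Numbering.
Variable n : nat.
Implicit Types (alpha beta gamma : partn n) (x y z : 'I_n) (u v : vertex n).
Notation pb alpha := (pblock (blocks alpha)).

(** A numbering of the [q] transversals: [a] and [b] give the number of the
    transversal through an upper or a lower point, and [None] off the
    transversals. Permutations act on numberings ([pact]), which makes the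
    permutation difference of two partitions a matter of labels ([perm_diffP]). *)
Definition tlab q alpha (a b : 'I_n -> option 'I_q) : Prop :=
  [/\ forall x y, tr alpha x y = (a x == b y) && isSome (a x),
      forall k, exists x, a x = Some k & forall k, exists y, b y = Some k].

Section Facts.
Variables (q : nat) (alpha : partn n) (a b : 'I_n -> option 'I_q).
Hypothesis L : tlab alpha a b.

Lemma tlab_tr x y k : a x = Some k -> tr alpha x y = (b y == Some k).
Proof. by case: L => -> _ _ e; rewrite e andbT eq_sym. Qed.
Lemma tlab_trb x y k : b y = Some k -> tr alpha x y = (a x == Some k).
Proof. by case: L => -> _ _ e; rewrite e; case: (a x) => [l|]; rewrite ?andbT. Qed.
Lemma tlab_dual : tlab (dual alpha) b a.
Proof.
case: L => h1 h2 h3; split=> // x y; rewrite tr_dual h1 eq_sym.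
by case: eqP => //= ->.
Qed.
Lemma tlab_dom x : (x \in dom alpha) = isSome (a x).
Proof.
case: L => h1 h2 h3; apply/domP/idP => [[y]|]; first by rewrite h1 => /andP[].
by case e: (a x) => [k|//] _; case: (h3 k) => y yk; exists y; rewrite h1 e yk eqxx.
Qed.
Lemma tlab_cod y : (y \in cod alpha) = isSome (b y).
Proof.
case: L => h1 h2 h3; apply/codP/idP => [[x]|].
  by rewrite h1 => /andP[/eqP <-].
by case e: (b y) => [k|//] _; case: (h2 k) => x xk; exists x; rewrite h1 e xk eqxx.
Qed.
Lemma tlab_up x x' k : a x = Some k -> up alpha x x' = (a x' == Some k).
Proof.
move=> e; case: L => h1 h2 h3; case: (h3 k) => y yk.
have xy : tr alpha x y by rewrite (tlab_tr _ e) yk.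
rewrite -(tlab_trb _ yk); apply/idP/idP => h; last exact: tr_up xy h.
by apply: up_tr xy; rewrite up_sym.
Qed.
Lemma tlab_lvl k : block_of [set x | a x == Some k] [set y | b y == Some k]
  \in transversals alpha.
Proof.
case: L => h1 h2 h3; case: (h2 k) => x xk.
suff -> : block_of [set x | a x == Some k] [set y | b y == Some k] = pb alpha (inl x).
  by rewrite transversal_up tlab_dom xk.
apply/setP => -[z|y]; rewrite inE mem_pb.
  rewrite (mem_imset _ _ (@inl_inj _ _)) inE -(tlab_up _ xk).
  by rewrite [X in _ || X](_ : _ = false) ?orbF //; apply/imsetP => -[].
rewrite (mem_imset _ _ (@inr_inj _ _)) inE -(tlab_tr _ xk).
by rewrite [X in X || _](_ : _ = false) ?orbF //; apply/imsetP => -[].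
Qed.

Lemma tlab_lvl_inj : injective (fun k => block_of [set x | a x == Some k] [set y | b y == Some k]).
Proof.
case: L => h1 h2 h3 k l e; case: (h2 k) => x xk.
have : (inl x : vertex n) \in block_of [set x | a x == Some k] [set y | b y == Some k].
  by apply/setUP; left; apply: imset_f; rewrite inE xk.
rewrite e => /setUP[|/imsetP[] //].
by rewrite (mem_imset _ _ (@inl_inj _ _)) inE xk => /eqP[].
Qed.

Lemma tlab_transversals :
  transversals alpha = [set block_of [set x | a x == Some k] [set y | b y == Some k] | k : 'I_q].
Proof.
apply/setP => B; apply/idP/imsetP => [|[k _ ->]]; last exact: tlab_lvl.
rewrite transversals_dom => /imsetP[x xd ->]; move: (xd).
rewrite tlab_dom; case e: (a x) => [k|//] _; exists k => //.
have := tlab_lvl k; rewrite inE => /andP[Bk _]; apply/esym/blockE => //.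
by apply/setUP; left; apply: imset_f; rewrite inE e.
Qed.

Lemma tlab_rank : rank alpha = q.
Proof.
by rewrite /rank tlab_transversals card_imset ?card_ord //; apply: tlab_lvl_inj.
Qed.
End Facts.

Lemma tlab_ext q alpha (a b a' b' : 'I_n -> option 'I_q) :
  a =1 a' -> b =1 b' -> tlab alpha a b -> tlab alpha a' b'.
Proof.
move=> ea eb [h1 h2 h3]; split=> [x y|k|k]; first by rewrite h1 ea eb.
  by case: (h2 k) => x e; exists x; rewrite -ea.
by case: (h3 k) => x e; exists x; rewrite -eb.
Qed.

Definition pact q (pi : 'S_q) (a : 'I_n -> option 'I_q) x := omap pi (a x).

Lemma tlab_act q alpha (a b : 'I_n -> option 'I_q) pi :
  tlab alpha a b -> tlab alpha (pact pi a) (pact pi b).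
Proof.
move=> [h1 h2 h3]; split=> [x y|k|k].
- rewrite h1 /pact; case: (a x) (b y) => [i|] [j|] //=.
  by rewrite !andbT !(inj_eq (@Some_inj _)) (inj_eq (@perm_inj _ pi)).
- by case: (h2 (pi^-1%g k)) => x e; exists x; rewrite /pact e /= permKV.
- by case: (h3 (pi^-1%g k)) => x e; exists x; rewrite /pact e /= permKV.
Qed.

Lemma pactM q (pi rho : 'S_q) a : pact rho (pact pi a) =1 pact (pi * rho)%g a.
Proof. by move=> x; rewrite /pact; case: (a x) => //= i; rewrite permM. Qed.
Lemma pact1 q (a : 'I_n -> option 'I_q) : pact 1%g a =1 a.
Proof. by move=> x; rewrite /pact; case: (a x) => //= i; rewrite perm1. Qed.

Lemma tlab_exists q alpha : rank alpha = q -> exists a b, @tlab q alpha a b.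
Proof.
move=> rq; pose s := enum (transversals alpha).
have sz : size s = q by rewrite -cardE.
pose idx B : option 'I_q := [pick k : 'I_q | nth set0 s k == B].
have sE k : k < q -> nth set0 s k \in transversals alpha.
  by move=> kq; rewrite -mem_enum mem_nth ?sz.
have idxT B : B \in transversals alpha -> exists2 k : 'I_q, idx B = Some k & nth set0 s k = B.
  move=> BT; have Bs : B \in s by rewrite mem_enum.
  have lt : index B s < q by rewrite -sz index_mem.
  rewrite /idx; case: pickP => [k /eqP e|/(_ (Ordinal lt))]; first by exists k.
  by rewrite /= nth_index ?eqxx.
have idxN B : B \notin transversals alpha -> idx B = None.
  move=> BT; rewrite /idx; case: pickP => [k /eqP e|//].
  by rewrite -e sE in BT.
have idxk (k : 'I_q) : idx (nth set0 s k) = Some k.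
  case: (idxT _ (sE k (ltn_ord k))) => l -> e; congr Some; apply/val_inj/eqP.
  by rewrite -(nth_uniq set0 (s := s)) ?sz ?ltn_ord ?enum_uniq // e.
exists (fun x => idx (pb alpha (inl x))), (fun y => idx (pb alpha (inr y))); split.
- move=> x y; apply/idP/andP => [h|[/eqP e s1]].
    have /idxT[k ek _] : pb alpha (inl x) \in transversals alpha.
      by rewrite transversal_up (tr_dom h).
    have E : pb alpha (inl x) = pb alpha (inr y) by apply/eqP; rewrite -same_blockE.
    by rewrite -E ek.
  rewrite /tr same_blockE.
  have xT : pb alpha (inl x) \in transversals alpha.
    by apply/negP => /negP/idxN e3; rewrite e3 in s1.
  have yT : pb alpha (inr y) \in transversals alpha.
    by apply/negP => /negP/idxN e3; rewrite e e3 in s1.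
  case: (idxT _ xT) => k ek <-; case: (idxT _ yT) => l el <-.
  by move: e; rewrite ek el => -[->].
- move=> k; have := sE k (ltn_ord k); rewrite transversals_dom => /imsetP[x _ e].
  by exists x; rewrite -e idxk.
- move=> k; have := sE k (ltn_ord k); rewrite transversals_cod => /imsetP[x _ e].
  by exists x; rewrite -e idxk.
Qed.

Lemma tlab_perm q alpha beta (a b a2 b2 : 'I_n -> option 'I_q) :
  tlab alpha a b -> tlab beta a2 b2 -> up alpha =2 up beta -> dom alpha = dom beta ->
  exists pi : 'S_q, a2 =1 pact pi a.
Proof.
move=> L1 L2 eu ed; case: (L1) => h1 h2 h3.
have key k : exists k2, exists2 x, a x = Some k & a2 x = Some k2.
  case: (h2 k) => x e; have := tlab_dom L2 x; rewrite -ed (tlab_dom L1) e /=.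
  by case e2: (a2 x) => [k2|//] _; exists k2, x.
have [f fP] := fin_all_exists key.
have injf : injective f.
  move=> k l e; case: (fP k) => x e1 e2; case: (fP l) => y e3 e4.
  apply/Some_inj; rewrite -e3; apply/esym/eqP; rewrite -(tlab_up L1 _ e1).
  by rewrite eu (tlab_up L2 _ e2) e4 e.
exists (perm injf) => x; rewrite /pact.
have := tlab_dom L2 x; rewrite -ed (tlab_dom L1).
case e: (a x) => [k|] /=; last by case: (a2 x).
move=> _; rewrite permE; case: (fP k) => x' e1 e2; apply/eqP.
by rewrite -(tlab_up L2 _ e2) -eu (tlab_up L1 _ e1) e.
Qed.

Lemma tlab_uniq_b q alpha (a b b' : 'I_n -> option 'I_q) :
  tlab alpha a b -> tlab alpha a b' -> b =1 b'.
Proof.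
move=> L1 L2 y; case: (L1) => h1 h2 h3; case: (L2) => h1' h2' h3'.
case e: (b y) => [k|].
  case: (h2 k) => x xk; apply/esym/eqP; rewrite -(tlab_tr L2 _ xk).
  by rewrite (tlab_tr L1 _ xk) e.
case e': (b' y) => [k|//]; case: (h2 k) => x xk.
have := tlab_tr L1 y xk; rewrite (tlab_tr L2 _ xk) e e' eqxx //.
Qed.

Lemma block_of_inl (A B : {set 'I_n}) x : ((inl x : vertex n) \in block_of A B) = (x \in A).
Proof.
rewrite inE (mem_imset _ _ (@inl_inj _ _)) [X in _ || X](_ : _ = false) ?orbF //.
by apply/imsetP => -[].
Qed.
Lemma block_of_inr (A B : {set 'I_n}) y : ((inr y : vertex n) \in block_of A B) = (y \in B).
Proof.
rewrite inE (mem_imset _ _ (@inr_inj _ _)) [X in X || _](_ : _ = false) ?orbF //.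
by apply/imsetP => -[].
Qed.

Lemma transversal_meet alpha B C u : B \in transversals alpha -> C \in transversals alpha ->
  u \in B -> u \in C -> B = C.
Proof.
rewrite !inE => /andP[Ba _] /andP[Ca _] uB uC.
by rewrite (blockE Ba uB) (blockE Ca uC).
Qed.

Lemma tlab_of_blocks q alpha (A B : 'I_q -> {set 'I_n}) :
  injective (fun i => block_of (A i) (B i)) ->
  transversals alpha = [set block_of (A i) (B i) | i : 'I_q] ->
  tlab alpha (fun x => [pick i | x \in A i]) (fun y => [pick i | y \in B i]).
Proof.
move=> inj tc.
have bc i : block_of (A i) (B i) \in transversals alpha by rewrite tc; apply/imsetP; exists i.
have blk i u : u \in block_of (A i) (B i) -> pb alpha u = block_of (A i) (B i).
  by move=> h; apply/esym/blockE => //; move: (bc i); rewrite inE => /andP[].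
have Ai i x : x \in A i -> [pick i | x \in A i] = Some i.
  move=> xi; case: pickP => [j xj|/(_ i)]; last by rewrite xi.
  by congr Some; apply: inj;
    rewrite -(blk i (inl x)) ?block_of_inl // -(blk j (inl x)) ?block_of_inl.
have Bi i x : x \in B i -> [pick i | x \in B i] = Some i.
  move=> xi; case: pickP => [j xj|/(_ i)]; last by rewrite xi.
  by congr Some; apply: inj;
    rewrite -(blk i (inr x)) ?block_of_inr // -(blk j (inr x)) ?block_of_inr.
split=> [x y|k|k].
- apply/idP/andP => [h|].
    have : pb alpha (inl x) \in transversals alpha by rewrite transversal_up (tr_dom h).
    rewrite tc => /imsetP[i _ e].
    have xi : x \in A i by rewrite -(block_of_inl _ (B i)) -e mem_pb same_block_refl.
    have yi : y \in B i by rewrite -(block_of_inr (A i)) -e mem_pb.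
    by rewrite (Ai i) // (Bi i).
  case=> /eqP; case: pickP => [i xi|//]; case: pickP => [j yj [e]|//] _.
  by rewrite /tr -mem_pb (blk i) ?block_of_inl ?block_of_inr // e.
- have := bc k; rewrite inE => /and3P[_ /set0Pn[[x|x]]];
  rewrite inE ?andbF // block_of_inl andbT => h _.
  by exists x; apply: Ai.
- have := bc k; rewrite inE => /and3P[_ _ /set0Pn[[x|x]]];
  rewrite inE ?andbF // block_of_inr andbT => h.
  by exists x; apply: Bi.
Qed.

Lemma perm_diffP q alpha beta (pi : 'S_q) :
  perm_diff alpha beta pi <->
  exists a b, tlab alpha a b /\ tlab beta (pact pi a) b.
Proof.
split; last first.
  case=> a [b [L1 L2]]; exists (fun k => [set x | a x == Some k]), (fun k =>
    [set y | b y == Some k]).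
  split; [exact: tlab_lvl_inj L1|exact: tlab_transversals L1|].
  rewrite (tlab_transversals L2); apply/setP => B; apply/imsetP/imsetP => -[k _ ->].
    exists (pi^-1%g k) => //; rewrite permKV; congr block_of; apply/setP => x; rewrite !inE /pact.
    case: (a x) => //= i; rewrite !(inj_eq (@Some_inj _)).
    by rewrite -(inj_eq (@perm_inj _ pi) i) permKV.
  exists (pi k) => //; congr block_of; apply/setP => x; rewrite !inE /pact.
  case: (a x) => //= i; rewrite !(inj_eq (@Some_inj _)).
  by rewrite (inj_eq (@perm_inj _ pi)).
case=> A [B [injAB tA tB]].
have bt k : block_of (A k) (B k) \in transversals alpha by rewrite tA; apply/imsetP; exists k.
have L1 := tlab_of_blocks injAB tA.
have injB : injective (fun i => block_of (A i) (B (pi i))).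
  move=> i j e; case: (L1) => _ /(_ i)[x xi] _.
  have xAi : x \in A i by move: xi; case: pickP => // k xk [<-].
  have xAj : x \in A j by rewrite -(block_of_inl _ (B (pi j))) -e block_of_inl.
  by apply: injAB; apply: (transversal_meet (bt i) (bt j) (u := inl x)); rewrite block_of_inl.
have L2 := tlab_of_blocks injB tB.
exists (fun x => [pick i | x \in A i]), (fun y => [pick i | y \in B i]); split=> //.
apply: tlab_ext (tlab_act pi L2) => // y; rewrite /pact.
have un i j : y \in B i -> y \in B j -> i = j.
  move=> yi yj; apply: injAB.
  by apply: (transversal_meet (bt i) (bt j) (u := inr y)); rewrite block_of_inr.
case: pickP => [i yi|no] /=; case: pickP => [j yj|no'] //=.
- by rewrite (un _ _ yi yj).
- by rewrite no' in yi.
- by have := no (pi^-1%g j); rewrite permKV yj.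
Qed.

(** Another numbering conjugates the permutation, and a normal subgroup does
    not see the difference. *)
Lemma perm_class q (N : {group 'S_q}) alpha beta (a b : 'I_n -> option 'I_q) :
  (N <| [set: 'S_q])%g ->
  (exists2 pi : 'S_q, perm_diff alpha beta pi & pi \in N) -> tlab alpha a b ->
  exists2 pi, pi \in N & tlab beta (pact pi a) b.
Proof.
move=> nN [pi /perm_diffP[a1 [b1 [L1 L2]]] piN] L.
have [rho ea] := tlab_perm L1 L (fun _ _ => erefl) erefl.
have eb : pact rho b1 =1 b.
  apply: tlab_uniq_b L; apply: tlab_ext (tlab_act rho L1) => // x; by rewrite ea.
exists (pi ^ rho)%g.
  by rewrite memJ_norm // (subsetP (normal_norm nN)) ?inE.
apply: tlab_ext (tlab_act rho L2) => // x.
rewrite pactM /pact ea /pact; case: (a1 x) => //= i; congr Some.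
by rewrite conjgE !permM permK.
Qed.

Lemma greenH_tlab q alpha beta (a b : 'I_n -> option 'I_q) :
  greenH alpha beta -> tlab alpha a b -> exists pi : 'S_q, tlab beta (pact pi a) b.
Proof.
case/andP => /greenRP[eu ed] /greenLP[el ec] L.
have [a2 [b2 L2]] := tlab_exists (etrans (esym (rank_eqR eu ed)) (tlab_rank L)).
have [rho ea] := tlab_perm L L2 eu ed.
have [|| tau eb] := tlab_perm (tlab_dual L) (tlab_dual L2).
- by move=> x y; rewrite !up_dual.
- by rewrite !dom_dual.
exists (rho * tau^-1)%g; apply: tlab_ext (tlab_act (tau^-1)%g L2) => x.
  by rewrite -pactM /pact ea.
by rewrite /pact eb /pact; case: (b x) => //= i; rewrite permK.
Qed.

(** If all transversals of [alpha] are still reached from above, and no two of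
    them are joined, then they keep their lower parts and their numbers. By
    [rank_mul_eq] this is the case whenever the rank is kept. *)
Lemma tlab_mul q gamma alpha (a b : 'I_n -> option 'I_q) :
  tlab alpha a b ->
  (forall k, exists x t, a x = Some k /\ mid gamma alpha (inl t) (inr x)) ->
  (forall x x' k k', a x = Some k -> a x' = Some k' ->
     mid gamma alpha (inr x) (inr x') -> k = k') ->
  exists2 a', tlab (pmul gamma alpha) a' b &
    forall t k, a' t = Some k <-> exists2 x, a x = Some k & mid gamma alpha (inl t) (inr x).
Proof.
move=> L touch sep; case: (L) => h1 h2 h3.
pose a' t := if [pick x | isSome (a x) && mid gamma alpha (inl t) (inr x)] is Some x then a x
  else None.
have aP t k : a' t = Some k <-> exists2 x, a x = Some k & mid gamma alpha (inl t) (inr x).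
  rewrite /a'; case: pickP => [x /andP[xs m]|no].
    split=> [e|[x' e m']]; first by exists x.
    case e2: (a x) xs => [k2|//] _; congr Some; apply: sep e2 e _.
    by apply: mid_trans m'; rewrite mid_sym.
  by split=> // -[x e m]; have := no x; rewrite e m.
exists a' => //; split=> // [x y|k]; last first.
  by case: (touch k) => x [t [e m]]; exists t; apply/aP; exists x.
apply/tr_mulP/andP => [[z zy m]|[/eqP e s]].
  move: zy; rewrite h1; case e: (a z) => [k|]; last by rewrite andbF.
  rewrite andbT => /eqP <-;
    have /aP -> : exists2 x', a x' = Some k & mid gamma alpha (inl x) (inr x') by exists z.
  by [].
case e2: (a' x) s => [k|//] _; case/aP: (e2) => z zk m; exists z => //.
by rewrite h1 zk -e e2 eqxx.
Qed.

Lemma rank_mul_eq q gamma alpha (a b : 'I_n -> option 'I_q) :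
  tlab alpha a b -> rank (pmul gamma alpha) = q ->
  (forall k, exists x t, a x = Some k /\ mid gamma alpha (inl t) (inr x)) /\
  (forall x x' k k', a x = Some k -> a x' = Some k' ->
     mid gamma alpha (inr x) (inr x') -> k = k').
Proof.
move=> L rq; have r := tlab_rank L; split=> [k|x x' k k' e e' m].
  case: (L) => _ /(_ k)[x e] _; exists x.
  case: (pickP (fun t => mid gamma alpha (inl t) (inr x))) => [t m|no]; first by exists t.
  have := @rank_mul_cut _ gamma alpha x; rewrite rq r ltnn => h.
  suff: false by [].
  by apply: h => [|t]; [rewrite (tlab_dom L) e|rewrite no].
apply/eqP; have := @rank_mul_merge _ gamma alpha x x'; rewrite rq r ltnn => h.
apply/negP => nk; suff: false by []. apply: h => //.
- by rewrite (tlab_dom L) e.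
- by rewrite (tlab_dom L) e'.
- by rewrite (tlab_up L _ e) e' (inj_eq (@Some_inj _)) eq_sym; apply/negP.
Qed.

End Numbering.

(** * How a product depends on its right factor *)

Section LeftMul.
Variable n : nat.
Implicit Types (alpha beta gamma : partn n) (x y z : 'I_n) (u v : vertex n).

Lemma eq_mid gamma alpha beta : up alpha =2 up beta -> mid gamma alpha =2 mid gamma beta.
Proof.
move=> eu; apply: eq_connect => u v; rewrite /mid_edge; congr (_ || _).
by case: u v => [//|x] [//|y].
Qed.

Lemma dom_mulP gamma alpha x :
  reflect (exists2 z, z \in dom alpha & mid gamma alpha (inl x) (inr z))
          (x \in dom (pmul gamma alpha)).
Proof.
apply: (iffP (domP _ _)) => [[y /tr_mulP[z zy m]]|[z /domP[y zy] m]].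
  by exists z => //; apply: tr_dom zy.
by exists y; apply/tr_mulP; exists z.
Qed.

Section EqR.
Variables gamma alpha beta : partn n.
Hypotheses (eu : up alpha =2 up beta) (ed : dom alpha = dom beta).

Lemma Phi_eqR : phi gamma alpha = phi gamma beta.
Proof.
have em := eq_mid gamma eu.
have ef : floating gamma alpha = floating gamma beta.
  apply/setP => z; apply/floatingP/floatingP => -[h1 h2]; split=> w; rewrite -?ed -?em //.
    exact: h2.
    by rewrite em; apply: h1.
  by rewrite em ed; apply: h2.
rewrite !Phi_mid ef; congr #|pred_of_set _|; apply: eq_imset => z.
by apply/setP => w; rewrite !inE em.
Qed.

Lemma up_mulR : up (pmul gamma alpha) =2 up (pmul gamma beta).
Proof. by move=> x y; rewrite !up_mul (eq_mid gamma eu). Qed.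

Lemma dom_mulR : dom (pmul gamma alpha) = dom (pmul gamma beta).
Proof.
have em := eq_mid gamma eu.
apply/setP => x; apply/dom_mulP/dom_mulP => -[z h1 h2]; exists z; rewrite -?ed -?em //.
  by rewrite ed.
by rewrite em.
Qed.

Lemma rank_mulR : rank (pmul gamma alpha) = rank (pmul gamma beta).
Proof. exact: rank_eqR up_mulR dom_mulR. Qed.
End EqR.

Lemma dn_mul_le1 gamma alpha : rank alpha <= 1 -> dn (pmul gamma alpha) =2 dn alpha.
Proof.
move=> r x y; apply/dn_mulP/idP => [[//|[z [z' [h1 h2 _]]]]|h]; last by left.
by apply: rank_le1_cod r _ _; [apply: tr_cod h1|apply: tr_cod h2].
Qed.

Lemma hat_mul gamma alpha beta : rank alpha <= 1 -> rank beta <= 1 ->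
  hat alpha = hat beta -> hat (pmul gamma alpha) = hat (pmul gamma beta).
Proof.
move=> ra rb /hatP[eu el]; apply/hatP; split; first exact: up_mulR.
by move=> x y; rewrite !dn_mul_le1.
Qed.

(** Look at the middle component that contains the upper part of the only
    transversal. Either it reaches an upper vertex, and the product keeps rank
    1; or it does not, and then it floats once the transversal is split. Hence
    the level minus the rank of a product depends on the hat only. *)
Lemma Phi_hat gamma alpha : rank alpha <= 1 ->
  phi gamma (hat alpha) + rank (pmul gamma alpha) = phi gamma alpha + rank alpha.
Proof.
move=> r1; have rm := rank_mulr gamma alpha.
have em : mid gamma (hat alpha) =2 mid gamma alpha by apply: eq_mid => x y; rewrite up_hat.
case: (posnP (rank alpha)) => [r0|].
  by move: rm; rewrite r0 leqn0 => /eqP->; rewrite hat_id.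
move=> r_gt0; have re : rank alpha = 1 by apply/eqP; rewrite eqn_leq r1.
case/rank_gt0P: (r_gt0) => x xd.
pose cls z := [set w | mid gamma alpha (inr z) (inr w)].
have PE a : mid gamma a =2 mid gamma alpha -> phi gamma a = #|[set cls z | z in floating gamma a]|.
  move=> ea; rewrite Phi_mid; congr #|pred_of_set _|; apply: eq_imset => z.
  by apply/setP => w; rewrite !inE ea.
have E1 := PE (hat alpha) em.
have E2 := PE alpha (fun _ _ => erefl).
have xw w : w \in dom alpha -> mid gamma alpha (inr x) (inr w).
  by move=> wd; apply: mid_right; apply: rank_le1 r1 xd wd.
case: (pickP (fun t => mid gamma alpha (inl t) (inr x))) => [t tx|no].
  have -> : rank (pmul gamma alpha) = 1.
    apply/eqP; rewrite eqn_leq (leq_trans rm r1); apply/rank_gt0P; exists t.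
    by apply/dom_mulP; exists x.
  rewrite re E1 E2.
  suff -> : floating gamma (hat alpha) = floating gamma alpha by [].
  apply/setP => z; apply/floatingP/floatingP => -[h1 h2]; split=> [w|w].
  - by rewrite -em.
  - move=> wd; apply/negP => m; have := h1 t; rewrite em; case/negP.
    apply: mid_trans tx (mid_trans (xw w wd) _); by rewrite mid_sym.
  - by rewrite em.
  - by rewrite dom_hat inE.
have -> : rank (pmul gamma alpha) = 0.
  apply/eqP; rewrite rank0; apply/eqP/setP => t; rewrite in_set0.
  apply/dom_mulP => -[z zd m]; have := no t.
  by rewrite (mid_trans m) // mid_sym xw.
rewrite re; move: (phi gamma (hat alpha)) (phi gamma alpha) E1 E2 => p1 p2 E1 E2.
rewrite addn0 addn1 {}E1 {}E2.
have -> : floating gamma (hat alpha) = floating gamma alpha :|: cls x.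
  apply/setP => z; rewrite in_setU [z \in cls x]inE; apply/floatingP/orP => [[h1 _]|].
    case m: (mid gamma alpha (inr x) (inr z)); [by right|left].
    apply/floatingP; split=> [w|w wd]; first by rewrite -em.
    apply/negP => m2; move: m; rewrite (mid_trans (xw w wd)) // mid_sym //.
  case=> [/floatingP[h1 h2]|m]; split=> [w|w]; rewrite ?dom_hat ?in_set0 // em //.
  by apply/negP => m2; have := no w; rewrite (mid_trans m2) // mid_sym.
have clsE z : z \in cls x -> cls z = cls x.
  rewrite inE => m; apply/setP => w; rewrite !inE; apply/idP/idP; first exact: mid_trans.
  by apply: mid_trans; rewrite mid_sym.
have -> : [set cls z | z in floating gamma alpha :|: cls x] = cls x |: [set cls z | z in
  floating gamma alpha].
  apply/setP => C; rewrite imsetU in_setU in_setU1 orbC; congr (_ || _).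
  apply/imsetP/eqP => [[z /clsE -> //]|->]; exists x => //.
  by rewrite inE mid_refl.
rewrite cardsU1 (_ : cls x \notin _) //; apply/imsetP => -[z /floatingP[_ h2] e].
have /negP := h2 x xd; apply; have : x \in cls x by rewrite inE mid_refl.
by rewrite e inE.
Qed.

(** The two products get their upper numberings by transport along [mid],
    which is the same for both, and keep the lower ones. *)
Lemma greenH_mul q gamma alpha beta (a b : 'I_n -> option 'I_q) (pi : 'S_q) :
  tlab alpha a b -> tlab beta (pact pi a) b -> greenH alpha beta ->
  rank (pmul gamma alpha) = q ->
  greenH (pmul gamma alpha) (pmul gamma beta) /\
  perm_diff (pmul gamma alpha) (pmul gamma beta) pi.
Proof.
move=> L1 L2 /andP[/greenRP[eu ed] /greenLP[el ec]] rq.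
have em := eq_mid gamma eu.
have [touch sep] := rank_mul_eq L1 rq.
have rq2 : rank (pmul gamma beta) = q by rewrite -(rank_mulR gamma eu ed).
have [touch2 sep2] := rank_mul_eq L2 rq2.
have [a' L1' E1] := tlab_mul L1 touch sep.
have [a'' L2' E2] := tlab_mul L2 touch2 sep2.
have ea : a'' =1 pact pi a'.
  have h t k : a' t = Some k -> a'' t = Some (pi k).
    move/E1 => [x xk m]; apply/E2; exists x; first by rewrite /pact xk.
    by rewrite -em.
  move=> t; rewrite /pact; case e: (a' t) => [k|]; first by rewrite (h _ _ e).
  case e2: (a'' t) => [k|//]; case/E2: e2 => x; rewrite /pact.
  case e3: (a x) => [l|//] _; rewrite -em => m.
  have /E1 : exists2 x, a x = Some l & mid gamma alpha (inl t) (inr x) by exists x.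
  by rewrite e.
split; last by apply/perm_diffP; exists a', b; split=> //; apply: tlab_ext L2'.
apply/andP; split; first by apply/greenRP; split; [exact: up_mulR|exact: dom_mulR].
have dnE q' c (a1 b1 : 'I_n -> option 'I_q') : tlab c a1 b1 ->
    (forall x x' k k', a1 x = Some k -> a1 x' = Some k' ->
     mid gamma c (inr x) (inr x') -> k = k') -> dn (pmul gamma c) =2 dn c.
  move=> L s x y; apply/dn_mulP/idP => [[//|[z [z' [h1 h2 m]]]]|h]; last by left.
  have := tr_dom h1; rewrite (tlab_dom L); case e: (a1 z) => [k|//] _.
  have := tr_dom h2; rewrite (tlab_dom L); case e': (a1 z') => [k'|//] _.
  have kk := s _ _ _ _ e e' m; subst k'.
  apply: tr_dn2 h1 _; rewrite (tlab_tr L _ e) -(tlab_tr L _ e') //.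
apply/greenLP; split=> [x y|].
  by rewrite (dnE _ _ _ _ L1 sep) (dnE _ _ _ _ L2 sep2) el.
by apply/setP => y; rewrite (tlab_cod L1') (tlab_cod L2').
Qed.

(** The lower kernel of the product can only grow by joining the lower parts of
    the two transversals, and it does so for both factors or for none, no
    matter which upper part goes with which lower part. *)
Lemma hat_mul2 gamma alpha beta : rank alpha = 2 -> greenH alpha beta ->
  hat (pmul gamma alpha) = hat (pmul gamma beta).
Proof.
move=> r2 H; have [a [b L1]] := tlab_exists r2.
have [pi L2] := greenH_tlab H L1.
case/andP: H => /greenRP[eu ed] /greenLP[el ec].
have em := eq_mid gamma eu.
apply/hatP; split; first exact: up_mulR.
have key (c c' : partn n) (a1 b1 a2 : 'I_n -> option 'I_2) : dn c =2 dn c' -> up c =2 up c' ->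
   dom c = dom c' -> tlab c a1 b1 -> tlab c' a2 b1 ->
   forall x y, dn (pmul gamma c) x y -> dn (pmul gamma c') x y.
  move=> ec1 eu1 ed1 M1 M2 x y /dn_mulP[h|]; first by apply/dn_mulP; left; rewrite -ec1.
  case=> z [z' [h1 h2 m]].
  case dxy: (dn c' x y); first by apply/dn_mulP; left.
  have := tr_cod h1; rewrite (tlab_cod M1); case ex: (b1 x) => [k|//] _.
  have := tr_cod h2; rewrite (tlab_cod M1); case ey: (b1 y) => [k'|//] _.
  have nk : k != k'.
    apply/negP => /eqP kk; move/negP: dxy; apply.
    by rewrite -up_dual (tlab_up (tlab_dual M2) _ ex) ey kk.
  have z1 : a1 z = Some k by apply/eqP; rewrite -(tlab_trb M1 _ ex).
  have z1' : a1 z' = Some k' by apply/eqP; rewrite -(tlab_trb M1 _ ey).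
  have := tr_dom h1; rewrite ed1 (tlab_dom M2); case e2: (a2 z) => [l|//] _.
  have := tr_dom h2; rewrite ed1 (tlab_dom M2); case e2': (a2 z') => [l'|//] _.
  have nl : l != l'.
    apply/negP => /eqP ll; have : up c' z z' by rewrite (tlab_up M2 _ e2) e2' ll.
    by rewrite -eu1 (tlab_up M1 _ z1) z1' (inj_eq (@Some_inj _)) eq_sym (negPf nk).
  have mm : mid gamma c' (inr z) (inr z') by rewrite -(eq_mid gamma eu1).
  have [E|E] : (l = k /\ l' = k') \/ (l = k' /\ l' = k).
    have : (l == k) || (l == k').
      move: nk; rewrite -!(inj_eq val_inj); case: (l) (k) (k') => [p hp] [r hr] [s hs] /=; lia.
    have : (l' == k) || (l' == k').
      move: nk; rewrite -!(inj_eq val_inj); case: (l') (k) (k') => [p hp] [r hr] [s hs] /=; lia.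
    case/orP => /eqP e5 /orP[]/eqP e6; subst; rewrite ?eqxx in nl; by [|left|right].
  - apply/dn_mulP; right; exists z, z'; split=> //.
      by rewrite (tlab_trb M2 _ ex) e2 E.1.
    by rewrite (tlab_trb M2 _ ey) e2' E.2.
  - apply/dn_mulP; right; exists z', z; split=> //.
    + by rewrite (tlab_trb M2 _ ex) e2' E.2.
    + by rewrite (tlab_trb M2 _ ey) e2 E.1.
    + by rewrite mid_sym.
move=> x y; apply/idP/idP; first exact: (key _ _ _ _ _ el eu ed L1 L2).
by apply: (key _ _ _ _ _ _ _ _ L2 L1) => *; rewrite ?el ?eu ?ed.
Qed.

End LeftMul.

Section Twisted.
Variables n d : nat.
Implicit Types (alpha beta gamma : partn n).

(** Levels above [d] denote the zero element, so that the product needs no case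
    distinction ([tmul_elt]). *)
Definition elt (i : nat) alpha : twisted n d :=
  if i <= d then Some (inord i, alpha) else None.

Lemma tmul_elt i alpha j beta :
  tmul (elt i alpha) (elt j beta) = elt (i + j + phi alpha beta) (pmul alpha beta).
Proof.
rewrite /elt; case: (leqP i d) => hi; last by rewrite /= ifF //; apply/negbTE; rewrite -ltnNge; lia.
case: (leqP j d) => hj; last by rewrite /= ifF //; apply/negbTE; rewrite -ltnNge; lia.
by rewrite /= !inordK // pmulE phiE.
Qed.

Lemma elt_big i alpha : d < i -> elt i alpha = None.
Proof. by rewrite /elt ltnNge => /negbTE->. Qed.

Lemma eltP (x : twisted n d) : exists i alpha, x = elt i alpha.
Proof.
case: x => [[i alpha]|].
  by exists i, alpha; rewrite /elt -ltnS ltn_ord inord_val.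
by exists d.+1, (Lab (fun _ => tt)); rewrite elt_big.
Qed.

Definition tdual (x : twisted n d) : twisted n d :=
  omap (fun p => (p.1, dual p.2)) x.

Lemma tdual_elt i alpha : tdual (elt i alpha) = elt i (dual alpha).
Proof. by rewrite /elt; case: ifP. Qed.
Lemma tdual_mul x y : tdual (tmul x y) = tmul (tdual y) (tdual x).
Proof.
case: (eltP x) => i [alpha ->]; case: (eltP y) => j [beta ->].
by rewrite !tdual_elt !tmul_elt tdual_elt dual_mul Phi_dual (addnC i j).
Qed.

End Twisted.

(** * Rows 0 and 1 of an fC-matrix *)

Section MatrixFacts.
Variables n d : nat.
Implicit Types M : 'M[symbol]_(n.+1, d.+1).

(** Counting entries beyond level [d] as [RR] matches the convention of [elt]. *)
Definition xentry M q i := if i <= d then entry M q i else RR.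

Lemma xentryE M q i : i <= d -> xentry M q i = entry M q i.
Proof. by rewrite /xentry => ->. Qed.
Lemma xentry_big M q i : d < i -> xentry M q i = RR.
Proof. by rewrite /xentry ltnNge => /negbTE->. Qed.
Lemma xentry_ext M q (F : nat -> symbol) :
  (forall j, j <= d -> entry M q j = F j) -> (forall j, d < j -> F j = RR) ->
  forall j, xentry M q j = F j.
Proof.
by move=> h1 h2 j; case: (leqP j d) => hj; [rewrite xentryE // h1|rewrite xentry_big // h2].
Qed.

Lemma min_rowE M q k : k <= d.+1 -> (forall j, j <= d -> is_R (entry M q j) = (k <= j)) ->
  min_row M q = k.
Proof.
move=> kd h; rewrite /min_row; set p := fun i => _; set s := iota _ _.
have sz : size s = d.+1 by rewrite size_iota.
have fs : find p s <= d.+1 by rewrite -sz find_size.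
have nt j : j <= d -> nth 0 s j = j by move=> jd; rewrite nth_iota.
apply/eqP; rewrite eqn_leq; apply/andP; split; rewrite leqNgt; apply/negP => lt.
  have kd2 : k <= d by lia.
  by have := @before_find _ 0 p s k lt; rewrite nt // /p h // leqnn.
have hs : has p s by rewrite has_find sz; lia.
have fd : find p s <= d by lia.
by have := @nth_find _ 0 p s hs; rewrite nt // /p h // leqNgt lt.
Qed.

Definition is_mu s := match s with Mu | MuUp | MuDown => true | _ => false end.

(** What the shifts caused by multiplication can do to a pair governed by rows
    0 and 1. By [rfmu], with an arrow or [Mu] at (1, i), the positions
    (1, i + c + 1) and (0, i + c) are both [RR] or are linked by [Mu]; by
    [rflink], positions linked by [Mu] stay linked or become [RR] together;
    [rflink0] is for the loss of the transversal in the rank-one half of a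
    linked pair. *)
Record row_facts M : Prop := RowFacts {
  rf0 : forall j, [\/ xentry M 0 j = Delta, xentry M 0 j = Mu | xentry M 0 j = RR];
  rf1 : forall j, [\/ xentry M 1 j = Delta, is_mu (xentry M 1 j) | xentry M 1 j = RR];
  rfR0 : forall j j', j <= j' -> xentry M 0 j = RR -> xentry M 0 j' = RR;
  rfR1 : forall j j', j <= j' -> xentry M 1 j = RR -> xentry M 1 j' = RR;
  rfR10 : forall j, xentry M 1 j = RR -> xentry M 0 j = RR;
  rfmu : forall i c, is_mu (xentry M 1 i) ->
    xentry M 1 (i + c).+1 = RR /\ xentry M 0 (i + c) = RR \/
    [/\ xentry M 1 (i + c).+1 = Mu, xentry M 0 (i + c) = Mu & min_row M 1 = (min_row M 0).+1];
  rflink : forall i j c, xentry M 1 i = Mu -> xentry M 0 j = Mu ->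
    i + min_row M 0 = j + min_row M 1 ->
    xentry M 1 (i + c) = RR /\ xentry M 0 (j + c) = RR \/
    xentry M 1 (i + c) = Mu /\ xentry M 0 (j + c) = Mu;
  rflink0 : forall i j c, xentry M 1 i = Mu -> xentry M 0 j = Mu ->
    i + min_row M 0 = j + min_row M 1 ->
    xentry M 0 (i + c) = RR /\ xentry M 0 (j + c).+1 = RR \/ i = j.+1;
  rfuniq : forall i j, is_mu (xentry M 1 i) -> xentry M 1 i <> Mu ->
    is_mu (xentry M 1 j) -> xentry M 1 j <> Mu -> i = j
}.

Ltac ifs := repeat match goal with
  | |- context[if ?b then _ else _] => let E := fresh "E" in destruct b eqn:E
  | H : context[if ?b then _ else _] |- _ => let E := fresh "E" in destruct b eqn:E
  end.
Ltac fin := try done; try (exfalso; lia); try lia.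
Ltac finb := first [done | exfalso; lia | apply/esym/negbTE; rewrite -ltnNge; lia | apply/esym;
  lia].
(** Once the rows are explicit, every field of [row_facts] is a comparison of
    indices. *)
Ltac rowtac E0 E1 m0 m1 :=
  constructor; rewrite ?m0 ?m1; clear m0 m1; intros;
  repeat match goal with
   | H : context [xentry _ 0 ?j] |- _ => rewrite -> (E0 j) in H
   | H : context [xentry _ 1 ?j] |- _ => rewrite -> (E1 j) in H end;
  rewrite ?E0 ?E1; clear E0 E1; ifs;
  try done; try (exfalso; lia); try (constructor 1; done); try (constructor 2; done);
    try (constructor 3; done);
  try (left; split; done); try (right; split; (done || lia)); try lia; try (left; lia);
    try (right; lia).

Lemma fC_row_facts M : fC_matrix M -> row_facts M.
Proof.
case=> rows _ _ _.
have elt q k F : k <= d.+1 -> (forall j, j <= d -> entry M q j = F j) ->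
   (forall j, is_R (F j) = (k <= j)) -> min_row M q = k.
  by move=> h1 h2 h3; apply: min_rowE => // j jd; rewrite h2.
case: rows.
- case=> k kd h.
  have E0 : forall j, xentry M 0 j = if j < k then Delta else RR.
    by apply: xentry_ext => [j jd|j dj]; [exact: (h j jd).1|ifs; fin].
  have E1 : forall j, xentry M 1 j = if j < k then Delta else RR.
    by apply: xentry_ext => [j jd|j dj]; [exact: (h j jd).2|ifs; fin].
  have m0 : min_row M 0 = k.
    by apply: elt; [|move=> j jd; exact: (h j jd).1|move=> j /=; ifs => /=; finb]; lia.
  have m1 : min_row M 1 = k.
    by apply: elt; [|move=> j jd; exact: (h j jd).2|move=> j /=; ifs => /=; finb]; lia.
  by rowtac E0 E1 m0 m1.
- case=> i0 [k [z [ik kd zz h]]].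
  have E0 : forall j, xentry M 0 j = if j < i0 then Delta else if j < k then Mu else RR.
    by apply: xentry_ext => [j jd|j dj]; [exact: (h j jd).1|ifs; fin].
  have E1 : forall j, xentry M 1 j = if j < i0 then Delta else if j == i0 then z else if j <= k
    then Mu else RR.
    by apply: xentry_ext => [j jd|j dj]; [exact: (h j jd).2|ifs; fin].
  have m0 : min_row M 0 = k.
    by apply: elt; [|move=> j jd; exact: (h j jd).1|move=> j /=; ifs => /=; finb]; lia.
  have m1 : min_row M 1 = k.+1.
    by apply: elt; [|move=> j jd; exact: (h j jd).2|move=> j /=; case: zz => ->; ifs => /=;
      finb]; lia.
  by case: zz => ez; rewrite ez in E1; rowtac E0 E1 m0 m1.
- case=> k [l [z [kl ld zz h]]].
  have E0 : forall j, xentry M 0 j = if j < k then Delta else RR.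
    by apply: xentry_ext => [j jd|j dj]; [exact: (h j jd).1|ifs; fin].
  have E1 : forall j, xentry M 1 j = if j.+1 < l then Delta else if j.+1 == l then z else RR.
    by apply: xentry_ext => [j jd|j dj]; [exact: (h j jd).2|ifs; fin].
  have m0 : min_row M 0 = k.
    by apply: elt; [|move=> j jd; exact: (h j jd).1|move=> j /=; ifs => /=; finb]; lia.
  have m1 : min_row M 1 = l.
    by apply: elt; [|move=> j jd; exact: (h j jd).2|move=> j /=; case: zz => ->; ifs => /=;
      finb]; lia.
  by case: zz => ez; rewrite ez in E1; rowtac E0 E1 m0 m1.
- case=> k [l [k0 kl ld h]].
  have E0 : forall j, xentry M 0 j = if j.+1 < k then Delta else if j.+1 == k then Mu else RR.
    by apply: xentry_ext => [j jd|j dj]; [exact: (h j jd).1|ifs; fin].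
  have E1 : forall j, xentry M 1 j = if j.+1 < l then Delta else if j.+1 == l then Mu else RR.
    by apply: xentry_ext => [j jd|j dj]; [exact: (h j jd).2|ifs; fin].
  have m0 : min_row M 0 = k.
    by apply: elt; [|move=> j jd; exact: (h j jd).1|move=> j /=; ifs => /=; finb]; lia.
  have m1 : min_row M 1 = l.
    by apply: elt; [|move=> j jd; exact: (h j jd).2|move=> j /=; ifs => /=; finb]; lia.
  by rowtac E0 E1 m0 m1.
Qed.

End MatrixFacts.

(** * The higher rows, and the relation of an fC-matrix beyond level d *)

Section Cong.
Variables n d : nat.
Implicit Types (M : 'M[symbol]_(n.+1, d.+1)) (alpha beta gamma : partn n).

(** The field [hfV] is [V1] with the row types taken into account: the only
    symbols left below an N-symbol are [RR] and, in row 1, [Mu]. *)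
Record high_facts M : Prop := HighFacts {
  hf : forall q j, 1 < q <= n ->
    [\/ xentry M q j = Delta, xentry M q j = RR |
        exists2 N : {group 'S_q}, xentry M q j = Nsym N & (N <| [set: 'S_q])%g];
  hfR : forall q j j', 1 < q <= n -> j <= j' -> xentry M q j = RR -> xentry M q j' = RR;
  hfN : forall q j j' (N : {group 'S_q}), 1 < q <= n -> j <= j' -> xentry M q j = Nsym N ->
    xentry M q j' = RR \/ exists2 N' : {group 'S_q}, xentry M q j' = Nsym N' & N \subset N';
  hfRd : forall q j, 1 < q <= n -> xentry M q j = RR -> xentry M q.-1 j = RR;
  hfV : forall q j, 1 < q <= n -> is_N (xentry M q j) ->
    xentry M q.-1 j = RR \/ q = 2 /\ xentry M 1 j = Mu
}.

Lemma Nsym_inj q (N N' : {group 'S_q}) : Nsym N = Nsym N' -> N = N'.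
Proof.
pose f s := match s with Nsym q' K => Some (Tagged (fun r => {group 'S_r}) K) | _ => None end.
move=> e; have : f (Nsym N) = f (Nsym N') by rewrite e.
by case => /eqP; rewrite eq_Tagged /= => /eqP.
Qed.

Lemma fC_high_facts M : fC_matrix M -> high_facts M.
Proof.
move=> fc; have rf := fC_row_facts fc; case: fc => _ h5 v1 v2.
have row q : 1 < q <= n -> exists i k (N : nat -> {group 'S_q}),
    [/\ i <= k <= d.+1,
      forall j, i <= j < k -> (N j <| [set: 'S_q])%g /\ N j :!=: 1%g,
      forall j j', i <= j -> j <= j' -> j' < k -> N j \subset N j' &
      forall j, xentry M q j = (if j < i then Delta else if j < k then Nsym (N j) else RR)].
  move=> qn; case: (h5 q qn) => i [k [N [h1 h2 h3 h4]]]; exists i, k, N; split=> //.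
  apply: xentry_ext => // j dj; rewrite !ifF //; lia.
have Rd q j : 1 < q <= n -> xentry M q j = RR -> xentry M q.-1 j = RR.
  move=> qn; case: (leqP j d) => jd; last by rewrite !xentry_big.
  by rewrite !xentryE // => /(v2 _ _ qn jd).
split.
- move=> q j qn; case: (row q qn) => i [k [N [h1 h2 h3 ->]]].
  case: ifP => [_|ij]; first by constructor 1.
  case: ifP => jk; last by constructor 2.
  by constructor 3; exists (N j) => //; apply: (h2 j _).1; lia.
- move=> q j j' qn jj'; case: (row q qn) => i [k [N [h1 h2 h3 h4]]]; rewrite !h4.
  case: ifP => // ij; case: ifP => // jk _; rewrite !ifF //; lia.
- move=> q j j' K qn jj'; case: (row q qn) => i [k [N [h1 h2 h3 h4]]]; rewrite !h4.
  case: ifP => // ij; case: ifP => // jk /Nsym_inj <-.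
  case: ifP => ij'; first by lia.
  case: ifP => jk'; last by left.
  by right; exists (N j') => //; apply: h3; lia.
- exact: Rd.
- move=> q j qn; case: (leqP j d) => jd; last by rewrite xentry_big.
  case: q qn => // q qn; rewrite xentryE // => Nq.
  have vv := v1 q j (proj2 (andP qn)) jd Nq; rewrite -!(xentryE _ _ jd) in vv.
  case: (leqP q 1) => q1.
    have eq1 : q = 1 by lia.
    subst q; have := rf1 rf j; case=> [e|e|e].
    + by case: vv; constructor 1.
    + by right; split=> //; case: (xentry M 1 j) e vv => // _ []; by [constructor 2|constructor 3].
    + by left.
  have qn' : 1 < q <= n by lia.
  case: (row q qn') => i [k [N [h1 h2 h3 h4]]]; left; rewrite /= h4.
  move: vv; rewrite h4; case: ifP => [_ []|_]; first by constructor 1.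
  by case: ifP => // _ []; constructor 4.
Qed.

Section Cgx.
Variable M : 'M[symbol]_(n.+1, d.+1).
Hypothesis fc : fC_matrix M.
Let rf := fC_row_facts fc.
Let hf' := fC_high_facts fc.

Lemma rank_le_n alpha : rank alpha <= n.
Proof.
rewrite rank_dom; apply: leq_trans (leq_imset_card _ _) _.
by rewrite -[X in _ <= X]card_ord max_card.
Qed.

Lemma xentry_R_mono q q' i i' : q <= n -> q' <= q -> i <= i' -> xentry M q i = RR ->
  xentry M q' i' = RR.
Proof.
move=> qn q'q ii' e.
have {}e : xentry M q i' = RR.
  case: q qn {q'q} e => [|[|q]] qn e; [exact: (rfR0 rf ii' e)|exact: (rfR1 rf ii' e)|].
  have qq : 1 < q.+2 <= n by [].
  exact: (hfR hf' qq ii' e).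
elim: q qn q'q e => [|q IH] qn q'q e; first by move: q'q; rewrite leqn0 => /eqP ->.
case: (eqVneq q' q.+1) => [->//|ne]; apply: IH; [by lia|by lia|].
case: q qn q'q e {ne} => [|q] qn q'q e; first exact: (rfR10 rf e).
have qq : 1 < q.+2 <= n by [].
exact: (hfRd hf' qq e).
Qed.

(** The relation [cg] continued to all levels by [xentry], with the condition
    on levels and thresholds in additive form. Being related to the zero element
    becomes being related to an element of level above [d] ([cg_elt]). *)
Definition xcg i alpha j beta : Prop :=
  let q := rank alpha in let r := rank beta in
  [\/ (i = j /\ alpha = beta) \/ (xentry M q i = RR /\ xentry M r j = RR),
      exists2 N : {group 'S_q}, (1 < q /\ xentry M q i = Nsym N) &
        [/\ i = j, greenH alpha beta & exists2 pi : 'S_q, perm_diff alpha beta pi & pi \in N],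
      [/\ q = 1, r = 1, i = j, hat alpha = hat beta &
          xentry M 1 i = MuDown /\ greenL alpha beta \/ xentry M 1 i = MuUp /\ greenR alpha beta] |
      [/\ xentry M q i = Mu, xentry M r j = Mu, q <= 1 /\ r <= 1, hat alpha = hat beta &
          i + min_row M r = j + min_row M q]].

Lemma greenR_refl alpha : greenR alpha alpha. Proof. exact: eqxx. Qed.
Lemma greenL_refl alpha : greenL alpha alpha. Proof. exact: eqxx. Qed.

Lemma perm_diff1 alpha : perm_diff alpha alpha (1%g : 'S_(rank alpha)).
Proof.
have [a [b L]] := tlab_exists (erefl (rank alpha)).
apply/perm_diffP; exists a, b; split=> //.
by apply: tlab_ext L => // x; rewrite pact1.
Qed.

Lemma Mu_row q i : q <= n -> i <= d -> xentry M q i = Mu -> q <= 1.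
Proof.
move=> qn id e; case: (leqP q 1) => // q1; have qq : 1 < q <= n by rewrite q1.
by case: (hf hf' i qq) => [h|h|[N h _]]; rewrite h in e.
Qed.
Lemma MuX_row q i : q <= n -> i <= d -> (xentry M q i = MuUp \/ xentry M q i = MuDown) -> q = 1.
Proof.
case: q => [|[|q]] qn id //.
  by case: (rf0 rf i) => -> [].
by case: (hf hf' i (qn : 1 < q.+2 <= n)) => [->|->|[N -> _]] [].
Qed.
Lemma N_row q r i (N : {group 'S_r}) : q <= n -> xentry M q i = Nsym N -> 1 < q /\ q = r.
Proof.
move=> qn e; case: q qn e => [|[|q]] qn e.
- by case: (rf0 rf i) => h; rewrite h in e.
- by case: (rf1 rf i) => h; rewrite e in h.
- case: (hf hf' i (qn : 1 < q.+2 <= n)) => [h|h|[K eK _]];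
  [by rewrite h in e|by rewrite h in e|split=> //].
  rewrite e in eK.
  pose f s := match s with Nsym q' K => q' | _ => 0 end.
  by have : f (Nsym N) = f (Nsym K) by rewrite eK.
Qed.

Lemma cg_elt i alpha j beta : cg M (elt d i alpha) (elt d j beta) <-> xcg i alpha j beta.
Proof.
have rn := rank_le_n alpha; have sn := rank_le_n beta.
have R_only k (c c' : partn n) l : d < k -> xcg k c l c' -> xentry M (rank c') l = RR.
  move=> dk; rewrite /xcg; case.
  - by case=> [[<- <-]|[]//]; rewrite xentry_big.
  - by case=> N [_]; rewrite xentry_big.
  - by case=> _ -> <- _ _; rewrite xentry_big.
  - by case; rewrite xentry_big.
have R_only' k (c c' : partn n) l : d < l -> xcg k c l c' -> xentry M (rank c) k = RR.
  move=> dl; rewrite /xcg; case.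
  - by case=> [[-> ->]|[]//]; rewrite xentry_big.
  - by case=> N _ [-> _ _]; rewrite xentry_big.
  - by case=> -> _ -> _ _; rewrite xentry_big.
  - by case=> _; rewrite xentry_big.
rewrite /elt; case: (leqP i d) => id; case: (leqP j d) => jd.
- rewrite /= /cg_nz !inordK // -!xentryE //; split.
  + case=> [[e1 e2 -> ->]|[[e1 e2]|[[N [[e1 e2] e3 H P]]|[[e1 e2 h g]|[[e1 e2 h g]|[e1 e2 h
    e3]]]]]].
    * by constructor 1; left.
    * by constructor 1; right.
    * by constructor 2; exists N; split=> //; exact: (N_row rn e1).1.
    * have q1 := MuX_row rn id (or_intror e1); have r1 := MuX_row sn jd (or_intror e2).
      rewrite q1 in e1; rewrite r1 in e2.
      constructor 3; split=> //; last by left.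
      by apply: (rfuniq rf); rewrite ?e1 ?e2.
    * have q1 := MuX_row rn id (or_introl e1); have r1 := MuX_row sn jd (or_introl e2).
      rewrite q1 in e1; rewrite r1 in e2.
      constructor 3; split=> //; last by right.
      by apply: (rfuniq rf); rewrite ?e1 ?e2.
    * constructor 4; split=> //; first by split; [exact: Mu_row e1|exact: Mu_row e2].
      by case: e3 => [[-> ->]|] //; lia.
  + case=> [[[e1 e2]|[e1 e2]]|[N [q1 e1] [e2 H P]]|[e1 e2 e3 h g]|[e1 e2 [q1 r1] h e3]].
    * rewrite -e1 -e2.
      case: (leqP (rank alpha) 1) => q1; last first.
        have qq : 1 < rank alpha <= n by rewrite q1.
        case: (hf hf' i qq) => [e|e|[N e nN]].
        - by left.
        - by right; left.
        - right; right; left; exists N; split=> //;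
          first by rewrite /greenH greenR_refl greenL_refl.
          by exists 1%g; [exact: perm_diff1|exact: group1].
      have : [\/ xentry M (rank alpha) i = Delta,
        is_mu (xentry M (rank alpha) i) | xentry M (rank alpha) i = RR].
        case: (rank alpha) q1 => [|[|//]] _; last exact: (rf1 rf).
        by case: (rf0 rf i) => ->; by [constructor 1|constructor 2|constructor 3].
      case=> [e|e|e]; [by left| |by right; left].
      case E: (xentry M _ _) e => // _; right; right; right.
      - by right; left; split=> //; exact: greenR_refl.
      - by left; split=> //; exact: greenL_refl.
      - by right; right; split=> //; left.
    * by right; left.
    * right; right; left; exists N; split=> //; split=> //; rewrite -e2.
      have <- : rank alpha = rank beta; last by [].
      by case/andP: H => /greenRP[eu ed] _; apply: rank_eqR.
    * rewrite e1 e2 -e3; case: g => -[em g]; right; right; right; by [left|right; left].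
    * by right; right; right; right; right; split=> //; right; lia.
- split=> [|h]; first by rewrite /= inordK // -xentryE // => e; constructor 1; right;
  rewrite (xentry_big _ _ jd).
  by rewrite /= inordK // -xentryE //; apply: R_only' jd h.
- split=> [|h]; first by rewrite /= inordK // -xentryE // => e; constructor 1; right;
  rewrite (xentry_big _ _ id).
  by rewrite /= inordK // -xentryE //; apply: R_only id h.
- by split=> // _; constructor 1; right; rewrite !xentry_big.
Qed.

End Cgx.
End Cong.

(** * The relation of an fC-matrix is a congruence *)

Section Cong.
Variables n d : nat.
Implicit Types (alpha beta gamma : partn n).
Variable M : 'M[symbol]_(n.+1, d.+1).
Hypothesis fc : fC_matrix M.
Let rf := fC_row_facts fc.
Let hf' := fC_high_facts fc.

Lemma greenR_sym alpha beta : greenR alpha beta = greenR beta alpha.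
Proof. exact: eq_sym. Qed.
Lemma greenL_sym alpha beta : greenL alpha beta = greenL beta alpha.
Proof. exact: eq_sym. Qed.
Lemma greenH_sym alpha beta : greenH alpha beta = greenH beta alpha.
Proof. by rewrite /greenH greenR_sym greenL_sym. Qed.
Lemma greenR_trans : transitive (@greenR n).
Proof. by move=> b a c /eqP h1 /eqP h2; apply/eqP; rewrite h1 h2. Qed.
Lemma greenL_trans : transitive (@greenL n).
Proof. by move=> b a c /eqP h1 /eqP h2; apply/eqP; rewrite h1 h2. Qed.
Lemma greenH_rank alpha beta : greenH alpha beta -> rank alpha = rank beta.
Proof. by case/andP => /greenRP[h1 h2] _; apply: rank_eqR. Qed.

Lemma perm_diff_sym q alpha beta (pi : 'S_q) :
  perm_diff alpha beta pi -> perm_diff beta alpha (pi^-1)%g.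
Proof.
move/perm_diffP => [a [b [L1 L2]]]; apply/perm_diffP; exists (pact pi a), b; split=> //.
by apply: tlab_ext L1 => // x; rewrite pactM mulgV pact1.
Qed.

Lemma Nnormal q i (N : {group 'S_q}) : q <= n -> xentry M q i = Nsym N -> (N <| [set: 'S_q])%g.
Proof.
move=> qn e; have [q1 _] := N_row fc qn e; have qq : 1 < q <= n by rewrite q1.
by case: (hf hf' i qq) => [h|h|[N' h nN]]; rewrite h in e => //; rewrite -(Nsym_inj e).
Qed.

Lemma xcg_sym i alpha j beta : xcg M i alpha j beta -> xcg M j beta i alpha.
Proof.
case=> [[[-> ->]|[e1 e2]]|[N [q1 e1] [<- H [pi P piN]]]|[r1 r2 <- h g]|[e1 e2 [r1 r2] h e3]].
- by constructor 1; left.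
- by constructor 1; right.
- have rk := greenH_rank H; rewrite /xcg.
  have {}P := perm_diff_sym P; move: N pi q1 e1 P piN; rewrite rk => N pi q1 e1 P piN.
  constructor 2; exists N; split=> //; first by rewrite greenH_sym.
  by exists (pi^-1)%g; rewrite ?groupV.
- constructor 3; split=> //.
  by case: g => -[em g]; [left|right]; split=> //; [rewrite greenL_sym|rewrite greenR_sym].
- by constructor 4; split.
Qed.

Lemma xcg_trans i alpha j beta k gamma :
  xcg M i alpha j beta -> xcg M j beta k gamma -> xcg M i alpha k gamma.
Proof.
case=> [[[-> ->]//|[e1 e2]]|[N [q1 e1] [<- H P]]|[r1 r2 <- h g]|[e1 e2 [r1 r2] h e3]].
- case=> [[[<- <-]|[e3 e4]]|[N [q1 e3]]|[r1 r2 _ _]|[e3]].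
  + by constructor 1; right.
  + by constructor 1; right.
  + by rewrite e2 in e3.
  + by case=> -[e3]; rewrite r1 e3 in e2.
  + by rewrite e2 in e3.
- have rk := greenH_rank H.
  case=> [[[<- <-]|[e3 e4]]|[N' [q1' e3] [<- H' P']]|[r1 r2 _ _ _]|[e3 _ [r1]]].
  + by constructor 2; exists N.
  + by rewrite -rk e1 in e3.
  + have nN := Nnormal (rank_le_n _) e1.
    have [a [b L1]] := tlab_exists (erefl (rank alpha)).
    have [pi piN L2] := perm_class nN P L1.
    move: N' q1' e3 P'; rewrite -rk => N' q1' e3 P'.
    have NN : N = N' by apply: Nsym_inj; rewrite -e1 -e3.
    subst N'; have [rho rhoN L3] := perm_class nN P' L2.
    constructor 2; exists N => //; split=> //.
      case/andP: H => h1 h2; case/andP: H' => h3 h4; apply/andP; split.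
        exact: greenR_trans h1 h3.
      exact: greenL_trans h2 h4.
    exists (pi * rho)%g; last by rewrite groupM.
    apply/perm_diffP; exists a, b; split=> //.
    by apply: tlab_ext L3 => // x; rewrite pactM.
  + by move: q1; rewrite rk r1.
  + by move: q1; rewrite rk ltnNge r1.
- case=> [[[<- <-]|[e3 e4]]|[N' [q1' e3] [<- H' P']]|[r3 r4 <- h' g']|[e3 e4 [r3 r4] h' e5]].
  + by constructor 3.
  + by rewrite r2 in e3; case: g => -[g]; rewrite g in e3.
  + by rewrite r2 in q1'.
  + constructor 3; split=> //; first by rewrite h.
    case: g g' => -[g1 g2] [] [g3 g4].
    * by left; split=> //; apply: greenL_trans g2 g4.
    * by rewrite g1 in g3.
    * by rewrite g1 in g3.
    * by right; split=> //; apply: greenR_trans g2 g4.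
  + by rewrite r2 in e3; case: g => -[g]; rewrite g in e3.
- case=> [[[<- <-]|[e4 e5]]|[N' [q1' e4] _]|[r3 r4 <- h' g']|[e4 e5 [r3 r4] h' e6]].
  + by constructor 4.
  + by rewrite e2 in e4.
  + by move: q1'; rewrite ltnNge r2.
  + by rewrite r3 in e2; case: g' => -[g]; rewrite g in e2.
  + by constructor 4; split=> //; [rewrite h|lia].
Qed.

Lemma low_shift k i gamma alpha : rank alpha <= 1 ->
  (k + i + phi gamma alpha) + rank alpha =
  i + (k + phi gamma (hat alpha)) + rank (pmul gamma alpha).
Proof. by move=> r; have := Phi_hat gamma r; lia. Qed.

Lemma xcg_Mu1 i alpha beta : rank alpha = 1 -> rank beta = 1 -> hat alpha = hat beta ->
  xentry M 1 i = Mu -> xcg M i alpha i beta.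
Proof. by move=> ra rb h e; constructor 4; rewrite ra rb; split. Qed.

Lemma xcg_hat0 i alpha beta : rank alpha = 0 -> rank beta = 0 -> hat alpha = hat beta ->
  xcg M i alpha i beta.
Proof.
by move=> ra rb h; constructor 1; left; rewrite -(hat_id ra) -(hat_id rb) h.
Qed.

(** By [Phi_hat] the levels of the two products are [i0 + c - 1] plus their
    ranks. If both ranks are 1 and [c] is 0 the level has not moved, and the
    original reason for the relation must be transported; in all other cases
    [rfmu] decides. *)
Lemma xcg_left_mu c i j i0 alpha beta :
  is_mu (xentry M 1 i0) -> rank alpha <= 1 -> rank beta <= 1 -> hat alpha = hat beta ->
  i0 <= i -> i0 <= j -> i.+1 = i0 + c + rank alpha -> j.+1 = i0 + c + rank beta ->
  (c = 0 -> rank alpha = 1 -> rank beta = 1 -> xcg M i0 alpha i0 beta) ->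
  xcg M i alpha j beta.
Proof.
move=> mu ra rb h i0i i0j ei ej c0.
case: (posnP (rank alpha)) => ra0; case: (posnP (rank beta)) => rb0.
- have -> : i = j by lia.
  exact: xcg_hat0.
- have {}rb : rank beta = 1 by lia.
  have ec : c = c.-1.+1 by lia.
  have -> : i = i0 + c.-1 by lia.
  have -> : j = (i0 + c.-1).+1 by lia.
  rewrite /xcg ra0 rb; case: (rfmu rf c.-1 mu) => [[e1 e2]|[e1 e2 e3]].
    by constructor 1; right.
  by constructor 4; split=> //; lia.
- have {}ra : rank alpha = 1 by lia.
  have ec : c = c.-1.+1 by lia.
  have -> : j = i0 + c.-1 by lia.
  have -> : i = (i0 + c.-1).+1 by lia.
  rewrite /xcg rb0 ra; case: (rfmu rf c.-1 mu) => [[e1 e2]|[e1 e2 e3]].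
    by constructor 1; right.
  by constructor 4; split=> //; lia.
- have {}ra : rank alpha = 1 by lia.
  have {}rb : rank beta = 1 by lia.
  have -> : i = i0 + c by lia.
  have -> : j = i0 + c by lia.
  case: c {ei ej i0i i0j} c0 => [|c] c0; first by rewrite addn0; apply: c0.
  rewrite addnS /xcg ra rb; case: (rfmu rf c mu) => [[e1 e2]|[e1 e2 e3]].
    by constructor 1; right.
  by constructor 4; split.
Qed.

(** If the rank-one partition keeps its rank, the linked positions are shifted
    together ([rflink]); if it does not, its product ends up one level lower
    than with rank 1, and [rflink0] applies. *)
Lemma xcg_left_link k i alpha j beta gamma :
  xentry M 1 i = Mu -> xentry M 0 j = Mu -> rank alpha = 1 -> rank beta = 0 ->
    hat alpha = hat beta ->
  i + min_row M 0 = j + min_row M 1 ->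
  xcg M (k + i + phi gamma alpha) (pmul gamma alpha) (k + j + phi gamma beta) (pmul gamma beta).
Proof.
move=> e1 e2 ra rb h e3.
have s1 := @low_shift k i gamma alpha; have s2 := @low_shift k j gamma beta.
move: s1 s2; rewrite -h ra rb => /(_ isT) s1 /(_ isT) s2.
have hm : hat (pmul gamma alpha) = hat (pmul gamma beta) by apply: hat_mul; rewrite ?ra ?rb.
have ra' := rank_mulr gamma alpha; have rb' := rank_mulr gamma beta.
rewrite ra in ra'; rewrite rb in rb'.
move: (k + phi gamma (hat alpha)) s1 s2 => c s1 s2.
have {}rb' : rank (pmul gamma beta) = 0 by lia.
move: s2; rewrite rb' !addn0 => ->.
case: (posnP (rank (pmul gamma alpha))) => ra0.
  case: (rflink0 rf c.-1 e1 e2 e3) => [[f1 f2]|eij].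
    constructor 1; right; rewrite ra0 rb'.
    have ec : c = c.-1.+1 by lia.
    split; first by rewrite (_ : k + i + phi gamma alpha = i + c.-1) //; lia.
    by rewrite (_ : j + c = (j + c.-1).+1) //; lia.
  have -> : k + i + phi gamma alpha = j + c by lia.
  exact: xcg_hat0.
have {}ra' : rank (pmul gamma alpha) = 1 by lia.
have -> : k + i + phi gamma alpha = i + c by lia.
rewrite /xcg ra' rb'; case: (rflink rf c e1 e2 e3) => -[f1 f2].
  by constructor 1; right.
by constructor 4; split=> //; lia.
Qed.

(** As long as the rank is kept, so is the permutation. If the rank drops, the
    symbol below the N-symbol is [RR], or the rank was 2 and [Mu] stands below;
    then the products have one hat by [hat_mul2]. *)
Lemma xcg_left_N k i alpha beta gamma (N : {group 'S_(rank alpha)}) (pi : 'S_(rank alpha)) :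
  1 < rank alpha -> xentry M (rank alpha) i = Nsym N -> greenH alpha beta ->
  perm_diff alpha beta pi -> pi \in N ->
  xcg M (k + i + phi gamma alpha) (pmul gamma alpha) (k + i + phi gamma beta) (pmul gamma beta).
Proof.
move=> q1 e H P piN; have rn := rank_le_n alpha; have qq : 1 < rank alpha <= n by rewrite q1.
have [eu ed] : up alpha =2 up beta /\ dom alpha = dom beta by case/andP: H => /greenRP.
rewrite -(Phi_eqR gamma eu ed); set i' := k + i + _; have ii' : i <= i' by rewrite /i'; lia.
have rk := rank_mulR gamma eu ed.
have := rank_mulr gamma alpha; rewrite leq_eqVlt => /orP[/eqP eq|lt].
  have nN := Nnormal rn e.
  have [a [b L1]] := tlab_exists (erefl (rank alpha)).
  have [rho rhoN L2] := perm_class nN (ex_intro2 _ _ pi P piN) L1.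
  have [H' P'] := greenH_mul L1 L2 H eq.
  case: (hfN hf' qq ii' e) => [e'|[N' e' NN']].
    by constructor 1; right; rewrite -rk eq.
  constructor 2; rewrite eq; exists N' => //; split=> //; exists rho => //.
  exact: (subsetP NN').
have isN : is_N (xentry M (rank alpha) i) by rewrite e.
case: (hfV hf' qq isN) => [e'|[r2 e']].
  constructor 1; right; rewrite -rk.
  have e'' : xentry M (rank (pmul gamma alpha)) i' = RR.
    by apply: (xentry_R_mono fc) e'; lia.
  by split.
have h := hat_mul2 gamma r2 H.
have r1 : rank (pmul gamma alpha) <= 1 by lia.
have [c ec] : exists c, i' = i + c by exists (i' - i); lia.
rewrite ec.
case: (posnP (rank (pmul gamma alpha))) => r0; first by apply: xcg_hat0; rewrite -?rk.
have {}r1 : rank (pmul gamma alpha) = 1 by lia.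
apply: (@xcg_left_mu c _ _ i); rewrite -?rk ?e' ?r1 //; try lia.
by move=> _ _ _; apply: xcg_Mu1; rewrite -?rk.
Qed.

Lemma xcg_left k i alpha j beta gamma : xcg M i alpha j beta ->
  xcg M (k + i + phi gamma alpha) (pmul gamma alpha) (k + j + phi gamma beta) (pmul gamma beta).
Proof.
case=> [[[-> ->]|[e1 e2]]|[N [q1 e1] [<- H [pi P piN]]]|[r1 r2 <- h g]|[e1 e2 [r1 r2] h e3]].
- by constructor 1; left.
- constructor 1; right; split.
    by apply: (xentry_R_mono fc) e1; [exact: rank_le_n|exact: rank_mulr|lia].
  by apply: (xentry_R_mono fc) e2; [exact: rank_le_n|exact: rank_mulr|lia].
- exact: xcg_left_N e1 H P piN.
- have s1 := @low_shift k i gamma alpha; have s2 := @low_shift k i gamma beta.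
  move: s1 s2; rewrite -h r1 r2 => /(_ isT) s1 /(_ isT) s2.
  have r1' := rank_mulr gamma alpha; have r2' := rank_mulr gamma beta.
  have l1 : rank alpha <= 1 by rewrite r1. have l2 : rank beta <= 1 by rewrite r2.
  have hm := hat_mul gamma l1 l2 h.
  rewrite r1 in r1'; rewrite r2 in r2'.
  apply: (@xcg_left_mu (k + phi gamma (hat alpha)) _ _ i) => //; try lia.
    by case: g => -[->].
  move=> c0 r3 r4; constructor 3; split=> //; case: g => -[em g]; [left|right]; split=> //.
    apply/greenLP; case/greenLP: g => g1 g2; split.
      by move=> x y; rewrite !dn_mul_le1.
    have cE a : rank a <= 1 -> rank (pmul gamma a) = 1 -> cod (pmul gamma a) = cod a.
      move=> ra1 rpa; apply/eqP; rewrite eqEsubset cod_mul; apply/subsetP => y ya.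
      have : 0 < rank (dual (pmul gamma a)) by rewrite rank_dual rpa.
      case/rank_gt0P => y'; rewrite dom_dual => y'c.
      have yy : dn a y' y by apply: rank_le1_cod ra1 _ ya; exact: (subsetP (cod_mul gamma a)).
      by rewrite -(dn_cod (dn_mul_sub gamma yy)).
    by rewrite !cE.
  case/greenRP: g => g1 g2; apply/greenRP; split; [exact: up_mulR|exact: dom_mulR].
- case: (posnP (rank alpha)) => ra0; case: (posnP (rank beta)) => rb0.
  + rewrite -(hat_id ra0) -(hat_id rb0) h; rewrite ra0 rb0 in e3.
    by have -> : i = j by [lia]; constructor 1; left.
  + have {}rb : rank beta = 1 by lia.
    rewrite ra0 rb in e1 e2 e3; apply: xcg_sym; apply: xcg_left_link => //; lia.
  + have {}ra : rank alpha = 1 by lia.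
    by rewrite ra rb0 in e1 e2 e3; apply: xcg_left_link.
  + have {}ra : rank alpha = 1 by lia.
    have {}rb : rank beta = 1 by lia.
    rewrite ra rb in e1 e2 e3.
    have ij : i = j by lia.
    subst j; have s1 := @low_shift k i gamma alpha; have s2 := @low_shift k i gamma beta.
    move: s1 s2; rewrite -h ra rb => /(_ isT) s1 /(_ isT) s2.
    have r1' := rank_mulr gamma alpha; have r2' := rank_mulr gamma beta.
    have hm := hat_mul gamma r1 r2 h.
    rewrite ra in r1'; rewrite rb in r2'.
    apply: (@xcg_left_mu (k + phi gamma (hat alpha)) _ _ i) => //; try lia.
      by rewrite e1.
    by move=> _ r3 r4; apply: xcg_Mu1.
Qed.

End Cong.

Section Dual.
Variables n d : nat.
Implicit Types (M : 'M[symbol]_(n.+1, d.+1)) (alpha beta gamma : partn n).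

Definition swap_symbol s := match s with MuUp => MuDown | MuDown => MuUp | s => s end.
Definition dualM M := map_mx swap_symbol M.

Lemma entry_dual M q i : entry (dualM M) q i = swap_symbol (entry M q i).
Proof. by rewrite /entry mxE. Qed.
Lemma xentry_dual M q i : xentry (dualM M) q i = swap_symbol (xentry M q i).
Proof. by rewrite /xentry entry_dual; case: ifP. Qed.

Lemma is_zeta_swap z : is_zeta z -> is_zeta (swap_symbol z).
Proof. by case=> ->; [constructor 1|constructor 3|constructor 2|constructor 4]. Qed.

Lemma swap_R s : swap_symbol s = RR -> s = RR. Proof. by case: s. Qed.

Lemma min_row_dual M q : min_row (dualM M) q = min_row M q.
Proof. by apply: eq_find => i; rewrite entry_dual; case: entry. Qed.

Lemma fC_dual M : fC_matrix M -> fC_matrix (dualM M).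
Proof.
case=> h1 h2 h3 h4; split.
- case: h1.
  + case=> k kd h; constructor 1; exists k => // j jd; rewrite !entry_dual.
    by case: (h j jd) => -> ->; case: ifP.
  + case=> i [k [z [ik kd zz h]]]; constructor 2; exists i, k, (swap_symbol z); split=> //.
      exact: is_zeta_swap.
    move=> j jd; rewrite !entry_dual; case: (h j jd) => -> ->.
    by rewrite !(fun_if swap_symbol).
  + case=> i [k [z [ik kd zz h]]]; constructor 3; exists i, k, (swap_symbol z); split=> //.
      exact: is_zeta_swap.
    move=> j jd; rewrite !entry_dual; case: (h j jd) => -> ->.
    by rewrite !(fun_if swap_symbol).
  + case=> k [l [k0 kl ld h]]; constructor 4; exists k, l; split=> // j jd.
    rewrite !entry_dual; case: (h j jd) => -> ->.
    by rewrite !(fun_if swap_symbol).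
- move=> q qn; case: (h2 q qn) => i [k [N [g1 g2 g3 g4]]]; exists i, k, N; split=> // j jd.
  by rewrite entry_dual g4 // !(fun_if swap_symbol).
- move=> q i qn id; rewrite !entry_dual => Ns.
  have Ns' : is_N (entry M q.+1 i) by move: Ns; case: entry.
  move=> C; apply: (h3 q i qn id Ns'); move: C.
  case: (entry M q i) => [|||||q' N'] /= C.
  + by constructor 1.
  + by constructor 2.
  + by constructor 3.
  + by case: C.
  + by case: C.
  + by constructor 4.
- by move=> q i qn id; rewrite !entry_dual => /swap_R /(h4 q i qn id) ->.
Qed.

Lemma greenR_dual alpha beta : greenR (dual alpha) (dual beta) = greenL alpha beta.
Proof. by rewrite greenL_dual. Qed.
Lemma greenL_dual' alpha beta : greenL (dual alpha) (dual beta) = greenR alpha beta.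
Proof. by rewrite greenL_dual !dualK. Qed.

Lemma perm_diff_dual q alpha beta (pi : 'S_q) :
  perm_diff alpha beta pi -> perm_diff (dual alpha) (dual beta) (pi^-1)%g.
Proof.
move/perm_diffP => [a [b [L1 L2]]]; apply/perm_diffP; exists b, a; split.
  exact: tlab_dual.
apply: tlab_ext (tlab_act (pi^-1)%g (tlab_dual L2)) => // x.
by rewrite pactM mulgV pact1.
Qed.

Lemma xcg_dual M i alpha j beta : xcg M i alpha j beta ->
  xcg (dualM M) i (dual alpha) j (dual beta).
Proof.
have gh : hat alpha = hat beta -> hat (dual alpha) = hat (dual beta).
  by rewrite !hat_dual => ->.
rewrite /xcg !xentry_dual !min_row_dual.
case=> [[[-> ->]|[e1 e2]]|[N [q1 e1] [<- H [pi P piN]]]|[r1 r2 <- h g]|[e1 e2 [r1 r2] h e3]].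
- by constructor 1; left.
- by constructor 1; right; rewrite !rank_dual e1 e2.
- constructor 2; rewrite rank_dual; exists N; first by rewrite e1.
  split=> //; first by rewrite /greenH greenR_dual greenL_dual' andbC.
  by exists (pi^-1)%g; [exact: perm_diff_dual|rewrite groupV].
- constructor 3; rewrite !rank_dual; split=> //; first exact: gh.
  case: g => -[-> g]; first by right; rewrite greenR_dual.
  by left; rewrite greenL_dual'.
- by constructor 4; rewrite !rank_dual e1 e2; split=> //; apply: gh.
Qed.

Lemma dualMK M : dualM (dualM M) = M.
Proof. by apply/matrixP => i j; rewrite !mxE; case: (M i j). Qed.

(** Right multiplication is left multiplication for the dual matrix. *)
Theorem cg_congruence M : fC_matrix M -> congruence (@tmul n d) (cg M).
Proof.
move=> fc; have fcd := fC_dual fc; split.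
- split.
  + by move=> x; have [i [a ->]] := eltP x; apply/(cg_elt fc); constructor 1; left.
  + move=> x y; have [i [a ->]] := eltP x; have [j [b ->]] := eltP y.
    by move/(cg_elt fc)/xcg_sym/(cg_elt fc).
  + move=> x y z; have [i [a ->]] := eltP x; have [j [b ->]] := eltP y; have [k [c ->]] := eltP z.
    by move=> /(cg_elt fc) h1 /(cg_elt fc) h2; apply/(cg_elt fc); apply: xcg_trans h2.
- move=> x y z; have [i [a ->]] := eltP x; have [j [b ->]] := eltP y; have [k [c ->]] := eltP z.
  by move/(cg_elt fc) => h; rewrite !tmul_elt; apply/(cg_elt fc)/xcg_left.
- move=> x y z; have [i [a ->]] := eltP x; have [j [b ->]] := eltP y; have [k [c ->]] := eltP z.
  move/(cg_elt fc) => h; rewrite !tmul_elt; apply/(cg_elt fc).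
  have := xcg_dual (xcg_left fcd k (dual c) (xcg_dual h)).
  by rewrite dualMK !dual_mul !dualK !Phi_dual !(addnC k).
Qed.
End Dual.

(** * Coarse products, and the ideal class of a congruence *)

Section Tools.
Variable n : nat.
Implicit Types (alpha beta gamma : partn n) (x y z : 'I_n) (u v : vertex n).

Lemma phi0_cod gamma alpha : (forall z, z \in cod gamma) -> phi gamma alpha = 0.
Proof.
move=> h; apply: Phi0_in => z; left; case/codP: (h z) => x xz; exists x.
exact: mid_left.
Qed.
Lemma phi0_dom gamma alpha : (forall z, z \in dom alpha) -> phi gamma alpha = 0.
Proof. by move=> h; rewrite -Phi_dual; apply: phi0_cod => z; rewrite cod_dual. Qed.

Lemma rank_ge (T : finType) (f : 'I_n -> T) (D : {set 'I_n}) alpha :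
  D \subset dom alpha -> (forall x y, up alpha x y -> f x = f y) -> #|f @: D| <= rank alpha.
Proof.
move=> Dd h; apply: leq_trans (subset_leq_card (imsetS f Dd)) _.
rewrite rank_dom; apply: leq_imset_fun => x y _ _ /eqP.
by rewrite -same_blockE => /h.
Qed.

Lemma rank_le (T : finType) (f : 'I_n -> T) alpha :
  (forall x y, f x = f y -> up alpha x y) -> rank alpha <= #|T|.
Proof.
move=> h; apply: leq_trans (max_card (mem (f @: dom alpha))).
rewrite rank_dom; apply: leq_imset_fun => x y _ _ /h.
by rewrite /up same_blockE => /eqP.
Qed.

Lemma rank_lab2 q (c a : 'I_n -> 'I_q) : rank (lab2 c a) <= q.
Proof.
rewrite -[X in _ <= X]card_ord; apply: (rank_le (f := c)) => x y e.
by rewrite up_lab2 e.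
Qed.

(** The partition with one block, and its hat [omega0]: representatives of the
    ranks 1 and 0. Multiplication by [omega] on both sides takes every partition
    to one of them ([omega_sand]) and lets nothing float, so that relations
    between arbitrary elements become relations between these ([s_omegar]). *)
Definition omega : partn n := lab2 (fun _ => tt) (fun _ => tt).
Definition omega0 : partn n := hat omega.
Definition omegar (q : nat) := if 0 < q then omega else omega0.

Lemma up_omega x y : up omega x y. Proof. by rewrite up_lab2. Qed.
Lemma dn_omega x y : dn omega x y. Proof. by rewrite dn_lab2. Qed.
Lemma tr_omega x y : tr omega x y. Proof. by rewrite tr_lab2. Qed.
Lemma up_omega0 x y : up omega0 x y. Proof. by rewrite up_hat up_omega. Qed.
Lemma dn_omega0 x y : dn omega0 x y. Proof. by rewrite dn_hat dn_omega. Qed.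
Lemma tr_omega0 x y : tr omega0 x y = false. Proof. by rewrite tr_hat. Qed.
Lemma dom_omega z : z \in dom omega. Proof. exact: tr_dom (tr_omega z z). Qed.
Lemma cod_omega z : z \in cod omega. Proof. exact: tr_cod (tr_omega z z). Qed.
Lemma dual_omega : dual omega = omega.
Proof. by apply: partn_ext3 => x y;
  rewrite ?up_dual ?dn_dual ?tr_dual ?up_lab2 ?dn_lab2 ?tr_lab2. Qed.
Lemma dual_omega0 : dual omega0 = omega0. Proof. by rewrite -hat_dual dual_omega. Qed.

Lemma rank_total alpha : (forall x y, up alpha x y) -> rank alpha = (dom alpha != set0).
Proof.
move=> h; case: (posnP (rank alpha)) => r0.
  by rewrite r0; move/eqP: r0; rewrite rank0 => ->.
have -> : dom alpha != set0 by rewrite -rank0 -lt0n.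
apply/eqP; rewrite eqn_leq r0 andbT.
by have := @rank_le unit (fun _ => tt) alpha; rewrite card_unit; apply.
Qed.

Lemma rank_omega (x0 : 'I_n) : rank omega = 1.
Proof.
rewrite rank_total; last exact: up_omega.
by have -> : dom omega != set0 by apply/set0Pn; exists x0; exact: dom_omega.
Qed.
Lemma rank_omega0 : rank omega0 = 0. Proof. exact: rank_hat. Qed.
Lemma rank_omegar (x0 : 'I_n) q : rank (omegar q) = (0 < q).
Proof. by rewrite /omegar; case: ifP => _; rewrite ?rank_omega ?rank_omega0. Qed.

Lemma cod_omega_mul alpha : cod (pmul omega alpha) = cod alpha.
Proof.
apply/eqP; rewrite eqEsubset cod_mul; apply/subsetP => y /codP[x xy]; apply/codP; exists x.
apply/tr_mulP; exists x => //; apply: mid_left; exact: tr_omega.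
Qed.

Lemma omega_sand alpha : pmul omega (pmul alpha omega) = omegar (rank alpha).
Proof.
have c1 x y : up (pmul alpha omega) x y -> dn omega x y by rewrite dn_omega.
have c2 x y : dn alpha x y -> up omega x y by rewrite up_omega.
have e : tr (pmul omega (pmul alpha omega)) =2 fun _ _ => 0 < rank alpha.
  move=> x y; apply/(trCP c1)/rank_gt0P => [[z _ /(trDP c2)[w zw _]]|[z]].
    by exists z; apply: tr_dom zw.
  case/domP => w zw; exists z; first exact: tr_omega.
  by apply/(trDP c2); exists w; rewrite ?tr_omega.
apply: partn_ext3 => x y.
- by rewrite upC // up_omega /omegar; case: ifP; rewrite ?up_omega ?up_omega0.
- have -> : dn (pmul omega (pmul alpha omega)) x y by apply: dn_mul_sub; rewrite dnD // dn_omega.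
  by rewrite /omegar; case: ifP; rewrite ?dn_omega ?dn_omega0.
- by rewrite e /omegar; case: ifP; rewrite ?tr_omega ?tr_omega0.
Qed.

Definition idpart : partn n := lab2 id id.
Lemma mul1p alpha : pmul idpart alpha = alpha.
Proof.
have c x y : dn idpart x y -> up alpha x y by rewrite dn_lab2 => /eqP ->; exact: up_refl.
apply: partn_ext3 => x y.
- apply/(upDP c)/idP => [[|[z [z' []]]]|h].
  + by rewrite up_lab2 => /eqP ->; exact: up_refl.
  + by rewrite !tr_lab2 => /eqP -> /eqP ->.
  + by right; exists x, y; rewrite !tr_lab2 !eqxx.
- exact: dnD.
- apply/(trDP c)/idP => [[z]|h]; first by rewrite tr_lab2 => /eqP ->.
  by exists x => //; rewrite tr_lab2.
Qed.
Lemma phi1p alpha : phi idpart alpha = 0.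
Proof. by apply: phi0_cod => z; apply: (@tr_cod _ _ z); rewrite tr_lab2. Qed.

(** The device for moving relations from one partition to another. The points
    of [alpha] are labelled by [a] above and [b] below, coarsely enough for the
    labels to be constant on blocks; the transversals then induce a relation
    [J] on labels. If [J] is a partial bijection, multiplying by [sandL] and
    [sandR] reads the labels again through [c] and [e], and the result [eta] has
    the kernels of [c] and [e], and transversals given by [J]. If all labels
    occur as values of [c] and [e], nothing floats ([phi_sandL], [phi_sandR]). *)
Section Sand.
Variables (T1 T2 U1 U2 : eqType) (a : 'I_n -> T1) (b : 'I_n -> T2).
Variables (c : 'I_n -> (T1 + U1)%type) (e : 'I_n -> (T2 + U2)%type).
Definition sandL := lab2 c (fun x => inl (a x) : (T1 + U1)%type).
Definition sandR := lab2 (fun x => inl (b x) : (T2 + U2)%type) e.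

Lemma phi_sandR alpha : (forall y, exists y', e y' = inl (b y)) -> phi alpha sandR = 0.
Proof.
move=> h; apply: phi0_dom => z; case: (h z) => y' ey; apply: (@tr_dom _ _ _ y').
by rewrite tr_lab2 ey.
Qed.
Lemma phi_sandL alpha : (forall x, exists x', c x' = inl (a x)) -> phi sandL alpha = 0.
Proof.
move=> h; apply: phi0_cod => z; case: (h z) => y' ey; apply: (@tr_cod _ _ y').
by rewrite tr_lab2 ey.
Qed.

Variables (alpha : partn n) (J : T1 -> T2 -> bool).
Hypothesis ha : forall x x', up alpha x x' -> a x = a x'.
Hypothesis hb : forall y y', dn alpha y y' -> b y = b y'.
Hypothesis J1 : forall x y, tr alpha x y -> J (a x) (b y).
Hypothesis J2 : forall s t, J s t -> exists x y, [/\ tr alpha x y, a x = s & b y = t].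
Hypothesis Ji : forall s t t', J s t -> J s t' -> t = t'.
Hypothesis Jj : forall s s' t, J s t -> J s' t -> s = s'.
Variable eta : partn n.
Hypothesis eu : forall x x', up eta x x' = (c x == c x').
Hypothesis el : forall y y', dn eta y y' = (e y == e y').
Hypothesis et : forall x y, tr eta x y =
  match c x, e y with inl s, inl t => J s t | _, _ => false end.

Lemma sand : pmul sandL (pmul alpha sandR) = eta.
Proof.
have c2 x y : dn alpha x y -> up sandR x y by move=> /hb; rewrite up_lab2 => ->.
have trR x y : tr (pmul alpha sandR) x y -> exists2 w, tr alpha x w & e y = inl (b w).
  by case/(trDP c2) => w h; rewrite tr_lab2 => /eqP <-; exists w.
have c1 x y : up (pmul alpha sandR) x y -> dn sandL x y.
  rewrite dn_lab2 => /(upDP c2)[/ha -> //|[z [z' [h1 h2]]]].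
  rewrite up_lab2 => /eqP[bz]; have := J1 h1; have := J1 h2; rewrite bz => h3 h4.
  by rewrite (Jj h4 h3).
apply: partn_ext3 => x y.
- by rewrite upC // up_lab2 eu.
- rewrite el; apply/(dnCP c1)/idP => [[|[z [z' [/trR[w zw ->] /trR[w' zw' ->]]]]]|h].
  + by rewrite dnD // dn_lab2.
  + rewrite dn_lab2 => /eqP[az]; have := J1 zw; have := J1 zw'; rewrite az => h3 h4.
    by rewrite (Ji h3 h4).
  + by left; rewrite dnD // dn_lab2.
- rewrite et; apply/(trCP c1)/idP => [[z]|].
    by rewrite tr_lab2 => /eqP -> /trR[w zw ->]; exact: J1.
  case ec: (c x) => [s|//]; case ee: (e y) => [t|//] /J2[z [w [zw az bw]]].
  exists z; first by rewrite tr_lab2 ec az.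
  by apply/(trDP c2); exists w => //; rewrite tr_lab2 ee bw.
Qed.
End Sand.

(** The upper kernel of [alpha], with the numbers of the transversals as
    labels: the outer labelling of a sandwich that produces [alpha]. *)
Definition clab q alpha (a : 'I_n -> option 'I_q) x : 'I_q + {set vertex n} :=
  if a x is Some k then inl k else inr (pblock (blocks alpha) (inl x)).
Definition dlab q alpha (b : 'I_n -> option 'I_q) := clab (dual alpha) b.

Section Clab.
Variables (q : nat) (alpha : partn n) (a b : 'I_n -> option 'I_q).
Hypothesis L : tlab alpha a b.

Lemma clab_up x x' : up alpha x x' = (clab alpha a x == clab alpha a x').
Proof.
rewrite /clab; case e: (a x) => [k|].
  rewrite (tlab_up L _ e); case: (a x') => [l|] //=.
  by rewrite (inj_eq (@Some_inj _)) (inj_eq (@inl_inj _ _)) eq_sym.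
case e': (a x') => [l|]; last by rewrite (inj_eq (@inr_inj _ _)) -same_blockE.
by rewrite up_sym (tlab_up L _ e') e.
Qed.

Lemma clab_hit k : exists x, clab alpha a x = inl k.
Proof. by case: L => _ /(_ k)[x e] _; exists x; rewrite /clab e. Qed.

Lemma odflt_up t x x' : up alpha x x' -> odflt t (a x) = odflt t (a x').
Proof.
move=> u; case e: (a x) => [k|].
  by move: u; rewrite (tlab_up L _ e) => /eqP ->.
case e': (a x') => [k|//]; by move: u; rewrite up_sym (tlab_up L _ e') e.
Qed.

Lemma odflt_im t : (fun x => odflt t (a x)) @: dom alpha = [set: 'I_q].
Proof.
apply/setP => k; rewrite inE; apply/imsetP; case: (L) => _ /(_ k)[x e] _.
by exists x; rewrite ?(tlab_dom L) e.
Qed.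

End Clab.

Section Dlab.
Variables (q : nat) (alpha : partn n) (a b : 'I_n -> option 'I_q).
Hypothesis L : tlab alpha a b.
Lemma dlab_dn y y' : dn alpha y y' = (dlab alpha b y == dlab alpha b y').
Proof. by rewrite -up_dual (clab_up (tlab_dual L)). Qed.
Lemma dlab_hit k : exists y, dlab alpha b y = inl k.
Proof. exact: clab_hit (tlab_dual L) k. Qed.
Lemma odflt_dn t y y' : dn alpha y y' -> odflt t (b y) = odflt t (b y').
Proof. by rewrite -up_dual; apply: odflt_up (tlab_dual L) _ _ _. Qed.
Lemma clab_tr x y : tr alpha x y =
  match clab alpha a x, dlab alpha b y with inl k, inl l => k == l | _, _ => false end.
Proof.
case: L => -> _ _; rewrite /dlab /clab.
by case: (a x) (b y) => [k|] [l|] //=; rewrite andbT (inj_eq (@Some_inj _)).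
Qed.
Lemma clab_pact pi beta x y : tlab beta (pact pi a) b -> tr beta x y =
  match clab alpha a x, dlab alpha b y with inl k, inl l => pi k == l | _, _ => false end.
Proof.
case=> -> _ _; rewrite /dlab /clab /pact.
by case: (a x) (b y) => [k|] [l|] //=; rewrite andbT (inj_eq (@Some_inj _)).
Qed.
End Dlab.

(** The analogue of [clab] for rank at most 1, where the domain is one class. *)
Definition dom_lab alpha x : unit + {set vertex n} :=
  if x \in dom alpha then inl tt else inr (pblock (blocks alpha) (inl x)).
Definition cod_lab alpha := dom_lab (dual alpha).

Lemma dom_labE alpha x x' : rank alpha <= 1 ->
  up alpha x x' = (dom_lab alpha x == dom_lab alpha x').
Proof.
move=> r; rewrite /dom_lab; case xa1: (x \in dom alpha); case xa2: (x' \in dom alpha).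
- by rewrite eqxx; apply: rank_le1.
- by apply/negP => /up_dom; rewrite xa1 xa2.
- by apply/negP => /up_dom; rewrite xa1 xa2.
- by rewrite (inj_eq (@inr_inj _ _)) -same_blockE.
Qed.
Lemma cod_labE alpha y y' : rank alpha <= 1 ->
  dn alpha y y' = (cod_lab alpha y == cod_lab alpha y').
Proof. by rewrite -rank_dual -up_dual; apply: dom_labE. Qed.

(** Points beyond [q] get the label 0, the default value of [inord]. *)
Definition std_lab q (x : 'I_n) : 'I_q.+1 := inord x.
Lemma std_lab_surj q (k : 'I_q.+1) : q.+1 <= n -> exists x, std_lab q x = k.
Proof.
move=> qn; have kn : k < n by apply: leq_trans qn.
by exists (Ordinal kn); rewrite /std_lab /= inord_val.
Qed.
Definition epart q := lab2 (std_lab q) (std_lab q).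
Lemma tlab_epart q : q.+1 <= n ->
  tlab (epart q) (fun x => Some (std_lab q x)) (fun x => Some (std_lab q x)).
Proof.
move=> qn; split=> [x y|k|k]; first by rewrite tr_lab2 andbT.
  by case: (std_lab_surj k qn) => x <-; exists x.
by case: (std_lab_surj k qn) => x <-; exists x.
Qed.
Lemma rank_epart q : q.+1 <= n -> rank (epart q) = q.+1.
Proof. by move/tlab_epart/tlab_rank. Qed.

Lemma rank_exists q : q <= n -> exists alpha, rank alpha = q.
Proof.
case: q => [|q] qn; first by exists omega0; exact: rank_omega0.
by exists (epart q); exact: rank_epart.
Qed.

End Tools.

Definition zero_class n d (sigma : twisted n d -> twisted n d -> Prop) i (alpha : partn n) :=
  sigma (elt d i alpha) None.

Section Cong.
Variables n d : nat.
Variable x0 : 'I_n.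
Implicit Types (alpha beta gamma : partn n) (x y z : 'I_n).
Variable sigma : twisted n d -> twisted n d -> Prop.
Hypothesis cong : congruence (@tmul n d) sigma.

Notation s i a j b := (sigma (elt d i a) (elt d j b)).
Notation in_zero := (zero_class sigma).

Lemma sig_refl X : sigma X X. Proof. by case: cong => -[r _ _] _ _; apply: r. Qed.
Lemma sig_sym X Y : sigma X Y -> sigma Y X. Proof. by case: cong => -[_ r _] _ _; apply: r. Qed.
Lemma sig_trans Y X Z : sigma X Y -> sigma Y Z -> sigma X Z.
Proof. by case: cong => -[_ _ r] _ _; apply: r. Qed.
Lemma sigL Z X Y : sigma X Y -> sigma (tmul Z X) (tmul Z Y).
Proof. by case: cong => _ h _; apply: h. Qed.
Lemma sigR Z X Y : sigma X Y -> sigma (tmul X Z) (tmul Y Z).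
Proof. by case: cong => _ _ h; apply: h. Qed.

Lemma tmul0r (X : twisted n d) : tmul X None = None.
Proof. by case: X => [[i a]|]. Qed.

Lemma sL gamma i alpha j beta : s i alpha j beta ->
  s (i + phi gamma alpha) (pmul gamma alpha) (j + phi gamma beta) (pmul gamma beta).
Proof. by move/(sigL (elt d 0 gamma)); rewrite !tmul_elt. Qed.
Lemma sR gamma i alpha j beta : s i alpha j beta ->
  s (i + phi alpha gamma) (pmul alpha gamma) (j + phi beta gamma) (pmul beta gamma).
Proof. by move/(sigR (elt d 0 gamma)); rewrite !tmul_elt !addn0. Qed.
Lemma sshift k i alpha j beta : s i alpha j beta -> s (i + k) alpha (j + k) beta.
Proof.
by move/(sigL (elt d k (idpart n))); rewrite !tmul_elt !mul1p !phi1p !addn0 !(addnC k).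
Qed.
Lemma in_zero_L gamma i alpha : in_zero i alpha -> in_zero (i + phi gamma alpha) (pmul gamma alpha).
Proof. by move/(sigL (elt d 0 gamma)); rewrite tmul_elt tmul0r. Qed.
Lemma in_zero_R gamma i alpha : in_zero i alpha -> in_zero (i + phi alpha gamma) (pmul alpha gamma).
Proof. by move/(sigR (elt d 0 gamma)); rewrite tmul_elt addn0. Qed.
Lemma in_zero_shift i j alpha : i <= j -> in_zero i alpha -> in_zero j alpha.
Proof.
move=> ij /(sigL (elt d (j - i) (idpart n))); rewrite tmul_elt tmul0r mul1p phi1p addn0.
by rewrite subnK.
Qed.
Lemma s_in_zero i alpha j beta : s i alpha j beta -> in_zero j beta -> in_zero i alpha.
Proof. exact: sig_trans. Qed.
Lemma s_in_zero' i alpha j beta : s i alpha j beta -> in_zero i alpha -> in_zero j beta.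
Proof. by move/sig_sym; apply: s_in_zero. Qed.
Lemma in_zero_big i alpha : d < i -> in_zero i alpha.
Proof. by move=> di; rewrite /zero_class elt_big //; apply: sig_refl. Qed.

(** Shifting such a relation again and again relates the element to its copies
    at levels without bound. *)
Lemma s_iter i j alpha : i < j -> s i alpha j alpha -> in_zero i alpha.
Proof.
move=> ij h; have [p pE p0] : exists2 p, j = i + p & 0 < p by exists (j - i); lia.
have key m : s i alpha (i + m * p) alpha.
  elim: m => [|m IH]; first by rewrite mul0n addn0; exact: sig_refl.
  apply: sig_trans h _; have := sshift p IH.
  by rewrite pE -addnA -mulSnr.
have := key d.+1; rewrite (@elt_big n d (i + _)) //.
by apply: leq_trans (leq_addl _ _); rewrite leq_pmulr.
Qed.

Lemma s_omegar i alpha j beta : s i alpha j beta ->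
  s i (omegar n (rank alpha)) j (omegar n (rank beta)).
Proof.
move/(sR (omega n))/(sL (omega n)); rewrite !omega_sand.
by rewrite !(phi0_dom _ (@dom_omega n)) !(phi0_cod _ (@cod_omega n)) !addn0.
Qed.

Section SandS.
Variables (T1 T2 U1 U2 : eqType) (a : 'I_n -> T1) (b : 'I_n -> T2).
Variables (c : 'I_n -> (T1 + U1)%type) (e : 'I_n -> (T2 + U2)%type).
Hypothesis hc : forall x, exists x', c x' = inl (a x).
Hypothesis he : forall y, exists y', e y' = inl (b y).
Lemma s_sand i alpha j beta : s i alpha j beta ->
  s i (pmul (sandL a c) (pmul alpha (sandR b e))) j (pmul (sandL a c) (pmul beta (sandR b e))).
Proof.
by move/(sR (sandR b e))/(sL (sandL a c)); rewrite !(phi_sandR _ he) !(phi_sandL _ hc) !addn0.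
Qed.
Lemma in_zero_sand i alpha : in_zero i alpha ->
  in_zero i (pmul (sandL a c) (pmul alpha (sandR b e))).
Proof.
by move/(in_zero_R (sandR b e))/(in_zero_L (sandL a c));
  rewrite !(phi_sandR _ he) !(phi_sandL _ hc) !addn0.
Qed.
End SandS.

(** The class of zero is an ideal, and a sandwich that merges transversals
    takes [alpha] to any [beta] of no larger rank. Hence for each rank the class
    is described by a threshold level. *)
Lemma in_zero_reach i alpha j beta : in_zero i alpha -> rank beta <= rank alpha -> i <= j ->
  in_zero j beta.
Proof.
move=> I0 + ij; have {I0 ij i}I : in_zero j alpha by apply: in_zero_shift I0.
case rb: (rank beta) => [|r] ra; last first.
  case rq: (rank alpha) ra => [//|q] ra.
  have [a [b La]] := tlab_exists rq.
  have [a' [b' Lb]] := tlab_exists rb.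
  (* Numbers above r, and points off the transversals, are merged with number 0. *)
  pose l (o : option 'I_q.+1) : 'I_r.+1 := inord (odflt ord0 o).
  have := in_zero_sand (a := l \o a) (b := l \o b) (fun x => clab_hit Lb _) (fun x =>
    dlab_hit Lb _) I.
  rewrite (@sand _ _ _ _ _ _ _ _ _ alpha (fun s t => s == t) _ _ _ _ _ _ beta) //.
  - by move=> x x' u; rewrite /l /= (odflt_up La ord0 u).
  - by move=> x x' u; rewrite /l /= (odflt_dn La ord0 u).
  - by move=> x y; case: La => -> _ _ /andP[/eqP /= -> _].
  - move=> k l' /eqP <-; have kr : k < q.+1 by apply: leq_trans ra.
    case: (La) => h1 /(_ (Ordinal kr))[x ex] /(_ (Ordinal kr))[y ey].
    by exists x, y; rewrite h1 /l /= ex ey eqxx /= inord_val.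
  - by move=> p p' t /eqP -> /eqP.
  - by move=> p p' t /eqP -> /eqP ->.
  - by move=> x x'; exact: clab_up Lb _ _.
  - by move=> x x'; exact: dlab_dn Lb _ _.
  - by move=> x y; exact: clab_tr Lb _ _.
(* For rank 0, remove the transversals first; one of them keeps the middle block of
   omega0 attached. *)
have {I ra}I : exists2 alpha', rank alpha' = 0 & in_zero j alpha'.
  case: (posnP (rank alpha)) => r0; first by exists alpha.
  exists (pmul alpha (omega0 n)).
    by apply/eqP; rewrite -leqn0 -(rank_omega0 n) rank_mulr.
  have := in_zero_R (omega0 n) I; rewrite Phi0D ?addn0 //; first by move=> x y _; exact: up_omega0.
  move=> z; right; case/rank_gt0P: r0 => x /domP[y xy]; exists y;
    [exact: tr_cod xy|exact: up_omega0].
case: I => alpha' ra' I.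
pose c x : (unit + {set vertex n})%type :=
  if up beta x x0 then inl tt else inr (pblock (blocks beta) (inl x)).
pose e x : (unit + {set vertex n})%type :=
  if dn beta x x0 then inl tt else inr (pblock (blocks beta) (inr x)).
have trF a : rank a = 0 -> forall x y, tr a x y = false.
  by move=> ra x y; apply/negP => /tr_dom; move/eqP: ra; rewrite rank0 => /eqP ->; rewrite inE.
have := in_zero_sand (a := fun _ => tt) (b := fun _ => tt) (c := c) (e := e) _ _ I.
rewrite (@sand _ _ _ _ _ _ _ _ _ alpha' (fun s t => false) _ _ _ _ _ _ beta) //.
- apply=> x; exists x0; first by rewrite /c up_refl.
  by rewrite /e dn_refl.
- by move=> x y; rewrite trF.
- move=> x x'; rewrite /c; case E: (up beta x x0); case E': (up beta x' x0).
  + by rewrite eqxx; apply: up_trans E _; rewrite up_sym.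
  + by apply/negP => h; move: E'; rewrite (up_trans _ E) // up_sym.
  + by apply/negP => h; move: E; rewrite (up_trans h E').
  + by rewrite (inj_eq (@inr_inj _ _)) -same_blockE.
- move=> x x'; rewrite /e; case E: (dn beta x x0); case E': (dn beta x' x0).
  + by rewrite eqxx; apply: dn_trans E _; rewrite dn_sym.
  + by apply/negP => h; move: E'; rewrite (dn_trans _ E) // dn_sym.
  + by apply/negP => h; move: E; rewrite (dn_trans h E').
  + by rewrite (inj_eq (@inr_inj _ _)) -same_blockE.
- by move=> x y; rewrite trF //; case: (c x) => // _; case: (e y).
Qed.

End Cong.

(** * Related pairs with different kernels or levels *)

(** A congruence in the mirror image of the monoid, to which the one-sided
    results on congruences are applied a second time. *)
Definition dual_rel n d (sigma : twisted n d -> twisted n d ->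
  Prop) x y := sigma (tdual x) (tdual y).

Lemma dual_rel_cong n d (sigma : twisted n d -> twisted n d -> Prop) :
  congruence (@tmul n d) sigma -> congruence (@tmul n d) (dual_rel sigma).
Proof.
case=> -[r s t] l m; split; first split.
- by move=> x; apply: r.
- by move=> x y; apply: s.
- by move=> x y z; apply: t.
- by move=> x y z h; rewrite /dual_rel !tdual_mul; apply: m.
- by move=> x y z h; rewrite /dual_rel !tdual_mul; apply: l.
Qed.

Lemma rank_pos_cod n (alpha : partn n) : (0 < rank alpha) = (cod alpha != set0).
Proof. by rewrite -rank_dual lt0n rank0 dom_dual. Qed.

Section LowRank.
Variables n d : nat.
Variable x0 : 'I_n.
Implicit Types (alpha beta gamma : partn n) (x y z : 'I_n).
Variable sigma : twisted n d -> twisted n d -> Prop.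
Hypothesis cong : congruence (@tmul n d) sigma.
Notation s i a j b := (sigma (elt d i a) (elt d j b)).
Notation in_zero := (zero_class sigma).

Lemma s_dual_rel i alpha j beta : dual_rel sigma (elt d i alpha) (elt d j beta) = s i (dual
  alpha) j (dual beta).
Proof. by rewrite /dual_rel !tdual_elt. Qed.
Lemma in_zero_dual_rel i alpha : zero_class (dual_rel sigma) i alpha = in_zero i (dual alpha).
Proof. by rewrite /zero_class /dual_rel !tdual_elt. Qed.

Lemma in_zero_omegar i alpha : rank alpha <= 1 -> in_zero i (omegar n (rank alpha)) ->
  in_zero i alpha.
Proof.
by move=> r I; apply: (in_zero_reach x0 cong I); rewrite ?(rank_omegar x0) //;
  case: (rank alpha) r => [|[|]].
Qed.

(** After multiplication by [omega0] on the left, nothing floats over [omega],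
    but the middle block floats over [omega0]. *)
Lemma link_omega0 i j : s i (omega n) j (omega0 n) -> s i (omega0 n) j.+1 (omega0 n).
Proof.
move=> h; have /(sL cong (omega0 n)) := h.
have e1 : pmul (omega0 n) (omega n) = omega0 n.
  have c x y : up (omega n) x y -> dn (omega0 n) x y by rewrite dn_omega0.
  apply: partn_ext3 => x y; first by rewrite upC // !up_omega0.
    by rewrite dn_omega0; apply: dn_mul_sub; rewrite dn_omega.
  by rewrite tr_omega0; apply/(trCP c) => -[z]; rewrite tr_omega0.
have e2 : pmul (omega0 n) (omega0 n) = omega0 n.
  have c x y : up (omega0 n) x y -> dn (omega0 n) x y by rewrite dn_omega0.
  apply: partn_ext3 => x y; first by rewrite upC // !up_omega0.
    by rewrite dn_omega0; apply: dn_mul_sub; rewrite dn_omega0.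
  by rewrite tr_omega0; apply/(trCP c) => -[z]; rewrite tr_omega0.
have p2 : phi (omega0 n) (omega0 n) = 1.
  have c x y : up (omega0 n) x y -> dn (omega0 n) x y by rewrite dn_omega0.
  apply: (@Phi1_in _ _ _ x0) => [|z _].
    by apply/floatingP; split=> [x|w];
      rewrite ?midC ?dom_hat ?inE // -/(tr (omega0 n) x x0) tr_omega0.
  by rewrite midC //; exact: dn_omega0.
by rewrite e1 e2 p2 (phi0_dom _ (@dom_omega n)) addn0 addn1.
Qed.

Lemma omega_omega0_zero j : s j (omega n) j (omega0 n) -> in_zero j (omega n).
Proof.
move=> h; apply: (s_in_zero cong h); apply: (s_iter cong (ltnSn j)).
exact: link_omega0.
Qed.

(** Cut the block of [x] in [beta] off from above. In [alpha] the block of [x]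
    and [y] bridges the cut. In [beta] it is effective: it removes the only
    transversal, which relates [omega] to [omega0] on one level, or it makes a
    component float, which relates an element to its shift. *)
Lemma split_kernel_zero i alpha j beta x y : s i alpha j beta -> rank beta <= 1 ->
  up alpha x y -> ~~ up beta x y -> in_zero j beta.
Proof.
move=> h r1 xya xyb.
(* Below, th has two classes: the block of x in beta, which is cut off, and all
   other points. *)
pose th := lab2 (fun _ => false) (fun z => up beta x z).
have labx : up beta x x by exact: up_refl.
(* The point y is joined to the upper vertices, and through alpha it brings x with it. *)
have e1 : pmul th alpha = pmul (omega n) alpha.
  apply: mul_mid => // u v; rewrite [RHS]mid_left; last by rewrite same_block_Lab;
    case: u v => [u|u] [v|v].
  have key w : mid th alpha w (inr y).
    have fy : same_block th (inl x0) (inr y) by rewrite same_block_Lab (negPf xyb).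
    case: w => [w|w]; first by apply: mid_left; rewrite same_block_Lab (negPf xyb).
    case E: (up beta x w); last by apply: mid_left; rewrite same_block_Lab E (negPf xyb).
    apply: mid_trans (mid_right _ xya); apply: mid_left.
    by rewrite same_block_Lab E labx.
  by apply: mid_trans (key u) _; rewrite mid_sym.
have p1 : phi th alpha = 0.
  apply: Phi0_in => z; left; exists x0.
  have : mid (omega n) alpha (inl x0) (inr z) by apply: mid_left; exact: tr_omega.
  have fy : mid th alpha (inl x0) (inr y) by apply: mid_left; rewrite same_block_Lab (negPf xyb).
  move=> _; case E: (up beta x z); last by apply: mid_left; rewrite same_block_Lab E.
  apply: mid_trans fy _; rewrite mid_sym; apply: mid_trans (mid_right _ xya).
  by apply: mid_left; rewrite same_block_Lab E labx.
have h1 := sL cong th h; rewrite e1 p1 addn0 in h1.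
have h2 := sL cong (omega n) h; rewrite !(phi0_cod _ (@cod_omega n)) !addn0 in h2.
have {h h1 h2}h3 := sig_trans cong (sig_sym cong h2) h1.
have c x1 y1 : up beta x1 y1 -> dn th x1 y1.
  move=> u1; rewrite dn_lab2; apply/eqP; apply/idP/idP => u2; first exact: up_trans u2 u1.
  by apply: up_trans u2 _; rewrite up_sym.
have rE a : (forall p r, up a p r) -> rank a = (cod a != set0).
  by move=> t; have := rank_total t; rewrite -rank0 -lt0n rank_pos_cod.
have rom : rank (pmul (omega n) beta) = rank beta.
  rewrite rE ?cod_omega_mul -?rank_pos_cod; first by case: (rank beta) r1 => [|[|]].
  by move=> a b; rewrite up_mul; apply: mid_left; exact: up_omega.
have rth : rank (pmul th beta) = (cod (pmul th beta) != set0).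
  by apply: rE => a b; rewrite up_mul; apply: mid_left; rewrite same_block_Lab.
case xd: (x \in dom beta).
  (* The block of x carries the transversal of beta, which the cut removes. *)
  have p2 : phi th beta = 0.
    apply: Phi0C => // z; case E: (up beta x z); [right|left].
      by exists x => //; rewrite dn_lab2 E labx.
    by apply: (@tr_cod _ _ z); rewrite tr_lab2 E.
  have r0 : rank (pmul th beta) = 0.
    rewrite rth; apply/eqP; rewrite eqb0 negbK; apply/eqP/setP => t; rewrite in_set0.
    apply/negP => /codP[w /(trCP c)[z]]; rewrite tr_lab2 => /eqP E /tr_dom zd.
    by have := rank_le1 r1 xd zd; rewrite -E.
  have rb : rank beta = 1.
    apply/eqP; rewrite eqn_leq r1; apply/rank_gt0P; by exists x.
  rewrite p2 addn0 in h3; have := s_omegar cong h3; rewrite rom rb r0 => /omega_omega0_zero I.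
  by apply: in_zero_omegar => //; rewrite rb.
(* The block of x is not on a transversal of beta, and floats. *)
have p2 : phi th beta = 1.
  have fE z : z \in floating th beta = up beta x z.
    rewrite floatingC //; apply/andP/idP => [[zc _]|E].
      by apply/negPn/negP => E; move/negP: zc; apply; apply: (@tr_cod _ _ z);
        rewrite tr_lab2 (negPf E).
    split; first by apply/codP => -[w]; rewrite tr_lab2 E.
    apply/forallP => w; apply/implyP => wd; rewrite dn_lab2 E.
    by apply/negP => /eqP/esym/up_dom; rewrite xd wd.
  apply: (@Phi1_in _ _ _ x); rewrite ?fE // => w; rewrite fE => E.
  by apply: mid_left; rewrite same_block_Lab E labx.
have r2 : rank (pmul th beta) = rank beta.
  rewrite rth; have -> : cod (pmul th beta) = cod beta.
    apply/eqP; rewrite eqEsubset cod_mul; apply/subsetP => t /codP[z zt]; apply/codP; exists x0.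
    apply/(trCP c); exists z => //; rewrite tr_lab2 eq_sym; apply/eqP/negP => E.
    by move: xd; rewrite (up_dom E) (tr_dom zt).
  by rewrite -rank_pos_cod; case: (rank beta) r1 => [|[|]].
rewrite p2 addn1 in h3; have := s_omegar cong h3; rewrite rom r2 => h4.
by apply: in_zero_omegar => //; apply: s_iter h4.
Qed.

(** Replace [alpha] by the projection [epart] of the same rank, and let [be] be
    the partition that takes the place of [beta]. Since [be] absorbs the
    projection, multiplication of the related pair by [be] at level [j - i]
    reproduces the right-hand side as a left-hand side; iterating this, the
    levels on the right grow without bound. *)
Lemma level_gap_zero i alpha j beta : s i alpha j beta -> i < j -> 0 < rank alpha ->
  in_zero i alpha.
Proof.
move=> h ij; case rq: (rank alpha) => [//|q] _.
have [a [b L]] := tlab_exists rq.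
have qn : q.+1 <= n by rewrite -rq rank_le_n.
pose at_ x := odflt ord0 (a x); pose bt x := odflt ord0 (b x).
pose c x : ('I_q.+1 + unit)%type := inl (std_lab q x).
have hit (l : 'I_n -> 'I_q.+1) x : exists x', c x' = inl (l x).
  by case: (std_lab_surj (l x) qn) => x' e; exists x'; rewrite /c e.
have := s_sand cong (hit at_) (hit bt) h.
rewrite (@sand _ _ _ _ _ _ _ _ _ alpha (fun s t => s == t) _ _ _ _ _ _ (epart n q)) //; first last.
- by move=> x y; rewrite tr_lab2.
- by move=> x y; rewrite dn_lab2.
- by move=> x y; rewrite up_lab2.
- by move=> k l m /eqP -> /eqP.
- by move=> k l m /eqP -> /eqP ->.
- move=> k l /eqP <-; case: (L) => h1 /(_ k)[x ex] /(_ k)[y ey].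
  by exists x, y; split; rewrite ?h1 /at_ /bt ?ex ?ey ?eqxx.
- by move=> x y; case: L => -> _ _ /andP[/eqP e _]; rewrite /at_ /bt e.
- by move=> x x'; exact: odflt_dn L _ _ _.
- by move=> x x'; exact: odflt_up L _ _ _.
set be := pmul (sandL _ _) _ => h1.
have dbe x y : std_lab q x = std_lab q y -> dn be x y.
  by move=> e; do 2 apply: dn_mul_sub; rewrite dn_lab2 /c e.
have cc x y : up (epart n q) x y -> dn be x y by rewrite up_lab2 => /eqP /dbe.
have mbe : pmul be (epart n q) = be.
  apply: partn_ext3 => x y; first by rewrite upC.
    apply/(dnCP cc)/idP => [[|[z [z' []]]]|hh].
    + by rewrite dn_lab2 => /eqP /dbe.
    + rewrite !tr_lab2 => /eqP/dbe h2 /eqP/dbe h3 h4.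
      apply: dn_trans h3; apply: dn_trans h4; by rewrite dn_sym.
    + by right; exists x, y; rewrite !tr_lab2 !eqxx.
  apply/(trCP cc)/idP => [[z xz]|hh]; last by exists y; rewrite ?tr_lab2.
  rewrite tr_lab2 => /eqP/dbe; exact: tr_dn xz.
have pbe : phi be (epart n q) = 0.
  by apply: phi0_dom => z; apply: (@tr_dom _ _ _ z); rewrite tr_lab2.
suff I : in_zero i (epart n q) by apply: (in_zero_reach x0 cong I); rewrite // rq rank_epart.
(* Each round replaces the element on the right by one at least j - i levels higher. *)
have key m : exists k g, i + m * (j - i) <= k /\ s i (epart n q) k g.
  elim: m => [|m [k [g [km hk]]]]; first by exists i, (epart n q); rewrite mul0n addn0;
    split=> //; exact: sig_refl.
  have := sigL cong (elt d (j - i) be) hk; rewrite !tmul_elt mbe pbe addn0 subnK; last exact: ltnW.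
  move=> h2; exists (j - i + k + phi be g), (pmul be g); split; last exact: (sig_trans cong h1 h2).
  by rewrite mulSn; move: (m * (j - i)) km => p; lia.
have [k [g [km]]] := key d.+1; rewrite (@elt_big n d k) //.
apply: leq_trans km; apply: leq_trans (leq_addl _ _); rewrite leq_pmulr //; lia.
Qed.

End LowRank.

(** * Related pairs of rank at least two are H-related on one level *)

Section Tools.
Variable n : nat.
Implicit Types (alpha beta gamma : partn n) (x y z : 'I_n).

Section Fuse.
Variables (T : finType) (l : 'I_n -> T).
Lemma cod_fuse z : z \in cod (lab2 l l).
Proof. by apply: (@tr_cod _ _ z); rewrite tr_lab2. Qed.
Lemma phi_fuse alpha : phi (lab2 l l) alpha = 0.
Proof. exact/phi0_cod/cod_fuse. Qed.
Variable alpha : partn n.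
Hypothesis c : forall x y, up alpha x y -> l x = l y.
Lemma fuseC x y : up alpha x y -> dn (lab2 l l) x y.
Proof. by move/c; rewrite dn_lab2 => ->. Qed.
Lemma rank_fuse : #|l @: dom alpha| <= rank (pmul (lab2 l l) alpha).
Proof.
apply: rank_ge => [|x y]; last by rewrite upC ?up_lab2; [move/eqP|exact: fuseC].
apply/subsetP => x /domP[y xy]; apply/domP; exists y; apply/(trCP fuseC).
by exists x; rewrite ?tr_lab2.
Qed.
End Fuse.

(** Merging the class of [k] with that of [m] costs at most one transversal;
    [rank_drop_zero] and [perm_kill] choose the two so that the other element of
    a related pair suffers more, or differently. *)
Lemma rank_merge q alpha (a b : 'I_n -> option 'I_q.+1) (k m : 'I_q.+1) : tlab alpha a b ->
  let l x := let p := odflt ord0 (a x) in if p == k then m else p in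
  (forall x y, up alpha x y -> l x = l y) /\ q <= rank (pmul (lab2 l l) alpha).
Proof.
move=> L l; have cl x y : up alpha x y -> l x = l y.
  by move=> u; rewrite /l (odflt_up L ord0 u).
split=> //; apply: leq_trans (rank_fuse cl).
have : [set: 'I_q.+1] :\ k \subset l @: dom alpha.
  apply/subsetP => p; rewrite !inE andbT => pk; case: (L) => _ /(_ p)[x e] _.
  by apply/imsetP; exists x; rewrite ?(tlab_dom L) /l e //= (negPf pk).
move/subset_leq_card; apply: leq_trans; have := cardsD1 k [set: 'I_q.+1].
rewrite inE cardsT card_ord add1n => e.
by rewrite -ltnS -e.
Qed.

Lemma perm_moves q (pi : 'S_q) : pi != 1%g -> exists k, pi k != k.
Proof.
move=> npi; apply/existsP; rewrite -negb_forall; apply: contra npi => /forallP e.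
by apply/eqP/permP => k; rewrite perm1; apply/eqP.
Qed.
End Tools.

Section HighRank.
Variables n d : nat.
Variable x0 : 'I_n.
Implicit Types (alpha beta gamma : partn n) (x y z : 'I_n).
Variable sigma : twisted n d -> twisted n d -> Prop.
Hypothesis cong : congruence (@tmul n d) sigma.
Notation s i a j b := (sigma (elt d i a) (elt d j b)).
Notation in_zero := (zero_class sigma).

Lemma split_cokernel_zero i alpha j beta x y : s i alpha j beta -> rank beta <= 1 ->
  dn alpha x y -> ~~ dn beta x y -> in_zero j beta.
Proof.
move=> h r1 h1 h2; have :=
  @split_kernel_zero n d x0 _ (dual_rel_cong cong) i (dual alpha) j (dual beta) x y.
by rewrite s_dual_rel in_zero_dual_rel !dualK !up_dual rank_dual; apply.
Qed.

(** Separate two transversals of [alpha] by the class [A] of the first one.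
    For [beta], which has at most one transversal, either this cut is bridged by
    a block, or one of its sides floats when it is cut off. *)
Lemma rank_drop_low i alpha j beta : s i alpha j beta -> 1 < rank alpha -> rank beta <= 1 ->
  in_zero i alpha.
Proof.
move=> h ra rb; suff Iom : in_zero i (omega n).
  apply: (s_in_zero cong h); apply: (in_zero_omegar x0 cong rb).
  have := s_omegar cong h; rewrite {1}/omegar (ltnW ra) => h2; exact: (s_in_zero' cong h2).
have /rank_gt1P[x1 [x2 [d1 d2 n12]]] := ra.
pose A z := up alpha x1 z.
have A1 : A x1 by exact: up_refl.
have A2 : A x2 = false by apply/negbTE.
have cA x y : up alpha x y -> A x = A y.
  by move=> u; apply/idP/idP => v; [apply: up_trans v u|apply: up_trans v _; rewrite up_sym].
case: (pickP (fun p : 'I_n * 'I_n => up beta p.1 p.2 && (A p.1 != A p.2))) => [[u v]|sat].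
  (* A block of beta bridges the cut: alpha keeps two lower classes apart that beta
     and omega join. *)
  case/andP => /= uv nA.
  have {u v uv nA}[u [v [uv Au Av]]] : exists u v, [/\ up beta u v, A u & A v = false].
    case Au: (A u) nA; case Av: (A v) => //= _; first by exists u, v.
    by exists v, u; rewrite up_sym.
  pose th := lab2 (fun _ => true) A.
  have c x y : up alpha x y -> dn th x y by move/cA; rewrite dn_lab2 => ->.
  have pa : phi th alpha = 0.
    apply: Phi0C => // z; case Az: (A z); [left|right].
      by apply: (@tr_cod _ _ z); rewrite tr_lab2 Az.
    by exists x2; rewrite ?dn_lab2 ?Az ?A2.
  have tot (w1 w2 : vertex n) : mid th beta w1 w2.
    have key w : mid th beta w (inr u).
      have su : same_block th (inl x0) (inr u) by rewrite same_block_Lab Au.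
      case: w => [w|w]; first by apply: mid_left; rewrite same_block_Lab Au.
      case Aw: (A w); first by apply: mid_left; rewrite same_block_Lab Au Aw.
      rewrite mid_sym; apply: mid_trans (mid_right _ uv) _; apply: mid_left.
      by rewrite same_block_Lab Av Aw.
    by apply: mid_trans (key w1) _; rewrite mid_sym.
  have eb : pmul th beta = pmul (omega n) beta.
    apply: mul_mid => // a b; rewrite tot; apply/esym/mid_left.
    by rewrite same_block_Lab; case: a b => [a|a] [b|b].
  have pb : phi th beta = 0 by apply: Phi0_in => z; left; exists x0.
  have h1 := sL cong th h; have h2 := sL cong (omega n) h.
  rewrite pa pb eb !addn0 in h1; rewrite !(phi0_cod _ (@cod_omega n)) !addn0 in h2.
  have {h1 h2}h3 := sig_trans cong h2 (sig_sym cong h1).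
  have /domP[y1 t1] := d1; have /domP[y2 t2] := d2.
  have rt : rank (pmul th alpha) <= 1.
    have := rank_mull th alpha; move/leq_trans; apply.
    by have := @rank_le n unit (fun _ => tt) th; rewrite card_unit; apply=> x y _; rewrite up_lab2.
  have I : in_zero i (pmul th alpha).
    apply: (split_cokernel_zero h3 rt (x := y1) (y := y2)).
      by apply/dn_mulP; right; exists x1, x2; split=> //; apply: mid_left; exact: dn_omega.
    apply/negP => /(dnCP c)[dd|[z [z' [zy zy' ]]]].
      by move/negP: n12; apply; apply: tr_up t2; apply: tr_dn t1 dd.
    rewrite dn_lab2 -(cA _ _ (tr_up t1 zy)) -(cA _ _ (tr_up t2 zy')) A1 A2 //.
  apply: (in_zero_reach x0 cong I) => //; rewrite (rank_omega x0) rank_pos_cod; apply/set0Pn;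
    exists y1.
  by apply/codP; exists x0; apply/(trCP c); exists x1 => //; rewrite tr_lab2 A1.
(* Otherwise beta respects the cut, and its transversal, if any, lies on one side;
   the other side, A z = t, is cut off and floats for beta, but not for alpha. *)
have {}sat u v : up beta u v -> A u = A v.
  by move=> uv; apply/eqP; have := sat (u, v); rewrite /= uv /= => /negbFE.
have [t tN] : exists t : bool, forall z, z \in dom beta -> A z <> t.
  case: (pickP (fun z => (z \in dom beta) && A z)) => [z /andP[zd Az]|no].
    by exists false => w wd; rewrite -(sat _ _ (rank_le1 rb zd wd)) Az.
  by exists true => z zd; have := no z; rewrite zd /= => ->.
pose th := lab2 (fun _ => ~~ t) A.
have [w1 [w2 [w1d w2d w1t w2t]]] : exists w1 w2, [/\ w1 \in dom alpha, w2 \in dom alpha,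
  A w1 = t & A w2 = ~~ t].
  by case: (t); [exists x1, x2|exists x2, x1].
have ca x y : up alpha x y -> dn th x y by move/cA; rewrite dn_lab2 => ->.
have cb x y : up beta x y -> dn th x y by move/sat; rewrite dn_lab2 => ->.
have codth z : (z \in cod th) = (A z == ~~ t).
  apply/codP/eqP => [[x]|e]; first by rewrite tr_lab2 => /eqP ->.
  by exists z; rewrite tr_lab2 e.
have pa : phi th alpha = 0.
  apply: Phi0C => // z; case Az: (A z == ~~ t); [left|right]; first by rewrite codth.
  exists w1 => //; rewrite dn_lab2 w1t; move: Az; by case: (A z) (t) => [] [].
have pb : phi th beta = 1.
  have fE z : (z \in floating th beta) = (A z == t).
    rewrite floatingC // codth; apply/andP/eqP => [[]|Az].
      by case: (A z) (t) => [] [].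
    split; first by rewrite Az; case: (t).
    apply/forallP => w; apply/implyP => wd; rewrite dn_lab2 Az.
    by apply/negP => /eqP e; case: (tN w wd).
  apply: (@Phi1_in _ _ _ w1); first by rewrite fE w1t.
  move=> w; rewrite fE => /eqP Aw; apply: mid_left; by rewrite same_block_Lab w1t Aw.
have h1 := sL cong th h; rewrite pa pb addn0 addn1 in h1.
have rta : 0 < rank (pmul th alpha).
  rewrite rank_pos_cod; have /domP[y2 t2] := w2d; apply/set0Pn; exists y2; apply/codP; exists x0.
  by apply/(trCP ca); exists w2 => //; rewrite tr_lab2 w2t.
have rtb : (0 < rank (pmul th beta)) = (0 < rank beta).
  rewrite !rank_pos_cod; congr (_ != _); apply/eqP; rewrite eqEsubset cod_mul.
  apply/subsetP => y /codP[z zy]; apply/codP; exists x0; apply/(trCP cb); exists z => //.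
  rewrite tr_lab2; have := tN z (tr_dom zy); by case: (A z) (t) => [] [].
have h2 := s_omegar cong h1; have h3 := s_omegar cong h.
rewrite /omegar rta rtb in h2; rewrite /omegar (ltnW ra) in h3.
have h4 := sig_trans cong (sig_sym cong h3) h2.
by apply: (s_in_zero cong h3); apply: (s_iter cong (ltnSn j)) h4.
Qed.

(** Right multiplication by a projection of the rank of [beta] that keeps all
    transversals of [beta] brings [alpha] into the given part of the class of
    zero, while [beta] does not lose rank. *)
Lemma in_zero_transfer i alpha j beta : s i alpha j beta ->
  0 < rank beta -> (forall zeta, rank zeta <= rank beta -> in_zero i zeta) -> in_zero i alpha.
Proof.
move=> h; case rb: (rank beta) => [//|r] _ hI.
have [a [b L]] := tlab_exists rb.
pose l y := odflt ord0 (b y); pose de := lab2 l l.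
have pd g : phi g de = 0 by apply: phi0_dom => z; apply: (@tr_dom _ _ _ z); rewrite tr_lab2.
have := sR cong de h; rewrite !pd !addn0 => h1.
have I : in_zero i (pmul alpha de).
  apply: hI; apply: leq_trans (rank_mulr _ _) _; exact: rank_lab2.
have {}I := s_in_zero' cong h1 I; apply: (s_in_zero cong h); apply: (in_zero_reach x0 cong I) => //.
have c x y : dn beta x y -> up de x y.
  by rewrite -up_dual up_lab2 => u; rewrite /l (odflt_up (tlab_dual L) ord0 u).
apply: eq_leq; apply: rank_eqR => [x y|].
  apply/idP/(upDP c) => [u|[//|[z [z' [xz yz']]]]]; first by left.
  rewrite up_lab2 /l => /eqP e; apply: (tr_up _ yz'); apply: (tr_dn xz).
  have := tr_cod xz; have := tr_cod yz'; rewrite !(tlab_cod L).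
  case ez: (b z) e => [k|//]; case ez': (b z') => [k'|//] /= ek _ _.
  by rewrite -up_dual (tlab_up (tlab_dual L) _ ez) ez' ek.
apply/setP => x; apply/domP/domP => -[y xy].
  by exists y; apply/(trDP c); exists y => //; rewrite tr_lab2.
by case/(trDP c): xy => z xz _; exists z.
Qed.

(** Induction on the rank of [beta]: merge two transversals of [beta], at the
    cost of at most one transversal of [alpha]. *)
Lemma rank_drop_zero i alpha j beta : s i alpha j beta -> 1 < rank alpha ->
  rank beta < rank alpha -> in_zero i alpha.
Proof.
move: {2}(rank beta) (leqnn (rank beta)) => r;
  elim: r i alpha j beta => [|r IH] i alpha j beta rr h ra rba.
  by apply: rank_drop_low h ra _; apply: leq_trans rr _.
case: (leqP (rank beta) 1) => rb1; first exact: rank_drop_low h ra rb1.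
have /rank_gt1P[y [z [yd zd nyz]]] := rb1.
case rq: (rank alpha) ra rba => [//|q] ra rba.
have [a [b L]] := tlab_exists rq.
(* The classes of y and z are merged, which lie on different transversals of beta. *)
have [cl r1] := rank_merge (odflt ord0 (a y)) (odflt ord0 (a z)) L.
move: cl r1; set l := (fun x => _) => cl r1.
have h1 := sL cong (lab2 l l) h; rewrite !phi_fuse !addn0 in h1.
have r2 : rank (pmul (lab2 l l) beta) < rank beta.
  apply: (rank_mul_merge yd zd nyz); apply: mid_left; rewrite same_block_Lab /l eqxx.
  by case: ifP.
have I : in_zero i (pmul (lab2 l l) alpha) by apply: (IH i _ j _ _ h1); lia.
apply: (in_zero_transfer h); first exact: ltnW.
by move=> zeta rz; apply: (in_zero_reach x0 cong I) => //; lia.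
Qed.

(** As in [split_kernel_zero] a block of [beta] is cut off, and [alpha] bridges
    the cut. The upper vertices are fused only within the transversals of
    [alpha], to keep its rank. *)
Lemma kernel_gap_zero i alpha beta x y : s i alpha i beta -> 1 < rank alpha ->
  rank beta = rank alpha ->
  up alpha x y -> ~~ up beta x y -> in_zero i alpha.
Proof.
move=> h ra rba xya xyb.
case rq: (rank alpha) ra => [//|q] ra.
have [a [b L]] := tlab_exists rq.
pose l x := odflt ord0 (a x).
have cl x1 x2 : up alpha x1 x2 -> l x1 = l x2 by move=> u; exact: (odflt_up L ord0 u).
have imq : #|l @: dom alpha| = q.+1 by rewrite (odflt_im L) cardsT card_ord.
have rga : q < rank (pmul (lab2 l l) alpha) by apply: leq_trans (rank_fuse cl); rewrite imq.
(* If a block of beta joins different labels, fusing by labels costs beta rank, but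
   not alpha. *)
case: (pickP (fun p : 'I_n * 'I_n => up beta p.1 p.2 && (l p.1 != l p.2))) => [[u v]|sat].
  case/andP => /= uv nl.
  have h1 := sL cong (lab2 l l) h; rewrite !phi_fuse !addn0 in h1.
  have r2 : rank (pmul (lab2 l l) beta) < q.+1.
    rewrite -rank_dual dual_mul; apply: leq_trans (rank_lab2 l l); rewrite -(rank_dual (lab2 l l)).
    apply: (@rank_mul_merge _ _ _ u v); rewrite ?dom_dual ?cod_fuse //.
      by rewrite up_dual dn_lab2.
    by apply: mid_left; rewrite same_block_dual.
  have I : in_zero i (pmul (lab2 l l) alpha) by apply: (rank_drop_zero h1); lia.
  by apply: (in_zero_reach x0 cong I) => //; rewrite rq.
have {}sat u v : up beta u v -> l u = l v.
  by move=> uv; apply/eqP; have := sat (u, v); rewrite /= uv /= => /negbFE.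
(* Otherwise cut off the block of x in beta, on the lower side of th. *)
pose th := lab2 (fun x => Some (l x)) (fun z => if up beta x z then None else Some (l z)).
have midth : forall u v, mid th alpha u v = mid (lab2 l l) alpha u v.
  have cc x1 x2 : up alpha x1 x2 -> dn (lab2 l l) x1 x2 by move/cl; rewrite dn_lab2 => ->.
  pose f (w : vertex n) := match w with inl x | inr x => l x end.
  move=> u v; rewrite [RHS](midC cc) same_block_Lab; apply/idP/eqP => [m|e].
    suff : f u = f v by case: u v {m} => [u|u] [v|v].
    apply: (mid_min (f := f)) m => [{}u {}v|x1 x2]; last exact: cl.
    rewrite same_block_Lab /f; case: u v => [u|u] [v|v] /=; try case: ifP => E1;
      try case: ifP => E2 //;
      try (by move=> /eqP[]).
    by move=> _; apply: sat; apply: up_trans E2; rewrite up_sym.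
  have key w : exists2 t, mid th alpha w t & exists2 p, t = inl p & l p = f w.
    case: w => [w|w]; first by exists (inl w); [exact: mid_refl|exists w].
    case E: (up beta x w).
      exists (inl y); last by exists y => //=; rewrite -(cl _ _ xya); apply: sat.
      apply: (mid_trans (v := inr x)).
        by apply: mid_left; rewrite same_block_Lab E up_refl.
      apply: (mid_trans (mid_right _ xya)); apply: mid_left.
      by rewrite same_block_Lab (negPf xyb).
    exists (inl w); last by exists w.
    by apply: mid_left; rewrite same_block_Lab E.
  have [t m1 [p ep lp]] := key u; have [t' m2 [p' ep' lp']] := key v.
  apply: mid_trans m1 _; rewrite mid_sym; apply: mid_trans m2 _; apply: mid_left.
  rewrite ep ep' same_block_Lab lp lp' /f; apply/eqP; congr Some.
  by case: u e {lp} => [u|u]; case: v {lp'} => [v|v].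
have eta : pmul th alpha = pmul (lab2 l l) alpha by apply: mul_mid.
have pa : phi th alpha = 0.
  apply: Phi0_in => z; left; exists z; rewrite midth; apply: mid_left; by rewrite same_block_Lab.
have h1 := sL cong th h; rewrite eta pa addn0 in h1.
suff I : in_zero i (pmul (lab2 l l) alpha) by apply: (in_zero_reach x0 cong I) => //; rewrite rq.
have cb x1 x2 : up beta x1 x2 -> dn th x1 x2.
  move=> u12; rewrite dn_lab2 (sat _ _ u12); case: ifP => E1; case: ifP => E2 //.
    by rewrite (up_trans E1 u12) in E2.
  by move: E1; rewrite (up_trans E2) // up_sym.
have cut t : ~~ mid th beta (inl t) (inr x) by rewrite midC // same_block_Lab up_refl.
(* In beta, the block cut off is a transversal that is lost, or a block that floats. *)
case xd: (x \in dom beta).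
  apply: (rank_drop_zero h1); first by lia.
  have := rank_mul_cut xd cut; rewrite rba rq; lia.
have fx : x \in floating th beta.
  apply/floatingP; split=> [//|w wd]; rewrite midC // same_block_Lab up_refl.
  by case: ifP => // /up_dom; rewrite xd wd.
have pb : 0 < phi th beta by rewrite lt0n Phi0; apply/set0Pn; exists x.
by apply: (level_gap_zero x0 cong h1); lia.
Qed.

(** A point off the transversals of [beta] can be fused with any of them at no
    cost for [beta]; for [alpha] it lies on a transversal, and fusing it with
    another one costs rank. *)
Lemma dom_gap_zero i alpha beta x : s i alpha i beta -> 1 < rank alpha -> rank beta = rank alpha ->
  x \in dom alpha -> x \notin dom beta -> in_zero i alpha.
Proof.
move=> h ra rba xd nxd.
have [z zd nxz] : exists2 z, z \in dom alpha & ~~ up alpha x z.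
  have /rank_gt1P[u [v [ud vd nuv]]] := ra.
  case xu: (up alpha x u); last by exists u; rewrite ?xu.
  exists v => //; apply: contra nuv; by apply: up_trans; rewrite up_sym.
case rq: (rank beta) => [|q]; first by rewrite -rba rq in ra.
have [a [b L]] := tlab_exists rq.
(* The labels number the transversals of beta; all points off them, among them x,
   get the label of z. *)
pose t0 := odflt ord0 (a z); pose l x := odflt t0 (a x).
have cl x1 x2 : up beta x1 x2 -> l x1 = l x2 by move=> u; exact: (odflt_up L t0 u).
have imq : #|l @: dom beta| = q.+1 by rewrite (odflt_im L) cardsT card_ord.
have rgb : q < rank (pmul (lab2 l l) beta) by apply: leq_trans (rank_fuse cl); rewrite imq.
have h1 := sL cong (lab2 l l) h; rewrite !phi_fuse !addn0 in h1.
have r2 : rank (pmul (lab2 l l) alpha) < rank alpha.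
  apply: (rank_mul_merge xd zd nxz); apply: mid_left; rewrite same_block_Lab /l.
  move: nxd; rewrite (tlab_dom L); case: (a x) => //= _.
  by rewrite /t0; case: (a z).
have I : in_zero i (pmul (lab2 l l) beta).
  by apply: (rank_drop_zero (sig_sym cong h1)); lia.
apply: (s_in_zero cong h); apply: (in_zero_reach x0 cong I) => //; by rewrite rq.
Qed.

Lemma related_level i alpha j beta : s i alpha j beta -> 0 < rank alpha -> 0 < rank beta ->
  ~ in_zero i alpha -> i = j.
Proof.
move=> h ra rb nI; case: (ltngtP i j) => // lt; case: nI; first exact: (level_gap_zero x0 cong h).
by apply: (s_in_zero cong h); apply: (level_gap_zero x0 cong (sig_sym cong h)).
Qed.

Lemma related_R i alpha j beta : s i alpha j beta -> 1 < rank alpha -> ~ in_zero i alpha ->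
  [/\ i = j, rank beta = rank alpha & greenR alpha beta].
Proof.
move=> h ra nI; have h' := sig_sym cong h; have nI' : ~ in_zero j beta by move/(s_in_zero cong h).
have re : rank beta = rank alpha.
  case: (ltngtP (rank beta) (rank alpha)) => // lt.
    by case: nI; apply: (rank_drop_zero h).
  by case: nI'; apply: (rank_drop_zero h'); lia.
have ij : i = j by apply: (related_level h) => //; rewrite ?re; lia.
subst j; split=> //; apply/greenRP.
have nn (P : bool) : (~~ P -> False) -> P by case: P => // /(_ isT).
split=> [x y|].
  apply/idP/idP => u; apply: nn => nu.
    apply: nI; apply: (kernel_gap_zero h) => //; [exact: u|exact: nu].
  apply: nI'; apply: (kernel_gap_zero h' _ _ u nu); rewrite ?re //.
apply/eqP; rewrite eqEsubset; apply/andP; split; apply/subsetP => x xd; apply: nn => nd.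
  by apply: nI; apply: (dom_gap_zero h _ _ xd nd).
by apply: nI'; apply: (dom_gap_zero h' _ _ xd nd); rewrite ?re.
Qed.
End HighRank.

Section HighRankH.
Variables n d : nat.
Variable x0 : 'I_n.
Implicit Types (alpha beta gamma : partn n) (x y z : 'I_n).
Variable sigma : twisted n d -> twisted n d -> Prop.
Hypothesis cong : congruence (@tmul n d) sigma.
Notation s i a j b := (sigma (elt d i a) (elt d j b)).
Notation in_zero := (zero_class sigma).

Lemma related_H i alpha j beta : s i alpha j beta -> 1 < rank alpha -> ~ in_zero i alpha ->
  [/\ i = j, rank beta = rank alpha & greenH alpha beta].
Proof.
move=> h ra nI; have [ij re gR] := related_R x0 cong h ra nI.
split=> //; rewrite /greenH gR greenL_dual.
have := @related_R n d x0 _ (dual_rel_cong cong) i (dual alpha) j (dual beta).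
by rewrite s_dual_rel in_zero_dual_rel !dualK !rank_dual => /(_ h ra nI)[].
Qed.
End HighRankH.

(** * Pairs of rank one, and the effect of a permutation *)

Section Rank1.
Variable n : nat.
Implicit Types (alpha beta gamma : partn n) (x y z : 'I_n).

Lemma tr_rank1 alpha x y : rank alpha <= 1 -> tr alpha x y = (x \in dom alpha) && (y \in cod alpha).
Proof.
move=> r; apply/idP/andP => [t|[xd /codP[z zy]]]; first by rewrite (tr_dom t) (tr_cod t).
exact: up_tr (rank_le1 r xd (tr_dom zy)) zy.
Qed.

Lemma dom_disjoint alpha beta : rank alpha <= 1 -> rank beta <= 1 -> up alpha =2 up beta ->
  dom alpha <> dom beta -> forall x, x \in dom alpha -> x \in dom beta -> False.
Proof.
move=> ra rb eu ne x xa xb; apply: ne; apply/setP => z; apply/idP/idP => zd.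
  by rewrite -(up_dom (_ : up beta x z)) // -eu; apply: rank_le1 ra xa zd.
by rewrite -(up_dom (_ : up alpha x z)) // eu; apply: rank_le1 rb xb zd.
Qed.

Lemma rank1_ext alpha beta : rank alpha <= 1 -> rank beta <= 1 -> hat alpha = hat beta ->
  dom alpha = dom beta -> cod alpha = cod beta -> alpha = beta.
Proof.
move=> ra rb /hatP[eu el] ed ec; apply: partn_ext3 => // x y.
by rewrite !tr_rank1 // ed ec.
Qed.
End Rank1.

Section Pairs.
Variables n d : nat.
Variable x0 : 'I_n.
Implicit Types (alpha beta gamma : partn n) (x y z : 'I_n).
Variable sigma : twisted n d -> twisted n d -> Prop.
Hypothesis cong : congruence (@tmul n d) sigma.
Notation s i a j b := (sigma (elt d i a) (elt d j b)).
Notation in_zero := (zero_class sigma).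

(** A sandwich depends on kernels and labels only, so the same multipliers take
    both halves of one pair to the halves of the other. *)
Lemma perm_spread q i alpha beta alpha' beta' (a b a' b' : 'I_n -> option 'I_q.+1) (pi : 'S_q.+1) :
  tlab alpha a b -> tlab beta (pact pi a) b -> greenH alpha beta ->
  tlab alpha' a' b' -> tlab beta' (pact pi a') b' -> greenH alpha' beta' ->
  s i alpha i beta -> s i alpha' i beta'.
Proof.
move=> L1 L2 /andP[/greenRP[eu ed] /greenLP[el ec]] L1' L2' /andP[/greenRP[eu' ed'] /greenLP[el'
  ec']] h.
pose l x := odflt ord0 (a x); pose m x := odflt ord0 (b x).
have := s_sand cong (a := l) (b := m) (c := clab alpha' a') (e := dlab alpha' b')
    (fun x => clab_hit L1' _) (fun x => dlab_hit L1' _) h.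
have hl x x' : up alpha x x' -> l x = l x' by move=> u; exact: (odflt_up L1 ord0 u).
have hm x x' : dn alpha x x' -> m x = m x'.
  by rewrite -up_dual => u; exact: (odflt_up (tlab_dual L1) ord0 u).
rewrite (@sand _ _ _ _ _ _ _ _ _ alpha (fun s t => s == t) _ _ _ _ _ _ alpha') //; first last.
- by move=> x y; exact: clab_tr L1' _ _.
- by move=> x x'; exact: dlab_dn L1' _ _.
- by move=> x x'; exact: clab_up L1' _ _.
- by move=> p r t /eqP -> /eqP ->.
- by move=> p r t /eqP -> /eqP.
- move=> k k' /eqP <-; case: (L1) => h1 /(_ k)[x ex] /(_ k)[y ey].
  by exists x, y; split; rewrite ?h1 /l /m ?ex ?ey ?eqxx.
- by move=> x y; case: L1 => -> _ _ /andP[/eqP e _]; rewrite /l /m e.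
rewrite (@sand _ _ _ _ _ _ _ _ _ beta (fun s t => pi s == t) _ _ _ _ _ _ beta') //; first last.
- by move=> x y; exact: (clab_pact _ _ _ L2').
- by move=> x x'; rewrite -el'; exact: dlab_dn L1' _ _.
- by move=> x x'; rewrite -eu'; exact: clab_up L1' _ _.
- by move=> p r t /eqP <- /eqP/perm_inj ->.
- by move=> p r t /eqP -> /eqP.
- move=> k k' /eqP <-; case: (L1) => h1 /(_ k)[x ex] _; case: (L1) => _ _ /(_ (pi k))[y ey].
  exists x, y; split; rewrite /l /m ?ex ?ey //.
  by case: (L2) => -> _ _; rewrite /pact ex ey /= eqxx.
- move=> x y; case: L2 => -> _ _; rewrite /pact /l /m; case: (a x) => [k|] //=;
  last by rewrite andbF.
  by rewrite andbT => /eqP <-.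
- by move=> x x'; rewrite -el; exact: hm.
- by move=> x x'; rewrite -eu; exact: hl.
Qed.

(** By [Lpair_spread] a single such pair, whatever its codomains, yields all
    pairs that [MuDown] stands for. *)
Definition Lpair i := exists alpha beta,
  [/\ rank alpha = 1, rank beta = 1, hat alpha = hat beta,
    dom alpha <> dom beta & s i alpha i beta].

(** Label the upper points by membership in the domain of [beta]: the two
    domains get different labels, which a sandwich reads as the domains of
    [alpha'] and [beta']. *)
Lemma Lpair_spread i alpha' beta' : Lpair i -> rank alpha' = 1 -> rank beta' = 1 ->
  hat alpha' = hat beta' -> cod alpha' = cod beta' -> s i alpha' i beta'.
Proof.
case=> alpha [beta [ra rb /hatP[eu el] ne h]] ra' rb' hh' ec'.
have [eu' el'] := (hatP _ _).1 hh'.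
have /rank_gt0P[xa xad] : 0 < rank alpha by rewrite ra.
have /rank_gt0P[xb xbd] : 0 < rank beta by rewrite rb.
have la : rank alpha <= 1 by rewrite ra.
have lb : rank beta <= 1 by rewrite rb.
have la' : rank alpha' <= 1 by rewrite ra'.
have lb' : rank beta' <= 1 by rewrite rb'.
case: (eqVneq (dom alpha') (dom beta')) => [ed'|/eqP ne'].
  by rewrite (rank1_ext la' lb' hh' ed' ec'); exact: sig_refl.
have dis := dom_disjoint la lb eu ne; have dis' := dom_disjoint la' lb' eu' ne'.
pose a x := x \in dom beta.
pose c x : (bool + {set vertex n})%type := if x \in dom beta' then inl true
   else if x \in dom alpha' then inl false else inr (pblock (blocks alpha') (inl x)).
have /rank_gt0P[xa' xad'] : 0 < rank alpha' by rewrite ra'.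
have /rank_gt0P[xb' xbd'] : 0 < rank beta' by rewrite rb'.
have hc x : exists x', c x' = inl (a x).
  case: (a x); first by exists xb'; rewrite /c xbd'.
  exists xa'; rewrite /c xad'; case: ifP => // xb2; by case: (dis' xa').
have he (y : 'I_n) : exists y', cod_lab alpha' y' = inl tt.
  by case/domP: xad' => y' /tr_cod y'c; exists y'; rewrite /cod_lab /dom_lab dom_dual y'c.
have ceu x x' : up alpha' x x' = (c x == c x').
  rewrite /c; case xb1: (x \in dom beta'); case xb2: (x' \in dom beta').
  - by rewrite eqxx eu'; apply: rank_le1.
  - rewrite eu'; transitivity false; last by case: ifP.
    by apply/negP => /up_dom; rewrite xb1 xb2.
  - rewrite eu'; transitivity false; last by case: ifP.
    by apply/negP => /up_dom; rewrite xb1 xb2.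
  case xa1: (x \in dom alpha'); case xa2: (x' \in dom alpha').
  - by rewrite eqxx; apply: rank_le1.
  - by apply/negP => /up_dom; rewrite xa1 xa2.
  - by apply/negP => /up_dom; rewrite xa1 xa2.
  - by rewrite (inj_eq (@inr_inj _ _)) -same_blockE.
have eel y y' : dn alpha' y y' = (cod_lab alpha' y == cod_lab alpha' y') by exact: cod_labE.
have := s_sand cong (a := a) (b := fun _ => tt) hc he h.
rewrite (@sand _ _ _ _ _ _ _ _ _ alpha (fun p t => ~~ p) _ _ _ _ _ _ alpha') //; first last.
- move=> x y; rewrite tr_rank1 // /c /cod_lab /dom_lab dom_dual.
  case xb1: (x \in dom beta').
    have -> : x \in dom alpha' = false by apply/negP => xa1; case: (dis' x).
    by case: ifP.
  by case: (x \in dom alpha'); case: (y \in cod alpha').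
- by move=> [] [].
- by move=> p [] [].
- move=> [] // [] _; case/domP: (xad) => y ay; exists xa, y; split=> //.
  by apply/negP => xb1; apply: dis xb1.
- move=> x y /tr_dom xd; apply/negP => xb1; exact: dis xd xb1.
- by move=> x x'; rewrite eu => /up_dom; rewrite /a => ->.
rewrite (@sand _ _ _ _ _ _ _ _ _ beta (fun p t => p) _ _ _ _ _ _ beta') //; first last.
- move=> x y; rewrite tr_rank1 // /c /cod_lab /dom_lab dom_dual -ec'.
  case xb1: (x \in dom beta') => /=; first by case: ifP.
  by case: (x \in dom alpha') => //; case: (y \in cod alpha').
- by move=> y y'; rewrite -el'.
- by move=> x x'; rewrite -eu'.
- by move=> [] [].
- by move=> p [] [].
- by move=> [] // [] _; case/domP: (xbd) => y ay; exists xb, y; split.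
- by move=> x y /tr_dom.
- by move=> x x' /up_dom; rewrite /a => ->.
Qed.

(** Cut the domain of [beta] off from above: over [alpha] it floats and raises
    the level, and [beta] loses its transversal. *)
Lemma Lpair_link i : Lpair i -> s i.+1 (omega n) i (omega0 n).
Proof.
case=> alpha [beta [ra rb /hatP[eu el] ne h]].
have la : rank alpha <= 1 by rewrite ra.
have lb : rank beta <= 1 by rewrite rb.
have dis := dom_disjoint la lb eu ne.
have /rank_gt0P[xa xad] : 0 < rank alpha by rewrite ra.
have /rank_gt0P[xb xbd] : 0 < rank beta by rewrite rb.
(* Below, th has the class of the domain of beta, which is cut off, and the class of
   all other points. *)
pose th := lab2 (fun _ => false) (fun z => z \in dom beta).
have cb x y : up beta x y -> dn th x y by move/up_dom; rewrite dn_lab2 => ->.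
have ca x y : up alpha x y -> dn th x y by rewrite eu; exact: cb.
have codth z : (z \in cod th) = (z \notin dom beta).
  apply/codP/idP => [[x]|e]; first by rewrite tr_lab2 eq_sym eqbF_neg.
  by exists z; rewrite tr_lab2 eq_sym eqbF_neg.
have pb : phi th beta = 0.
  apply: Phi0C => // z; case zd: (z \in dom beta); [right|left]; last by rewrite codth zd.
  by exists xb; rewrite // dn_lab2 zd xbd.
have pa : phi th alpha = 1.
  have fE z : (z \in floating th alpha) = (z \in dom beta).
    rewrite floatingC // codth negbK; apply: andb_idr => zd; apply/forallP => w; apply/implyP => wd.
    rewrite dn_lab2 zd; apply/negP => /eqP/esym; exact: dis wd.
  apply: (@Phi1_in _ _ _ xb) => [|w]; rewrite fE // => wd.
  by apply: mid_left; rewrite same_block_Lab xbd wd.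
have r1 : 0 < rank (pmul th alpha).
  rewrite rank_pos_cod; case/domP: (xad) => y ay; apply/set0Pn; exists y; apply/codP; exists xa.
  apply/(trCP ca); exists xa => //; rewrite tr_lab2 eq_sym eqbF_neg; apply/negP; exact: dis xad.
have r0 : rank (pmul th beta) = 0.
  apply/eqP; rewrite -leqn0 leqNgt rank_pos_cod negbK; apply/eqP/setP => y; rewrite in_set0.
  by apply/negP => /codP[x /(trCP cb)[z]]; rewrite tr_lab2 eq_sym eqbF_neg => /negP nz /tr_dom.
have := s_omegar cong (sL cong th h); by rewrite pa pb addn0 addn1 r0 /omegar r1.
Qed.

Lemma link_spread i j alpha : s i (omega n) j (omega0 n) -> rank alpha = 1 ->
  s i alpha j (hat alpha).
Proof.
move=> h r; have /rank_gt0P[x1 xd] : 0 < rank alpha by rewrite r.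
case/domP: (xd) => y1 xy1; have yc := tr_cod xy1.
have la : rank alpha <= 1 by rewrite r.
have hc (x : 'I_n) : exists x', dom_lab alpha x' = inl tt by exists x1; rewrite /dom_lab xd.
have he (x : 'I_n) : exists x', cod_lab alpha x' = inl tt.
  by exists y1; rewrite /cod_lab /dom_lab dom_dual yc.
have := s_sand cong (a := fun _ => tt) (b := fun _ => tt) hc he h.
rewrite (@sand _ _ _ _ _ _ _ _ _ (omega n) (fun p t => true) _ _ _ _ _ _ alpha) //; first last.
- move=> x y; rewrite tr_rank1 // /cod_lab /dom_lab dom_dual.
  by case: ifP => // _; case: ifP.
- by move=> y y'; exact: cod_labE.
- by move=> x x'; exact: dom_labE.
- by move=> [] [].
- by move=> p [] [].
- by move=> [] [] _; exists x0, x0; split=> //; exact: tr_omega.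
rewrite (@sand _ _ _ _ _ _ _ _ _ (omega0 n) (fun p t => false) _ _ _ _ _ _ (hat alpha)) //;
  first last.
- by move=> x y; rewrite tr_hat; case: (dom_lab _ _) => // _; case: (cod_lab _ _).
- by move=> x y; rewrite dn_hat; exact: cod_labE.
- by move=> x y; rewrite up_hat; exact: dom_labE.
- by move=> x y; rewrite tr_omega0.
Qed.

(** With at least three transversals, merge one that is moved with one that is
    neither it nor its image. Then the lower parts joined in the two products
    are different, which [related_H] forbids outside the class of zero. *)
Lemma perm_kill q i alpha beta (a b : 'I_n -> option 'I_q.+1) (pi : 'S_q.+1) :
  1 < q -> tlab alpha a b -> tlab beta (pact pi a) b -> greenH alpha beta -> pi != 1%g ->
  s i alpha i beta -> forall zeta, rank zeta <= q -> in_zero i zeta.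
Proof.
move=> q1 L1 L2 H npi h zeta rz.
have [k nk] := perm_moves npi.
(* A third transversal exists, since there are q + 1 > 2 of them. *)
have [k2 n2 n2'] : exists2 k2 : 'I_q.+1, k2 != k & k2 != pi k.
  have : 0 < #|~: [set k; pi k]|.
    by have := cardsC [set k; pi k]; rewrite cards2 card_ord; case: (k != pi k) => /=; lia.
  by case/card_gt0P => k2; rewrite !inE negb_or => /andP[]; exists k2.
have [cl r1] := rank_merge k2 k L1.
move: cl r1; set l := (fun x => _) => cl r1.
have [eu ed] : up alpha =2 up beta /\ dom alpha = dom beta by case/andP: H => /greenRP.
have clb x x' : up beta x x' -> l x = l x' by rewrite -eu; exact: cl.
have h1 := sL cong (lab2 l l) h; rewrite !phi_fuse !addn0 in h1.
apply: boolp.contrapT => nI.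
have nI1 : ~ in_zero i (pmul (lab2 l l) alpha).
  by move=> I; apply: nI; apply: (in_zero_reach x0 cong I) => //; apply: leq_trans r1.
have [_ _ /andP[_ /greenLP[el _]]] := related_H x0 cong h1 (leq_trans q1 r1) nI1.
case: (L1) => h1' /(_ k)[z zk] hb; have [y yk] := hb (pi k); have [y' yk'] := hb (pi k2).
case: (L1) => _ /(_ k2)[z' zk'] _.
have : dn (pmul (lab2 l l) beta) y y'.
  apply/(dnCP (fuseC clb)); right; exists z, z'; split.
  - by case: L2 => -> _ _; rewrite /pact zk yk /= eqxx.
  - by case: L2 => -> _ _; rewrite /pact zk' yk' /= eqxx.
  - by rewrite dn_lab2 /l zk zk' /= if_same !eqxx.
rewrite -el => /(dnCP (fuseC cl))[|[w [w' [wy wy']]]].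
  rewrite -up_dual (tlab_up (tlab_dual L1) _ yk) yk' (inj_eq (@Some_inj _)) (inj_eq perm_inj).
  by apply/negP.
have wk : a w = Some (pi k) by apply/eqP; rewrite -(tlab_trb L1 _ yk).
have wk' : a w' = Some (pi k2) by apply/eqP; rewrite -(tlab_trb L1 _ yk').
rewrite dn_lab2 /l wk wk' /= [pi k == k2]eq_sym (negPf n2').
case: ifP => _; first by rewrite (negPf nk).
by rewrite (inj_eq perm_inj) eq_sym (negPf n2).
Qed.

Definition Rpair i := exists alpha beta,
  [/\ rank alpha = 1, rank beta = 1, hat alpha = hat beta,
    cod alpha <> cod beta & s i alpha i beta].

(** Of the two transversals keep the one numbered [k] above. Its lower part is
    numbered [k] in one product and [pi k] in the other, while the lower kernels
    have not changed. *)
Lemma perm2_Rpair i alpha beta (a b : 'I_n -> option 'I_2) (pi : 'S_2) :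
  tlab alpha a b -> tlab beta (pact pi a) b -> greenH alpha beta -> pi != 1%g ->
  s i alpha i beta -> Rpair i.
Proof.
move=> L1 L2 H npi h.
have [k nk] := perm_moves npi.
have [[eu ed] [el ec]] : (up alpha =2 up beta /\ dom alpha = dom beta) /\ (dn alpha =2 dn beta
  /\ cod alpha = cod beta).
  by case/andP: H => /greenRP ? /greenLP.
(* Only the points with number k stay connected to the upper vertices. *)
pose A x := a x == Some k; pose th := lab2 (fun _ => true) A.
have cA x x' : up alpha x x' -> A x = A x'.
  move=> u; rewrite /A; case e: (a x) => [m|].
    by move: u; rewrite (tlab_up L1 _ e) => /eqP ->.
  case e': (a x') => [m|//]; by move: u; rewrite up_sym (tlab_up L1 _ e') e.
have ca x y : up alpha x y -> dn th x y by move/cA; rewrite dn_lab2 => ->.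
have cb x y : up beta x y -> dn th x y by rewrite -eu; exact: ca.
have pE g : dom g = dom alpha -> (forall x y, up g x y -> dn th x y) -> phi th g = 0.
  move=> dg cg; apply: Phi0C => // z; case Az: (A z); [left|right].
    by apply: (@tr_cod _ _ z); rewrite tr_lab2 Az.
  case: (L1) => _ /(_ (pi k))[x e] _; exists x; first by rewrite dg (tlab_dom L1) e.
  by rewrite dn_lab2 Az /A e (inj_eq (@Some_inj _)) (negPf nk).
have h1 := sL cong th h; rewrite !pE ?addn0 // in h1.
have ca' : forall y, (y \in cod (pmul th alpha)) = (b y == Some k).
  move=> y; apply/codP/eqP => [[x /(trCP ca)[z]]|e].
    rewrite tr_lab2 /A => /eqP/esym/eqP e; by rewrite (tlab_tr L1 _ e) => /eqP.
  case: (L1) => _ /(_ k)[x ex] _; exists x; apply/(trCP ca); exists x.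
    by rewrite tr_lab2 /A ex eqxx.
  by rewrite (tlab_tr L1 _ ex) e.
have cb' : forall y, (y \in cod (pmul th beta)) = (b y == Some (pi k)).
  move=> y; apply/codP/eqP => [[x /(trCP cb)[z]]|e].
    rewrite tr_lab2 /A => /eqP/esym/eqP e.
    have e' : pact pi a z = Some (pi k) by rewrite /pact e.
    by rewrite (tlab_tr L2 _ e') => /eqP.
  case: (L1) => _ /(_ k)[x ex] _; exists x; apply/(trCP cb); exists x.
    by rewrite tr_lab2 /A ex eqxx.
  have e' : pact pi a x = Some (pi k) by rewrite /pact ex.
  by rewrite (tlab_tr L2 _ e') e.
have tot g x y : up (pmul th g) x y by apply: up_mul_sub; rewrite up_lab2.
have r1 g : cod (pmul th g) != set0 -> rank (pmul th g) = 1.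
  move=> c; apply/eqP; rewrite eqn_leq rank_pos_cod c andbT.
  by have := @rank_le n unit (fun _ => tt) (pmul th g); rewrite card_unit; apply=> x y _;
    exact: tot.
have ord2 (p p' : 'I_2) : p != k -> p' != k -> p = p'.
  by rewrite -!(inj_eq val_inj); move=> h2 h3; apply: val_inj; move: h2 h3;
    case: p p' k {nk A th cA ca cb pE h1 ca' cb' tot r1} => [p hp] [p' hp'] [r hr] /=; lia.
have dE g (a1 : 'I_n -> option 'I_2) : tlab g a1 b -> (forall x y, up g x y -> dn th x y) ->
   dom g = dom alpha -> up g =2 up alpha -> dn (pmul th g) =2 dn g.
  move=> L cg dg ug x y; apply/(dnCP cg)/idP => [[//|[z [z' [zx zy]]]]|hh]; last by left.
  rewrite dn_lab2 => /eqP e; apply: (@tr_dn2 _ _ z) => //.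
  have := tr_dom zx; have := tr_dom zy; rewrite dg !(tlab_dom L1).
  case e1: (a z') => [m'|//] _; case e2: (a z) => [m|//] _.
  have mm : m = m'.
    move: e; rewrite /A e1 e2 !(inj_eq (@Some_inj _)).
    case: (eqVneq m k) => [->|nm]; first by move/esym/eqP.
    by case: (eqVneq m' k) => // nm' _; apply: ord2.
  by apply: up_tr zy; rewrite ug (tlab_up L1 _ e2) e1 mm.
exists (pmul th alpha), (pmul th beta); split=> //.
- apply: r1; case: (L1) => _ _ /(_ k)[y e]; apply/set0Pn; exists y; by rewrite ca' e.
- apply: r1; case: (L1) => _ _ /(_ (pi k))[y e]; apply/set0Pn; exists y; by rewrite cb' e.
- apply/hatP; split=> x y; first by rewrite !tot.
  by rewrite (dE _ _ L1) // (dE _ _ L2) // => u v; rewrite eu.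
- move=> E; case: (L1) => _ _ /(_ k)[y e]; have := ca' y; rewrite E cb' e eqxx.
  by rewrite (inj_eq (@Some_inj _)) eq_sym (negPf nk).
Qed.

End Pairs.

Section DualPairs.
Variables n d : nat.
Variable x0 : 'I_n.
Implicit Types (alpha beta gamma : partn n) (x y z : 'I_n).
Variable sigma : twisted n d -> twisted n d -> Prop.
Hypothesis cong : congruence (@tmul n d) sigma.
Notation s i a j b := (sigma (elt d i a) (elt d j b)).

Lemma Rpair_dual i : Rpair sigma i -> Lpair (dual_rel sigma) i.
Proof.
case=> alpha [beta [ra rb h ne hs]]; exists (dual alpha), (dual beta).
by rewrite !rank_dual !hat_dual h !dom_dual s_dual_rel !dualK.
Qed.

Lemma Rpair_spread i alpha beta : Rpair sigma i -> rank alpha = 1 -> rank beta = 1 ->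
  hat alpha = hat beta -> dom alpha = dom beta -> s i alpha i beta.
Proof.
move=> /Rpair_dual R ra rb h ed.
have := Lpair_spread (dual_rel_cong cong) R (alpha' := dual alpha) (beta' := dual beta).
by rewrite !rank_dual !hat_dual h !cod_dual s_dual_rel !dualK; apply.
Qed.

Lemma Rpair_link i : Rpair sigma i -> s i.+1 (omega n) i (omega0 n).
Proof.
by move/Rpair_dual/(Lpair_link (dual_rel_cong cong)); rewrite s_dual_rel dual_omega dual_omega0.
Qed.

Lemma perm2_Lpair i alpha beta (a b : 'I_n -> option 'I_2) (pi : 'S_2) :
  tlab alpha a b -> tlab beta (pact pi a) b -> greenH alpha beta -> pi != 1%g ->
  s i alpha i beta -> Lpair sigma i.
Proof.
move=> L1 L2 H npi h.
have L2' : tlab (dual beta) (pact (pi^-1)%g b) a.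
  apply: tlab_ext (tlab_act (pi^-1)%g (tlab_dual L2)) => // x.
  by rewrite pactM mulgV pact1.
have H' : greenH (dual alpha) (dual beta).
  by move: H; rewrite /greenH greenR_dual greenL_dual' andbC.
have npi' : (pi^-1 != 1)%g by rewrite invg_eq1.
have := perm2_Rpair (dual_rel_cong cong) (tlab_dual L1) L2' H' npi' (i := i).
rewrite s_dual_rel !dualK => /(_ h)[al [be [ra rb hh ne hs]]].
exists (dual al), (dual be); rewrite !rank_dual !hat_dual hh !dom_dual; split=> //.
by rewrite -s_dual_rel.
Qed.
End DualPairs.

(** * The matrix of a congruence *)

Notation decide P := (boolp.asbool P).
Lemma decideP P : reflect P (decide P). Proof. exact: boolp.asboolP. Qed.

Section Mix.
Variable n : nat.
Implicit Types (alpha beta gamma : partn n) (x y z : 'I_n).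

(** The intermediate step between two partitions of rank one that differ both
    in domain and in codomain: it splits their relation into one of L-pairs and
    one of R-pairs. *)
Lemma rank1_mix alpha beta : rank alpha = 1 -> rank beta = 1 -> hat alpha = hat beta ->
  exists gamma, [/\ rank gamma = 1, hat gamma = hat alpha,
    dom gamma = dom beta & cod gamma = cod alpha].
Proof.
move=> ra rb /hatP[eu el].
have la : rank alpha <= 1 by rewrite ra.
have lb : rank beta <= 1 by rewrite rb.
have /rank_gt0P[xb xbd] : 0 < rank beta by rewrite rb.
have /rank_gt0P[xa /domP[ya /tr_cod yac]] : 0 < rank alpha by rewrite ra.
pose f (u : vertex n) : (unit + (bool * {set vertex n}))%type := match u with
  | inl x => if dom_lab beta x is inr B then inr (true, B) else inl tt
  | inr y => if cod_lab alpha y is inr B then inr (false, B) else inl tt end.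
pose gamma := Lab f.
have ug x x' : up gamma x x' = up beta x x'.
  by rewrite [RHS]dom_labE // /up same_block_Lab /f;
    case: (dom_lab _ x) (dom_lab _ x') => [[]|B] [[]|B'].
have dg x x' : dn gamma x x' = dn alpha x x'.
  by rewrite [RHS]cod_labE // /dn same_block_Lab /f;
    case: (cod_lab _ x) (cod_lab _ x') => [[]|B] [[]|B'].
have tg x y : tr gamma x y = (x \in dom beta) && (y \in cod alpha).
  by rewrite /tr same_block_Lab /f /cod_lab /dom_lab dom_dual; case: ifP; case: ifP.
have domg : dom gamma = dom beta.
  apply/setP => x; apply/domP/idP => [[y]|xd]; first by rewrite tg => /andP[].
  by exists ya; rewrite tg xd.
have codg : cod gamma = cod alpha.
  apply/setP => x; apply/codP/idP => [[y]|xd]; first by rewrite tg => /andP[].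
  by exists xb; rewrite tg xd xbd.
exists gamma; split=> //; last by apply/hatP; split=> // x y; rewrite ug eu.
by rewrite -rb; apply: rank_eqR.
Qed.

Lemma twist_exists q alpha (a b : 'I_n -> option 'I_q) (pi : 'S_q) : tlab alpha a b ->
  exists beta, tlab beta (pact pi a) b /\ greenH alpha beta.
Proof.
move=> L; pose c x : ('I_q + {set vertex n})%type := if a x is Some k then inl (pi k)
   else inr (pblock (blocks alpha) (inl x)).
pose f (u : vertex n) : ('I_q + (bool * {set vertex n}))%type := match u with
  | inl x => match clab alpha a x with inl k => inl (pi k) | inr B => inr (true, B) end
  | inr x => match dlab alpha b x with inl k => inl k | inr B => inr (false, B) end end.
pose beta := Lab f.
have ug x x' : up beta x x' = up alpha x x'.
  rewrite (clab_up L) /up same_block_Lab /f;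
    case: (clab alpha a x) (clab alpha a x') => [k|B] [k'|B'] //.
  by rewrite !(inj_eq (@inl_inj _ _)) (inj_eq perm_inj).
have dg x x' : dn beta x x' = dn alpha x x'.
  by rewrite (dlab_dn L) /dn same_block_Lab /f;
    case: (dlab alpha b x) (dlab alpha b x') => [k|B] [k'|B'].
have L2 : tlab beta (pact pi a) b.
  case: (L) => h1 h2 h3; split=> [x y|k|k //].
    rewrite /tr same_block_Lab /f /dlab /clab /pact; case: (a x) (b y) => [k|] [l|] //=.
    by rewrite andbT.
  by case: (h2 (pi^-1%g k)) => x e; exists x; rewrite /pact e /= permKV.
exists beta; split=> //; apply/andP; split.
  apply/greenRP; split=> [x y|]; first by rewrite ug.
  by apply/setP => x; rewrite (tlab_dom L) (tlab_dom L2) /pact; case: (a x).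
apply/greenLP; split=> [x y|]; first by rewrite dg.
by apply/setP => x; rewrite (tlab_cod L) (tlab_cod L2).
Qed.

Lemma tlab_eq q alpha beta (a b : 'I_n -> option 'I_q) : tlab alpha a b -> tlab beta a b ->
  greenH alpha beta -> alpha = beta.
Proof.
move=> [h1 _ _] [h2 _ _] /andP[/greenRP[eu _] /greenLP[el _]].
by apply: partn_ext3 => // x y; rewrite h1 h2.
Qed.
End Mix.

Lemma threshold (P : nat -> bool) m : (forall i j, i <= j -> P i -> P j) -> P m ->
  exists2 k, k <= m & forall i, P i = (k <= i).
Proof.
move=> mono Pm; have ex : exists k, P k by exists m.
case: (ex_minnP ex) => k Pk km; exists k => [|i]; first exact: km.
by apply/idP/idP => [/km//|ki]; apply: mono Pk.
Qed.

Section Assembly.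
Variables n d : nat.
Variable x0 : 'I_n.
Implicit Types (alpha beta gamma : partn n) (x y z : 'I_n).
Variable sigma : twisted n d -> twisted n d -> Prop.
Hypothesis cong : congruence (@tmul n d) sigma.
Notation s i a j b := (sigma (elt d i a) (elt d j b)).
Notation in_zero := (zero_class sigma).

Definition zero_row q i := decide (forall alpha, rank alpha = q -> in_zero i alpha).

Lemma zero_rowP i alpha : reflect (in_zero i alpha) (zero_row (rank alpha) i).
Proof.
apply: (iffP (decideP _)) => [|I beta rb]; first exact.
by apply: (in_zero_reach x0 cong I); rewrite ?rb.
Qed.

Lemma zero_row_mono q q' i i' : q <= n -> q' <= q -> i <= i' -> zero_row q i -> zero_row q' i'.
Proof.
move=> qn; have [alpha <-] := rank_exists qn => q'q ii' /zero_rowP I.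
by apply/decideP => beta rb; apply: (in_zero_reach x0 cong I) => //; rewrite rb.
Qed.

Lemma zero_row_big q i : d < i -> zero_row q i.
Proof. by move=> di; apply/decideP => alpha _; exact: in_zero_big. Qed.

Lemma zero_row_thr q : q <= n -> exists2 k, k <= d.+1 & forall i, zero_row q i = (k <= i).
Proof.
move=> qn; apply: threshold => [i j ij|]; last exact: zero_row_big.
exact: zero_row_mono.
Qed.

(** Quantifying over all pairs with difference [pi] gives the group laws at
    once; by [Nset_in] one related pair is enough for membership. *)
Definition Nset q i : {set 'S_q.+2} := [set pi | decide (forall alpha beta (a b : 'I_n ->
  option 'I_q.+2),
   tlab alpha a b -> tlab beta (pact pi a) b -> greenH alpha beta -> s i alpha i beta)].

Lemma NsetP q i (pi : 'S_q.+2) : reflect (forall alpha beta (a b : 'I_n -> option 'I_q.+2),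
   tlab alpha a b -> tlab beta (pact pi a) b -> greenH alpha beta ->
     s i alpha i beta) (pi \in Nset q i).
Proof. by rewrite inE; apply: decideP. Qed.

Lemma Nset_in q i alpha beta (a b : 'I_n -> option 'I_q.+2) pi :
  tlab alpha a b -> tlab beta (pact pi a) b -> greenH alpha beta -> s i alpha i beta ->
  pi \in Nset q i.
Proof.
by move=> L1 L2 H h; apply/NsetP => al be a' b' L1' L2' H';
  apply: (perm_spread cong L1 L2 H L1' L2' H' h).
Qed.

Lemma Nset_group q i : group_set (Nset q i).
Proof.
apply/group_setP; split.
  apply/NsetP => alpha beta a b L1 L2 H.
  have L2' : tlab beta a b by apply: tlab_ext L2 => // x; rewrite pact1.
  by rewrite (tlab_eq L1 L2' H); exact: sig_refl.
move=> pi rho /NsetP h1 /NsetP h2; apply/NsetP => alpha gamma a b L1 L3 H.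
have [beta [L2 H1]] := twist_exists pi L1.
apply: (sig_trans cong (h1 _ _ _ _ L1 L2 H1)); apply: (h2 _ _ _ _ L2).
  by apply: tlab_ext L3 => // x; rewrite pactM.
case/andP: H1 => r1 l1; case/andP: H => r2 l2; apply/andP; split.
  by apply: greenR_trans r2; rewrite greenR_sym.
by apply: greenL_trans l2; rewrite greenL_sym.
Qed.
Definition Ngrp q i : {group 'S_q.+2} := Group (Nset_group q i).

Lemma Ngrp_normal q i : (Ngrp q i <| [set: 'S_q.+2])%g.
Proof.
apply/andP; split; first exact: subsetT.
apply/subsetP => rho _; rewrite inE; apply/subsetP => _ /imsetP[pi /NsetP h ->].
apply/NsetP => alpha beta a b L1 L2 H.
apply: (h _ _ _ _ (tlab_act (rho^-1)%g L1) _ H).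
apply: tlab_ext (tlab_act (rho^-1)%g L2) => // x.
by rewrite !pactM conjgE -!mulgA mulgV mulg1.
Qed.

Lemma Ngrp_mono q i j : i <= j -> Ngrp q i \subset Ngrp q j.
Proof.
move=> ij; apply/subsetP => pi /NsetP h; apply/NsetP => alpha beta a b L1 L2 H.
by have := sshift cong (j - i) (h _ _ _ _ L1 L2 H); rewrite subnKC.
Qed.

(** Links connect rank 1 and rank 0. A single one relates each rank-one
    partition at level [i] to its hat at level [j] ([link_spread]). *)
Definition linked i j := s i (omega n) j (omega0 n).
Definition linked_top i := decide (exists j, linked i j).
Definition linked_bot j := decide (exists i, linked i j).
Definition rpairb i := decide (Rpair sigma i).
Definition lpairb i := decide (Lpair sigma i).

(** In row 1, [Mu] stands where all pairs with equal hats are related. A link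
    does this, with the common hat as the intermediate element; and so do L-pairs
    and R-pairs together, through [rank1_mix]. *)
Definition symbol_at q i : symbol :=
  if zero_row q i then RR else
  match q with
  | 0 => if linked_bot i then Mu else Delta
  | 1 => if linked_top i || (rpairb i && lpairb i) then Mu else if rpairb i then MuUp
         else if lpairb i then MuDown else Delta
  | q.+2 => if Ngrp q i :==: 1%g then Delta else Nsym (Ngrp q i)
  end.

Definition matrix_of : 'M[symbol]_(n.+1, d.+1) := \matrix_(q, i) symbol_at q i.

Lemma entryM q i : q <= n -> i <= d -> entry matrix_of q i = symbol_at q i.
Proof. by move=> qn id; rewrite /entry mxE !inordK. Qed.

Lemma xentryM q i : q <= n -> xentry matrix_of q i = symbol_at q i.
Proof.
move=> qn; case: (leqP i d) => id; first by rewrite xentryE // entryM.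
by rewrite xentry_big // /symbol_at zero_row_big.
Qed.

Lemma is_R_symbol_at q i : is_R (symbol_at q i) = zero_row q i.
Proof.
rewrite /symbol_at; case: (zero_row q i) => //; case: q => [|[|q]]; do ! case: ifP => //.
Qed.
Lemma symbol_R q i : symbol_at q i = RR <-> zero_row q i.
Proof. by rewrite -is_R_symbol_at; case: (symbol_at q i). Qed.

Lemma n_gt0 : 0 < n. Proof. by apply: leq_ltn_trans (ltn_ord x0). Qed.

Lemma linked_shift c i j : linked i j -> linked (i + c) (j + c).
Proof. exact: sshift. Qed.

Lemma omega_zero_row i : in_zero i (omega n) <-> zero_row 1 i.
Proof.
have h := zero_rowP i (omega n); rewrite (rank_omega x0) in h.
by split=> I; apply/h.
Qed.
Lemma omega0_zero_row i : in_zero i (omega0 n) <-> zero_row 0 i.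
Proof.
have h := zero_rowP i (omega0 n); rewrite rank_omega0 in h.
by split=> I; apply/h.
Qed.

Lemma linked_zero_row i j : linked i j -> zero_row 1 i = zero_row 0 j.
Proof.
move=> h; apply/idP/idP => [/omega_zero_row I|/omega0_zero_row I].
  by apply/omega0_zero_row; apply: (s_in_zero' cong h).
by apply/omega_zero_row; apply: (s_in_zero cong h).
Qed.

Lemma linked_omega0 i j : linked i j -> s i (omega0 n) j.+1 (omega0 n).
Proof. exact: (link_omega0 x0 cong). Qed.

Lemma in_zero_lt q i k : (forall i, zero_row q i = (k <= i)) -> ~~ zero_row q i = (i < k).
Proof. by move=> ->; rewrite -ltnNge. Qed.

(** Both ends of a link move together under shifts and reach the class of zero
    at the same time, so their distances to the thresholds agree. Besides,
    [omega0] at level [i] is related to [omega0] at level [j + 1]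
    ([link_omega0]): these levels are equal, or both lie beyond the threshold. *)
Lemma linked_facts m0 m1 i j : (forall i, zero_row 0 i = (m0 <= i)) ->
  (forall i, zero_row 1 i = (m1 <= i)) ->
  linked i j -> i < m1 \/ j < m0 ->
  [/\ i < m1, j < m0, i + m0 = j + m1 & i = j.+1 \/ j.+1 = m0 /\ j.+1 < i].
Proof.
move=> z0 z1 h ij.
have E c : (m1 <= i + c) = (m0 <= j + c) by rewrite -z0 -z1; apply: linked_zero_row;
  apply: linked_shift.
have := E 0; rewrite !addn0 => E0.
have im : i < m1 by lia.
have jm : j < m0 by lia.
have e1 := E (m1 - i); have e2 := E (m0 - j).
have e3 : i + m0 = j + m1 by lia.
split=> //; case: (ltngtP i j.+1) => [lt|lt|]; last by left.
  have /omega0_zero_row : in_zero i (omega0 n) by apply: (s_iter cong lt); exact: linked_omega0.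
  by rewrite z0; lia.
have /omega0_zero_row : in_zero j.+1 (omega0 n) by apply: (s_iter cong lt);
  apply: (sig_sym cong); exact: linked_omega0.
by rewrite z0 => mj; right; lia.
Qed.

Lemma Lpair_linked i : Lpair sigma i -> linked i.+1 i. Proof. exact: Lpair_link. Qed.
Lemma Rpair_linked i : Rpair sigma i -> linked i.+1 i. Proof. exact: Rpair_link. Qed.

Lemma symbol1_Delta j : ~~ zero_row 1 j -> ~ (exists j', linked j j') -> ~ linked j.+1 j ->
  symbol_at 1 j = Delta.
Proof.
move=> z nl nt; rewrite /symbol_at (negPf z).
have -> : linked_top j = false by apply/decideP.
have -> : rpairb j = false by apply/decideP => /Rpair_linked.
by have -> : lpairb j = false by apply/decideP => /Lpair_linked.
Qed.

Lemma symbol1_zeta j : ~~ zero_row 1 j -> is_zeta (symbol_at 1 j).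
Proof.
move=> z; rewrite /symbol_at (negPf z); case: ifP => _; first by constructor 1.
case: ifP => _; first by constructor 2.
by case: ifP => _; [constructor 3|constructor 4].
Qed.

Lemma symbol1_Mu i j : ~~ zero_row 1 i -> linked i j -> symbol_at 1 i = Mu.
Proof.
move=> z h; rewrite /symbol_at (negPf z).
by have -> : linked_top i by apply/decideP; exists j.
Qed.
Lemma symbol0_Mu i j : ~~ zero_row 0 j -> linked i j -> symbol_at 0 j = Mu.
Proof.
move=> z h; rewrite /symbol_at (negPf z).
by have -> : linked_bot j by apply/decideP; exists i.
Qed.
Lemma symbol0_Delta j : ~~ zero_row 0 j -> ~ (exists i, linked i j) -> symbol_at 0 j = Delta.
Proof.
move=> z h; rewrite /symbol_at (negPf z).
by have -> : linked_bot j = false by apply/decideP.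
Qed.

(** By [linked_facts] a link outside the class of zero either goes from level
    [j + 1] to level [j] or stands immediately before both thresholds, and the
    former needs consecutive thresholds. *)
Lemma rows01 : [\/ fRT1 matrix_of, fRT2 matrix_of, fRT3 matrix_of | fRT4 matrix_of].
Proof.
have n1 := n_gt0.
have [m0 m0d z0] := zero_row_thr (leq0n n); have [m1 m1d z1] := zero_row_thr n1.
have m01 : m0 <= m1.
  have : zero_row 0 m1 by apply: (@zero_row_mono 1 _ m1) => //; rewrite z1.
  by rewrite z0.
have RR0 j : m0 <= j -> symbol_at 0 j = RR by rewrite -z0 => /symbol_R.
have RR1 j : m1 <= j -> symbol_at 1 j = RR by rewrite -z1 => /symbol_R.
have nz0 j : j < m0 -> ~~ zero_row 0 j by rewrite z0 -ltnNge.
have nz1 j : j < m1 -> ~~ zero_row 1 j by rewrite z1 -ltnNge.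
(* Without links outside the class of zero, only the last entry of row 1 before its
   threshold can be other than Delta: pairs there give a link inside that class. *)
case: (boolp.pselect (exists i j, linked i j /\ i < m1)) => [|nolink]; last first.
  have D0 j : j < m0 -> symbol_at 0 j = Delta.
    move=> jm; apply: symbol0_Delta; first exact: nz0.
    case=> i h; apply: nolink; exists i, j; split=> //.
    by case: (linked_facts z0 z1 h (or_intror jm)).
  have D1 j : j.+1 < m1 \/ j < m0 /\ j < m1 -> symbol_at 1 j = Delta.
    move=> jm; apply: symbol1_Delta; first by apply: nz1; lia.
      by case=> j' h; apply: nolink; exists j, j'; split=> //; lia.
    move=> h; case: (ltnP j.+1 m1) => jm1; first by apply: nolink; exists j.+1, j.
    have jm0 : j < m0 by lia.
    by apply: nolink; exists j.+1, j; split=> //; case: (linked_facts z0 z1 h (or_intror jm0)).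
  move: m01; rewrite leq_eqVlt => /orP[/eqP e01|lt01].
    subst m1; constructor 1; exists m0 => // j jd; rewrite !entryM //.
    by case: (ltnP j m0) => jm; [rewrite D0 // D1 //; right|rewrite RR0 // RR1].
  constructor 3; exists m0, m1, (symbol_at 1 m1.-1); split=> //.
    by apply: symbol1_zeta; apply: nz1; lia.
  move=> j jd; rewrite !entryM //; split.
    by case: (ltnP j m0) => jm; [rewrite D0|rewrite RR0].
  case: (ltnP j.+1 m1) => jm; first by rewrite D1 //; left.
  case: eqP => [<- //|ne]; rewrite RR1 //; lia.
case=> i [j [h im]].
have [_ jm e ij] := linked_facts z0 z1 h (or_introl im).
(* If the thresholds are not consecutive, the only link stands immediately before them. *)
case: (eqVneq m1 m0.+1) => [e1|ne1]; last first.
  have jm0 : j.+1 = m0 by lia.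
  have im1 : i.+1 = m1 by lia.
  constructor 4; exists m0, m1; split; [by lia|by lia|by lia|] => j' jd; rewrite !entryM //; split.
    case: (ltnP j'.+1 m0) => jm'.
      apply: symbol0_Delta; first by apply: nz0; lia.
      case=> i' h'; have jm2 : j' < m0 by lia.
      by case: (linked_facts z0 z1 h' (or_intror jm2)) => _ _ e' []; lia.
    case: eqP => ej; last by rewrite RR0 //; lia.
    have -> : j' = j by lia.
    by apply: symbol0_Mu h; apply: nz0.
  case: (ltnP j'.+1 m1) => jm'.
    apply: symbol1_Delta; first by apply: nz1; lia.
      case=> i' h'; have jm2 : j' < m1 by lia.
      by case: (linked_facts z0 z1 h' (or_introl jm2)) => _ _ e' []; lia.
    by move=> h'; case: (linked_facts z0 z1 h' (or_introl jm')) => _ _ e' []; lia.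
  case: eqP => ej; last by rewrite RR1 //; lia.
  have -> : j' = i by lia.
  by apply: symbol1_Mu h; apply: nz1.
(* If they are consecutive, all links go from level k + 1 to level k, and they occur
   from a first k on. *)
subst m1; have ei : i = j.+1 by lia.
subst i; have exi : exists k, decide (linked k.+1 k) by exists j; apply/decideP.
case: (ex_minnP exi) => i0 /decideP h0 min0.
have i0j : i0 <= j by apply: min0; apply/decideP.
have up0 k : i0 <= k -> linked k.+1 k.
  by move=> ik; have := linked_shift (k - i0) h0; rewrite addSn subnKC.
have lo k : k < m0 -> linked k.+1 k -> i0 <= k by move=> _ hk; apply: min0; apply/decideP.
constructor 2; exists i0, m0, (symbol_at 1 i0); split=> //; [by lia|by apply: symbol1_zeta;
  apply: nz1; lia|].
move=> k kd; rewrite !entryM //; split.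
  case: (ltnP k i0) => ki.
    apply: symbol0_Delta; first by apply: nz0; lia.
    case=> i' h'; have km : k < m0 by lia.
    case: (linked_facts z0 z1 h' (or_intror km)) => _ _ e' _.
    by have ei : i' = k.+1 by [lia]; subst i'; have := lo k km h'; lia.
  case: (ltnP k m0) => km; last by rewrite RR0.
  by apply: symbol0_Mu (up0 k ki); apply: nz0.
case: (ltnP k i0) => ki.
  apply: symbol1_Delta; first by apply: nz1; lia.
    case=> j' h'; have km : k < m0.+1 by lia.
    case: (linked_facts z0 z1 h' (or_introl km)) => _ jm' e' _.
    by have ek : k = j'.+1 by [lia]; subst k; have := lo j' jm' h'; lia.
  by move=> h'; have km : k < m0 by [lia]; have := lo k km h'; lia.
case: eqP => [-> //|ne]; case: (leqP k m0) => km; last by rewrite RR1.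
case: k {kd} ki ne km => [|k] ki ne km; first by lia.
apply: (symbol1_Mu (j := k)); first by apply: nz1.
by apply: up0; lia.
Qed.

Lemma symbol_N q i : is_N (symbol_at q.+2 i) -> exists2 pi, pi \in Ngrp q i & pi != 1%g.
Proof.
rewrite /symbol_at; case: ifP => // _; case: ifP => // /negbT nt _.
by case/trivgPn: nt => pi; exists pi.
Qed.

Lemma fC_matrix_of : fC_matrix matrix_of.
Proof.
split; first exact: rows01.
- case=> [|[|q]] // /andP[_ qn].
  have [k kd zk] := zero_row_thr qn.
  have mono j j' : j <= j' -> zero_row q.+2 j || (Ngrp q j :!=: 1%g) ->
      zero_row q.+2 j' || (Ngrp q j' :!=: 1%g).
    move=> jj' /orP[z|nt]; first by rewrite (zero_row_mono qn (leqnn _) jj' z).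
    apply/orP; right; apply: contra nt; rewrite -!subG1.
    exact: subset_trans (Ngrp_mono q jj').
  have Pk : zero_row q.+2 k || (Ngrp q k :!=: 1%g) by rewrite zk leqnn.
  have [i ik Pi] := threshold mono Pk.
  exists i, k, (Ngrp q); split; first by rewrite ik.
  + move=> j /andP[ij jk]; split; first exact: Ngrp_normal.
    by have := Pi j; rewrite ij zk leqNgt jk.
  + by move=> j j' _ jj' _; apply: Ngrp_mono.
  + move=> j jd; rewrite entryM // /symbol_at zk.
    have := Pi j; rewrite zk; case: (ltnP j i) => ji.
      move/negbT; rewrite negb_or -ltnNge negbK => /andP[jk /eqP->].
      by rewrite leqNgt jk /= eqxx.
    case: (leqP k j) => jk //=.
    by move=> /negPf ->.
- move=> q i qn id; rewrite !entryM //; last exact: ltnW.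
  case: q qn => [|q] qn; first by rewrite /symbol_at; case: ifP => //; case: ifP => //;
    case: ifP => //; case: ifP.
  case/symbol_N => pi /NsetP hpi npi.
  have [alpha ra] := rank_exists qn.
  have [a [b L1]] := tlab_exists ra; have [beta [L2 H]] := twist_exists pi L1.
  have h := hpi _ _ _ _ L1 L2 H.
  case: q qn pi hpi npi alpha ra a b L1 L2 H h => [|q] qn pi hpi npi alpha ra a b L1 L2 H h.
    (* Over row 1 both kinds of pairs appear, so the entry there is Mu or RR. *)
    have hL := perm2_Lpair cong L1 L2 H npi h; have hR := perm2_Rpair cong L1 L2 H npi h.
    rewrite /symbol_at; case: ifP => _; first by case.
    have -> : rpairb i by apply/decideP.
    have -> : lpairb i by apply/decideP.
    by rewrite orbT; case.
  have -> : symbol_at q.+2 i = RR.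
    apply/symbol_R/decideP => zeta rz; apply: (perm_kill x0 cong _ L1 L2 H npi h) => //.
    by rewrite rz.
  by case.
- move=> q i /andP[q1 qn] id; rewrite !entryM //; last by lia.
  by move/symbol_R => z; apply/symbol_R; apply: zero_row_mono z => //; lia.
Qed.

Lemma min_rowM q k : q <= n -> k <= d.+1 -> (forall i, zero_row q i = (k <= i)) ->
  min_row matrix_of q = k.
Proof.
by move=> qn kd z; apply: min_rowE => // j jd; rewrite entryM // is_R_symbol_at z.
Qed.

(** In rank at most 1 all kernels of a related pair agree, on both sides. *)
Lemma related_hat i alpha j beta : s i alpha j beta -> rank alpha <= 1 -> rank beta <= 1 ->
  ~ in_zero i alpha -> hat alpha = hat beta.
Proof.
move=> h ra rb nI; have h' := sig_sym cong h;
  have nI' : ~ in_zero j beta by move/(s_in_zero cong h).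
have nn (P : bool) : (~~ P -> False) -> P by case: P => // /(_ isT).
apply/hatP; split=> x y; apply/idP/idP => u; apply: nn => nu.
- by apply: nI'; apply: (split_kernel_zero x0 cong h rb u nu).
- by apply: nI; apply: (split_kernel_zero x0 cong h' ra u nu).
- by apply: nI'; apply: (split_cokernel_zero x0 cong h rb u nu).
- by apply: nI; apply: (split_cokernel_zero x0 cong h' ra u nu).
Qed.

Lemma s_xcg_high i alpha j beta : s i alpha j beta -> 1 < rank alpha -> ~ in_zero i alpha ->
  xcg matrix_of i alpha j beta.
Proof.
move=> h ra nI; have [ij re H] := related_H x0 cong h ra nI; subst j.
have rn := rank_le_n alpha; have nz : ~~ zero_row (rank alpha) i by apply/negP => /zero_rowP.
case rq: (rank alpha) ra rn nz => [|[|q]] // _ rn nz.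
have [a [b L1]] := tlab_exists rq; have [pi L2] := greenH_tlab H L1.
have piN := Nset_in L1 L2 H h.
case: (eqVneq pi 1%g) => [e1|n1].
  have L2' : tlab beta a b by apply: tlab_ext L2 => // x; rewrite e1 pact1.
  by constructor 1; left; rewrite (tlab_eq L1 L2' H).
constructor 2; rewrite rq; exists (Ngrp q i).
  split=> //; rewrite xentryM // /symbol_at (negPf nz) ifF //; apply/negbTE/trivgPn.
  by exists pi.
split=> //; exists pi => //; apply/perm_diffP; by exists a, b.
Qed.

Lemma s_xcg10 i alpha j beta : s i alpha j beta -> ~ in_zero i alpha ->
  rank alpha = 1 -> rank beta = 0 -> xcg matrix_of i alpha j beta.
Proof.
move=> h nI ra rb.
have n1 := n_gt0; have [m0 m0d z0] := zero_row_thr (leq0n n); have [m1 m1d z1] := zero_row_thr n1.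
have nI' : ~ in_zero j beta by move/(s_in_zero cong h).
have nz1 : ~~ zero_row 1 i by rewrite -ra; apply/negP => /zero_rowP.
have nz0 : ~~ zero_row 0 j by rewrite -rb; apply/negP => /zero_rowP.
have hl : linked i j by have := s_omegar cong h; rewrite /omegar ra rb.
have im : i < m1 by rewrite -(in_zero_lt _ z1).
have [_ _ e _] := linked_facts z0 z1 hl (or_introl im).
constructor 4; rewrite ra rb !xentryM // (min_rowM _ _ z0) // (min_rowM _ _ z1) //; split=> //.
- exact: symbol1_Mu hl.
- exact: symbol0_Mu hl.
- by apply: related_hat h _ _ nI; rewrite ?ra ?rb.
Qed.

(** Which of the symbols [MuUp], [MuDown], [Mu] is needed depends on whether
    the codomains differ, the domains, or both. *)
Lemma s_xcg11 i alpha j beta : s i alpha j beta -> ~ in_zero i alpha ->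
  rank alpha = 1 -> rank beta = 1 -> xcg matrix_of i alpha j beta.
Proof.
move=> h nI ra rb; have n1 := n_gt0.
have la : rank alpha <= 1 by rewrite ra.
have lb : rank beta <= 1 by rewrite rb.
have hh := related_hat h la lb nI; have [eu el] := (hatP _ _).1 hh.
have ij : i = j by apply: (related_level x0 cong h) nI; rewrite ?ra ?rb.
subst j; have nz1 : ~~ zero_row 1 i by rewrite -ra; apply/negP => /zero_rowP.
have mu : symbol_at 1 i = Mu -> xcg matrix_of i alpha i beta.
  by move=> e; constructor 4; rewrite ra rb !xentryM.
case: (eqVneq (dom alpha) (dom beta)) => [ed|/eqP nd];
  case: (eqVneq (cod alpha) (cod beta)) => [ec|/eqP nc].
- by constructor 1; left; rewrite (rank1_ext la lb hh ed ec).
- have R : rpairb i by apply/decideP; exists alpha, beta.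
  move: mu; rewrite /symbol_at (negPf nz1) R /=; case E: (linked_top i || lpairb i) => mu;
    first exact: mu.
  constructor 3; split=> //; right; split; last by apply/greenRP.
  by rewrite xentryM // /symbol_at (negPf nz1) R E.
- have R : lpairb i by apply/decideP; exists alpha, beta.
  move: mu; rewrite /symbol_at (negPf nz1) R /= andbT;
    case E: (linked_top i || rpairb i) => mu; first exact: mu.
  constructor 3; split=> //; left; split; last by apply/greenLP.
  by rewrite xentryM // /symbol_at (negPf nz1) R andbT E; move/negbT: E;
    rewrite negb_or => /andP[_ /negPf ->].
- apply: mu; rewrite /symbol_at (negPf nz1).
  have -> : rpairb i by apply/decideP; exists alpha, beta.
  have -> : lpairb i by apply/decideP; exists alpha, beta.
  by rewrite orbT.
Qed.

Lemma s_xcg i alpha j beta : s i alpha j beta -> xcg matrix_of i alpha j beta.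
Proof.
move=> h; have h' := sig_sym cong h; have rn := rank_le_n alpha; have sn := rank_le_n beta.
case: (boolp.pselect (in_zero i alpha)) => [I|nI].
  constructor 1; right; rewrite !xentryM //; split; apply/symbol_R/zero_rowP => //.
  exact: (s_in_zero cong h').
have nI' : ~ in_zero j beta by move/(s_in_zero cong h).
case: (leqP (rank alpha) 1) => ra; last exact: s_xcg_high.
case: (leqP (rank beta) 1) => rb; last by apply: xcg_sym; apply: s_xcg_high.
case: (posnP (rank alpha)) => ra0; case: (posnP (rank beta)) => rb0.
- have hh := related_hat h ra rb nI.
  constructor 1; left; split; last by rewrite -(hat_id ra0) -(hat_id rb0).
  have := s_omegar cong h; rewrite ra0 rb0 => ho; case: (ltngtP i j) => // lt.
    by case: nI; apply: (in_zero_omegar x0 cong ra); rewrite ra0; apply: (s_iter cong lt).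
  by case: nI'; apply: (in_zero_omegar x0 cong rb); rewrite rb0; apply: (s_iter cong lt);
    apply: sig_sym.
- by apply: xcg_sym; apply: s_xcg10 => //; lia.
- by apply: s_xcg10 => //; lia.
- by apply: s_xcg11 => //; lia.
Qed.

Lemma xcg_s10 i alpha j beta : rank alpha = 1 -> rank beta = 0 -> hat alpha = hat beta ->
  symbol_at 1 i = Mu -> symbol_at 0 j = Mu ->
    i + min_row matrix_of 0 = j + min_row matrix_of 1 -> s i alpha j beta.
Proof.
move=> ra rb hh e1 e0 e.
have n1 := n_gt0; have [m0 m0d z0] := zero_row_thr (leq0n n); have [m1 m1d z1] := zero_row_thr n1.
move: e; rewrite (min_rowM _ _ z0) // (min_rowM _ _ z1) // => e.
have nz0 : ~~ zero_row 0 j by apply/negP => /symbol_R; rewrite e0.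
move: e0; rewrite /symbol_at (negPf nz0); case: ifP => // /decideP[i' hl] _.
have jm : j < m0 by rewrite -(in_zero_lt _ z0).
have [_ _ e' _] := linked_facts z0 z1 hl (or_intror jm).
have ei : i' = i by lia.
subst i'; have := link_spread x0 cong hl ra; by rewrite hh (hat_id rb).
Qed.

Lemma xcg_s i alpha j beta : xcg matrix_of i alpha j beta -> s i alpha j beta.
Proof.
have rn := rank_le_n alpha; have sn := rank_le_n beta; have n1 := n_gt0.
rewrite /xcg !xentryM //.
case=> [[[-> ->]|[e1 e2]]|[N [q1 e1] [<- H [pi P piN]]]|[r1 r2 <- h g]|[e1 e2 [r1 r2] h e3]].
- exact: sig_refl.
- move/symbol_R/zero_rowP: e1 => I1; move/symbol_R/zero_rowP: e2 => I2.
  exact: (sig_trans cong I1 (sig_sym cong I2)).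
- case/perm_diffP: P => a [b [L1 L2]].
  have key q (K : {group 'S_q}) (rho : 'S_q) (a' b' : 'I_n -> option 'I_q) :
     symbol_at q i = Nsym K -> 1 < q -> rho \in K -> tlab alpha a' b' ->
     tlab beta (pact rho a') b' -> s i alpha i beta.
    case: q K rho a' b' => [|[|q]] // K rho a' b'; rewrite /symbol_at; case: ifP => // _;
      case: ifP => // _.
    by move/Nsym_inj <- => _ /NsetP hN L1' L2'; apply: hN L1' L2' H.
  exact: key e1 q1 piN L1 L2.
- case: g => -[e gr].
    have L : Lpair sigma i.
      apply/decideP; move: e; rewrite /symbol_at; do 3! case: ifP => // _; by rewrite /lpairb;
        case: ifP.
    by apply: (Lpair_spread cong L r1 r2 h); case/greenLP: gr.
  have R : Rpair sigma i.
    apply/decideP; move: e; rewrite /symbol_at; do 2! case: ifP => // _; rewrite -/(rpairb i);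
      case: (rpairb i) => //; by case: ifP.
  by apply: (Rpair_spread cong R r1 r2 h); case/greenRP: gr.
- case: (posnP (rank alpha)) => ra0; case: (posnP (rank beta)) => rb0.
  + rewrite ra0 rb0 in e3; have -> : i = j by lia.
    by rewrite -(hat_id ra0) -(hat_id rb0) h; exact: sig_refl.
  + have {}rb0 : rank beta = 1 by lia.
    rewrite ra0 rb0 in e1 e2 e3; apply: (sig_sym cong); apply: xcg_s10 => //; lia.
  + have {}ra0 : rank alpha = 1 by lia.
    by rewrite ra0 rb0 in e1 e2 e3; apply: xcg_s10.
  + have {}rb0 : rank beta = 1 by lia.
    have {}ra0 : rank alpha = 1 by lia.
    rewrite ra0 rb0 in e1 e2 e3; have ij : i = j by lia.
    subst j; move: e1; rewrite /symbol_at; case: ifP => // _; case: ifP;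
      last by do 2! case: ifP => //.
    case/orP => [/decideP[k hl] _|/andP[/decideP hR /decideP hL] _].
      (* Both partitions are linked to their common hat. *)
      have h1 := link_spread x0 cong hl ra0; have := link_spread x0 cong hl rb0.
      by rewrite -h => h2; apply: (sig_trans cong h1 (sig_sym cong h2)).
    have [gamma [rg hg dg cg]] := rank1_mix ra0 rb0 h.
    have h1 : s i alpha i gamma by apply: (Lpair_spread cong hL).
    apply: (sig_trans cong h1); apply: (Rpair_spread cong hR) => //.
    by rewrite hg.
Qed.

Lemma sigma_cg X Y : sigma X Y <-> cg matrix_of X Y.
Proof.
have [i [alpha ->]] := eltP X; have [j [beta ->]] := eltP Y.
split=> [h|/(cg_elt fC_matrix_of) h]; first exact/(cg_elt fC_matrix_of)/s_xcg.
exact: xcg_s.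
Qed.

End Assembly.

Theorem theorem7p3 (n d : nat) (n_ge1 : 1 <= n)
    (sigma : twisted n d -> twisted n d -> Prop) :
  congruence (@tmul n d) sigma <->
  exists2 M : 'M[symbol]_(n.+1, d.+1),
    fC_matrix M & forall x y, sigma x y <-> cg M x y.
Proof.
split=> [cong|[M0 fc h]].
  have x0 : 'I_n := Ordinal n_ge1.
  by exists (matrix_of cong); [exact: (fC_matrix_of x0)|exact: (sigma_cg x0)].
have [[r s t] l m] := cg_congruence fc; split; first split.
- by move=> x; apply/h.
- by move=> x y /h/s/h.
- by move=> x y z /h h1 /h h2; apply/h; apply: t h1 h2.
- by move=> x y z /h/l h1; apply/h.
- by move=> x y z /h/m h1; apply/h.
Qed.
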